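(* Let $r\in\mathbb{N}$, $d>0$, $T>0$, and let $M(r,d,T)=\Gamma_r\backslash G$ be the 3-dimensional Heisenberg manifold. Spin structures on $M(r,d,T)$ correspond to triples $\delta=(\delta_1,\delta_2,\delta_3)\in\{-1,1\}^3$, where the case $\delta_3=-1$ occurs if and only if $r$ is even. The eigenvalues of the Dirac operator on $M(r,d,T)$ with the spin structure given by $\delta$ are as follows. **A.** If $\delta_3=+1$: (a) $\lambda^{\pm}_{\alpha,\beta}:=-\frac{d^2T}{4}\pm 2\pi d\sqrt{\alpha^2+\beta^2}$, with multiplicity $1$ for each $\alpha\in\frac{1}{2r}\mathbb{Z}$ with $e^{2\pi i r\alpha}=\delta_1$ and each $\beta\in\frac12\mathbb{Z}$ with $e^{2\pi i\beta}=\delta_2$; (b) $\lambda_\tau:=-\frac{d^2T}{4}-2\pi\tau T^{-1}$, with multiplicity $2\tau r$ for each $\tau\in\mathbb{N}$; (c) $\lambda^{\pm}_{\tau,k}:=-\frac{d^2T}{4}\pm 2\sqrt{\pi^2\tau^2T^{-2}+k\pi d^2\tau}$, with multiplicity $2\tau r$ for all $\tau,k\in\mathbb{N}$. **B.** If $\delta_3=-1$: (a) $\lambda_\tau:=-\frac{d^2T}{4}-2\pi\tau T^{-1}$, with multiplicity $2\tau r$ for each $\tau\in\mathbb{N}_0+\frac12$; (b) $\lambda^{\pm}_{\tau,k}:=-\frac{d^2T}{4}\pm 2\sqrt{\pi^2\tau^2T^{-2}+k\pi d^2\tau}$, with multiplicity $2\tau r$ for each $\tau\in\mathbb{N}_0+\frac12$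 and each $k\in\mathbb{N}$.
   Context: $\mathbb{N}=\{1,2,\dots\}$, $\mathbb{N}_0=\mathbb{N}\cup\{0\}$. $G$ is the 3-dimensional Heisenberg group of matrices $g(x,y,z)=\begin{pmatrix}1&x&z\\0&1&y\\0&0&1\end{pmatrix}$, $x,y,z\in\mathbb{R}$, with Lie algebra spanned by the left invariant fields $X,Y,Z$ (the elementary matrices with a single entry $1$ in position $(1,2)$, $(2,3)$, $(1,3)$ respectively), so that $[X,Y]=Z$ is the only nontrivial commutator. $\Gamma_r=\{g(rx,y,z)\mid x,y,z\in\mathbb{Z}\}$. $M(r,d,T)$ is $\Gamma_r\backslash G$ with the metric induced by the left invariant metric on $G$ for which $e_1=-dX$, $e_2=-dY$, $e_3=T^{-1}Z$ is an orthonormal frame (taken as positively oriented). Spin structures on $\Gamma_r\backslash G$ correspond to homomorphisms $\epsilon:\Gamma_r\to\{-1,1\}$; the triple $\delta$ of $\epsilon$ is $\delta_1=\epsilon(g(r,0,0))$, $\delta_2=\epsilon(g(0,1,0))$, $\delta_3=\epsilon(g(0,0,1))$. Using the global frame $(e_1,e_2,e_3)$, spinor fields on $M(r,d,T)$ for $\epsilon$ are identified with maps $\sigma:G\to\Sigma_3=\mathbb{C}^2$ such that $\sigma(g_0g)=\epsilon(g_0)\sigma(g)$ for $g_0\in\Gamma_r$, $g\in G$. Clifford multiplication satisfies $\gamma(X)\gamma(Y)+\gamma(Y)\gamma(X)+2\langle X,Y\rangle\,\mathrm{id}=0$ and is given by $\gamma(e_1)=\begin{pmatrix}0&i\\i&0\end{pmatrix}$,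 $\gamma(e_2)=\begin{pmatrix}0&-1\\1&0\end{pmatrix}$, $\gamma(e_3)=\begin{pmatrix}i&0\\0&-i\end{pmatrix}$. The Dirac operator is $D\sigma=\sum_{i=1}^3\gamma(e_i)\nabla^\Sigma_{e_i}\sigma$, where $\nabla^\Sigma$ is the spinor connection induced by the Levi-Civita connection: $\nabla^\Sigma_{e_i}\sigma=\partial_{e_i}\sigma+\frac14\sum_{j,k}\Gamma_{ij}^k\gamma(e_j)\gamma(e_k)\sigma$ with $\nabla_{e_i}e_j=\sum_k\Gamma_{ij}^ke_k$. The listed families together give the full spectrum; if the same real number occurs for several parameter values (or for both signs), the multiplicities add. *)

(* Defs.v *)
From mathcomp Require Import all_boot all_order all_algebra.
From mathcomp Require Import all_classical all_reals all_analysis.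
From mathcomp Require Import ring.
From mathcomp Require Export complex.

Set Implicit Arguments.
Unset Strict Implicit.
Unset Printing Implicit Defensive.

Import Order.TTheory GRing.Theory Num.Theory.
Import numFieldNormedType.Exports.

Local Open Scope classical_set_scope.
Local Open Scope complex_scope.
Local Open Scope ring_scope.

Definition rows_mx (A : nmodType) (m n : nat) (s : seq (seq A)) : 'M[A]_(m, n) :=
  \matrix_(i < m, j < n) (nth [::] s i)`_j.

Section Heisenberg.
Variable R : realType.

(* Points of the Heisenberg group G are represented by their coordinates
   (x, y, z) in the global chart g(x, y, z); hmx recovers the matrix. *)
Definition hpt (x y z : R) : 'rV[R]_3 := \row_(i < 3) [:: x; y; z]`_i.

Definition hmx (g : 'rV[R]_3) : 'M[R]_3 :=
  rows_mx 3 3 [:: [:: 1; g 0 0; g 0 2%:R];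
                  [:: 0; 1;     g 0 1   ];
                  [:: 0; 0;     1       ]].

Definition hcoord (M : 'M[R]_3) : 'rV[R]_3 := hpt (M 0 1) (M 1 2%:R) (M 0 2%:R).

Definition hmul (g h : 'rV[R]_3) : 'rV[R]_3 := hcoord (hmx g *m hmx h).

Definition lieX : 'M[R]_3 := delta_mx 0 1.
Definition lieY : 'M[R]_3 := delta_mx 1 2%:R.
Definition lieZ : 'M[R]_3 := delta_mx 0 2%:R.

Definition bracket (A B : 'M[R]_3) : 'M[R]_3 := A *m B - B *m A.

Definition frame (d T : R) (i : 'I_3) : 'M[R]_3 :=
  [:: - d *: lieX; - d *: lieY; T^-1 *: lieZ]`_i.

(* The inner product on the Lie algebra for which the frame is orthonormal;
   see frame_orthonormal. *)
Definition hmetric (d T : R) (A B : 'M[R]_3) : R :=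
  (A 0 1 * B 0 1 + A 1 2%:R * B 1 2%:R) / d ^+ 2
  + T ^+ 2 * (A 0 2%:R * B 0 2%:R).

(* Koszul formula for the frame, whose inner products are constant; see
   christoffelP for the characterization of the Levi-Civita connection. *)
Definition christoffel (d T : R) (i j k : 'I_3) : R :=
  let e := frame d T in
  2^-1 * (hmetric d T (bracket (e i) (e j)) (e k)
          - hmetric d T (bracket (e j) (e k)) (e i)
          + hmetric d T (bracket (e k) (e i)) (e j)).

(* The connection nabla_(e_i) e_j = \sum_k Gam i j k *: e_k is metric and
   torsion free. *)
Definition levi_civita (d T : R) (Gam : 'I_3 -> 'I_3 -> 'I_3 -> R) : Prop :=
  (forall i j k, Gam i j k + Gam i k j = 0) /\
  (forall i j, \sum_(k < 3) (Gam i j k - Gam j i k) *: frame d T k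
               = bracket (frame d T i) (frame d T j)).

Definition lattice (r : nat) : set 'rV[R]_3 :=
  [set g | exists a b c : int, g = hpt (r%:R * a%:~R) b%:~R c%:~R].

Definition is_sign (s : int) : Prop := s = 1 \/ s = - 1.

(* A homomorphism from the lattice to {-1, 1}; its values outside the lattice
   are irrelevant. *)
Definition spin_structure (r : nat) (eps : 'rV[R]_3 -> int) : Prop :=
  (forall g, lattice r g -> is_sign (eps g)) /\
  (forall g h, lattice r g -> lattice r h -> eps (hmul g h) = eps g * eps h).

Definition delta1 (r : nat) (eps : 'rV[R]_3 -> int) : int := eps (hpt r%:R 0 0).
Definition delta2 (eps : 'rV[R]_3 -> int) : int := eps (hpt 0 1 0).
Definition delta3 (eps : 'rV[R]_3 -> int) : int := eps (hpt 0 0 1).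

Definition gamma (i : 'I_3) : 'M[R[i]]_2 :=
  [:: rows_mx 2 2 [:: [:: 0;  'i%C];
                      [:: 'i%C; 0 ]];
      rows_mx 2 2 [:: [:: 0; -1];
                      [:: 1; 0 ]];
      rows_mx 2 2 [:: [:: 'i%C; 0  ];
                      [:: 0;  -'i%C]]]`_i.

Fixpoint Ck (n : nat) (f : 'rV[R]_3 -> R) : Prop :=
  continuous f /\
  if n is m.+1 then
    forall i : 'I_3,
      (forall x, derivable f x (delta_mx 0 i)) /\
      Ck m (fun x => 'D_(delta_mx 0 i) f x)
  else True.

Definition smooth (f : 'rV[R]_3 -> R) : Prop := forall n, Ck n f.

Definition smooth_spinor (sigma : 'rV[R]_3 -> 'cV[R[i]]_2) : Prop :=
  forall k : 'I_2, smooth (fun g => complex.Re (sigma g k 0)) /\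
                   smooth (fun g => complex.Im (sigma g k 0)).

Definition spinor_field (r : nat) (eps : 'rV[R]_3 -> int)
    (sigma : 'rV[R]_3 -> 'cV[R[i]]_2) : Prop :=
  smooth_spinor sigma /\
  (forall g0 g, lattice r g0 -> sigma (hmul g0 g) = (eps g0)%:~R *: sigma g).

(* The left invariant field A has the value hmx g *m A at g, which is
   hcoord (hmx g *m A) in the chart. *)
Definition lder (A : 'M[R]_3) (f : 'rV[R]_3 -> R) (g : 'rV[R]_3) : R :=
  'D_(hcoord (hmx g *m A)) f g.

Definition lder_spinor (A : 'M[R]_3) (sigma : 'rV[R]_3 -> 'cV[R[i]]_2)
    (g : 'rV[R]_3) : 'cV[R[i]]_2 :=
  \col_(k < 2) (lder A (fun h => complex.Re (sigma h k 0)) g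
                +i* lder A (fun h => complex.Im (sigma h k 0)) g).

Definition nabla (d T : R) (i : 'I_3) (sigma : 'rV[R]_3 -> 'cV[R[i]]_2)
    (g : 'rV[R]_3) : 'cV[R[i]]_2 :=
  lder_spinor (frame d T i) sigma g
  + 4^-1 *: \sum_(j < 3) \sum_(k < 3)
      (christoffel d T i j k)%:C *: (gamma j *m gamma k *m sigma g).

Definition dirac (d T : R) (sigma : 'rV[R]_3 -> 'cV[R[i]]_2)
    (g : 'rV[R]_3) : 'cV[R[i]]_2 :=
  \sum_(i < 3) gamma i *m nabla d T i sigma g.

Definition eigenspinors (r : nat) (d T : R) (eps : 'rV[R]_3 -> int)
    (lambda : R[i]) : set ('rV[R]_3 -> 'cV[R[i]]_2) :=
  [set sigma | spinor_field r eps sigma /\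
               forall g, dirac d T sigma g = lambda *: sigma g].

(* E is a complex subspace of finite dimension m. *)
Definition has_dim (E : set ('rV[R]_3 -> 'cV[R[i]]_2)) (m : \bar R) : Prop :=
  exists (n : nat) (e : 'I_n -> 'rV[R]_3 -> 'cV[R[i]]_2),
    [/\ m = (n%:R)%:E,
        (forall c : 'I_n -> R[i],
           (forall g, \sum_(i < n) c i *: e i g = 0) -> forall i, c i = 0) &
        (forall sigma, E sigma <->
           exists c : 'I_n -> R[i], forall g, sigma g = \sum_(i < n) c i *: e i g)].

Definition cis (t : R) : R[i] := cos t +i* sin t.

(* The boolean s selects the sign: + for false, - for true. *)
Definition ev_torus (d T a b : R) (s : bool) : R :=
  - (d ^+ 2 * T / 4) + (-1) ^+ s * (2 * pi * d * Num.sqrt (a ^+ 2 + b ^+ 2)).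

Definition ev_ground (d T tau : R) : R :=
  - (d ^+ 2 * T / 4) - 2 * pi * tau * T^-1.

Definition ev_excited (d T tau : R) (k : nat) (s : bool) : R :=
  - (d ^+ 2 * T / 4)
  + (-1) ^+ s * (2 * Num.sqrt (pi ^+ 2 * tau ^+ 2 * (T ^+ 2)^-1
                               + k%:R * pi * d ^+ 2 * tau)).

Definition torus_params (r : nat) (d1 d2 : int) : set (R * R) :=
  [set ab | [/\ exists m : int, ab.1 = m%:~R / (2 * r%:R),
                exists m : int, ab.2 = m%:~R / 2,
                cis (2 * pi * r%:R * ab.1) = d1%:~R &
                cis (2 * pi * ab.2) = d2%:~R]].

Definition pos_nats : set R := [set t | exists2 n : nat, (0 < n)%N & t = n%:R].
Definition half_odds : set R := [set t | exists n : nat, t = n%:R + 2^-1].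

(* Total multiplicity with which lambda occurs in each family. *)
Definition mult_torus (r : nat) (d T : R) (d1 d2 : int) (lambda : R[i]) : \bar R :=
  \esum_(p in [set p : R * R * bool | torus_params r d1 d2 p.1 /\
                 (ev_torus d T p.1.1 p.1.2 p.2)%:C = lambda]) 1%:E.

Definition mult_ground (taus : set R) (r : nat) (d T : R) (lambda : R[i]) : \bar R :=
  \esum_(t in [set t | taus t /\ (ev_ground d T t)%:C = lambda])
     (2 * t * r%:R)%:E.

Definition mult_excited (taus : set R) (r : nat) (d T : R) (lambda : R[i]) : \bar R :=
  \esum_(p in [set p : R * nat * bool | [/\ taus p.1.1, (0 < p.1.2)%N &
                 (ev_excited d T p.1.1 p.1.2 p.2)%:C = lambda]])
     (2 * p.1.1 * r%:R)%:E.

End Heisenberg.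

Ltac case_ord := repeat match goal with i : 'I_ _ |- _ =>
  let m := fresh "m" in let Hm := fresh "Hm" in
  case: i => m Hm; do 3?[case: m Hm => [|m] Hm //] end.

Ltac mxsimp := repeat progress rewrite ?mxE ?big_ord_recl ?big_ord0 /=.

Section FrameFacts.
Variable R : realType.
Implicit Types (d T : R) (g h : 'rV[R]_3).

Lemma hmx_hmul g h : hmx (hmul g h) = hmx g *m hmx h.
Proof. by apply/matrixP => i j; case_ord; mxsimp; ring. Qed.

Lemma hmulE (x y z x' y' z' : R) :
  hmul (hpt x y z) (hpt x' y' z') = hpt (x + x') (y + y') (z + z' + x * y').
Proof. by apply/rowP => i; case_ord; mxsimp; ring. Qed.

Lemma frame_orthonormal d T i j : d != 0 -> T != 0 ->
  hmetric d T (frame d T i) (frame d T j) = (i == j)%:R.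
Proof.
by move=> d0 T0; case_ord; rewrite /hmetric /frame /=; mxsimp;
  field; rewrite ?d0 ?T0.
Qed.

Lemma gamma_clifford i j :
  gamma R i *m gamma R j + gamma R j *m gamma R i = (- 2 * (i == j)%:R)%:M.
Proof.
apply/matrixP => a b; case_ord; rewrite /gamma /=; mxsimp;
  apply/eqP; rewrite eq_complex /=; apply/andP; split; apply/eqP => /=; ring.
Qed.

Let c d T i j k := hmetric d T (bracket (frame d T i) (frame d T j)) (frame d T k).

Let cC d T i j k : c d T j i k = - c d T i j k.
Proof. by rewrite /c /hmetric /bracket !mxE; ring. Qed.

Let hmetric_sum d T (a : 'I_3 -> R) l : d != 0 -> T != 0 ->
  hmetric d T (\sum_(k < 3) a k *: frame d T k) (frame d T l) = a l.
Proof.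
move=> d0 T0; rewrite -[RHS]mulr1.
transitivity (\sum_(k < 3) a k * hmetric d T (frame d T k) (frame d T l)).
  by rewrite !big_ord_recl !big_ord0 /hmetric !mxE; ring.
rewrite (bigD1 l)//= frame_orthonormal// eqxx big1 ?addr0// => k /negbTE kl.
by rewrite frame_orthonormal// kl mulr0.
Qed.

Let bracket_span d T i j : T != 0 -> exists a : 'I_3 -> R,
  bracket (frame d T i) (frame d T j) = \sum_(k < 3) a k *: frame d T k.
Proof.
move=> T0.
suff [b ->] : exists b : R, bracket (frame d T i) (frame d T j) = b *: lieZ R.
  exists (fun k : 'I_3 => if (k : nat) == 2%N then b * T else 0).
  by rewrite !big_ord_recl big_ord0 /= !scale0r !add0r addr0 scalerA mulfK.
exists (bracket (frame d T i) (frame d T j) 0 2%:R).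
rewrite /bracket /lieZ; case_ord; rewrite /frame /lieX /lieY /lieZ /=
  -?scalemxAl -?scalemxAr !mul_delta_mx_cond /= ?mulr0n ?mulr1n ?scaler0
  ?subrr ?subr0 ?sub0r ?mxE /= ?scale0r ?oppr0 ?mulr1 ?mulrN ?scalerA ?scaleNr //;
  by rewrite !(mulrN, mulNr, scaleNr, opprK).
Qed.

Let bracket_sum d T i j : d != 0 -> T != 0 ->
  \sum_(k < 3) c d T i j k *: frame d T k = bracket (frame d T i) (frame d T j).
Proof.
move=> d0 T0; have [a Ea] := bracket_span d i j T0.
by rewrite /c Ea; apply: eq_bigr => k _; rewrite hmetric_sum.
Qed.

Lemma christoffelP d T Gam : d != 0 -> T != 0 ->
  levi_civita d T Gam <-> forall i j k, Gam i j k = christoffel d T i j k.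
Proof.
move=> d0 T0; split=> [[Gm Gt] i j k|GE].
  have G3 i' j' k' : c d T i' j' k' = Gam i' j' k' - Gam j' i' k'.
    by rewrite /c -Gt hmetric_sum.
  have m1 := Gm j i k; have m2 := Gm k i j; have m3 := Gm i j k.
  rewrite /christoffel -!/(c _ _ _ _ _) !G3.
  have -> : Gam j i k = - Gam j k i by apply/eqP; rewrite -addr_eq0 m1.
  have -> : Gam k i j = - Gam k j i by apply/eqP; rewrite -addr_eq0 m2.
  have -> : Gam i k j = - Gam i j k by apply/eqP; rewrite -addr_eq0 addrC m3.
  by field.
split=> [i j k|i j].
  rewrite !GE /christoffel -!/(c _ _ _ _ _).
  by rewrite (cC d T i k j) (cC d T k j i) (cC d T j i k); ring.
rewrite -bracket_sum//; apply: eq_bigr => k _; congr (_ *: _).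
rewrite !GE /christoffel -!/(c _ _ _ _ _).
by rewrite (cC d T i j k) (cC d T i k j) (cC d T k j i); field.
Qed.

End FrameFacts.

(* Main.v *)
(* In the coordinates (x, y, z) the Dirac operator is a first order system in the
   left invariant fields X, Y, Z, shifted by -d^2 T / 4, and each eigenspace is
   analysed through the Fourier coefficients (n, b) of its spinors in z and y.
   For n = 0 the coefficients are periodic up to sign in x and a further Fourier
   expansion leaves a 2 by 2 linear system for each frequency of the flat torus.
   For n <> 0 the two components satisfy a ladder system for the harmonic
   oscillator on the real line: repeated lowering gives bounded solutions of
   v'' = (w^2 x^2 + w (1 + 2 k) - kappa) v, which vanish for k large since |v|^2
   is then convex, so a bounded solution is a pair of Hermite functions of
   adjacent degrees and the eigenvalue is quantized.  Invariance under
   the lattice links the frequencies b and b + n r, so the coefficients with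
   |n| = tau depend on 2 tau r constants, and theta series realise all of them.
   Evaluating Fourier coefficients at suitable points gives functionals dual to
   these explicit eigenspinors. *)
Require Import Defs.
From mathcomp Require Import all_boot all_order all_algebra.
From mathcomp Require Import all_classical all_reals all_analysis.
From mathcomp Require Import ring lra zify.

Set Implicit Arguments.
Unset Strict Implicit.
Unset Printing Implicit Defensive.

Import Order.TTheory GRing.Theory Num.Theory.
Import numFieldNormedType.Exports.

Local Open Scope classical_set_scope.
Local Open Scope ring_scope.

(** * Directional derivatives and smooth functions *)

(** The eigenvalue is an arbitrary complex number and spinors carry no inner product here, so
    neither self-adjointness nor the spectral theory of the oscillator is at hand. Boundedness
    replaces both: the modulus of a section is constant on lattice orbits and the quotient is
    compact, so every Fourier coefficient is bounded on the line. Each lowering adds 2w to the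
    constant term of the potential, which eventually exceeds the real part of any complex [kappa].
    The last nonzero iterate is then a Gaussian, and the Hermite functions are recovered by climbing
    back from it. Independence and completeness of the candidate eigenspinors come from linear
    functionals: only their values on the candidates and the triviality of their common kernel
    matter. The central characters n and -n share one computation, because a change of sign
    exchanges the two components of the spinor. This gives the factor 2 in 2 tau r. It also explains
    the single sign of the ground family: the component that carries the Gaussian changes with the
    sign of n, so the Z term of the operator is -2 pi tau / T on it for both signs. *)

Section ContinuousOperations.
Context {R : realType} {T : topologicalType}.
Implicit Types f g : T -> R.

Lemma continuous_add f g : continuous f -> continuous g -> continuous (fun x => f x + g x).
Proof. by move=> cf cg x; apply: cvgD; [exact: cf|exact: cg]. Qed.

Lemma continuous_mul f g : continuous f -> continuous g -> continuous (fun x => f x * g x).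
Proof. by move=> cf cg x; apply: cvgM; [exact: cf|exact: cg]. Qed.

Lemma continuous_sub f g : continuous f -> continuous g -> continuous (fun x => f x - g x).
Proof. by move=> cf cg x; apply: cvgB; [exact: cf|exact: cg]. Qed.

Lemma continuous_cst (a : R) : continuous (fun _ : T => a).
Proof. by move=> x; exact: cvg_cst. Qed.

Lemma continuousP_eps f : continuous f <->
  forall x e, 0 < e -> \forall y \near x, `|f x - f y| <= e.
Proof.
split=> [cf x e e0|H x]; first by have /cvgrPdist_le/(_ _ e0) := cf x.
by apply/cvgrPdist_le => e; exact: H.
Qed.

End ContinuousOperations.

(** * Directional derivatives along lines and their additivity *)

Section DirectionalDerivatives.
Context {R : realType}.
Local Notation V := 'rV[R]_3.
Implicit Types (f g : V -> R) (x v w : V).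

(** Restriction to a line makes the one-variable chain rule and mean value theorem applicable to
    directional derivatives. *)
Lemma is_derive_line f x v l (s : R) :
  is_derive (x + s *: v) v f l <-> is_derive s 1 (fun t : R => f (x + t *: v)) l.
Proof.
have E : (fun h : R => h^-1 *: ((f \o shift (x + s *: v)) (h *: v) - f (x + s *: v)))
   = (fun h : R => h^-1 *: (((fun t : R => f (x + t *: v)) \o shift s) (h *: (1 : R))
        - f (x + s *: v))).
  apply/funext => h /=; congr (_ *: (f _ - _)).
  by rewrite [h%:A]mulr1 scalerDl addrCA.
split=> -[D1 D2]; constructor.
- by rewrite /derivable -E.
- by rewrite /derive -E.
- by rewrite /derivable E.
- by rewrite /derive E.
Qed.

Lemma is_derive_line0 f x v l :
  is_derive x v f l <-> is_derive (0 : R) 1 (fun t : R => f (x + t *: v)) l.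
Proof. by rewrite -is_derive_line scale0r addr0. Qed.

Lemma is_derive_unique (W : normedModType R) (f : W -> R) (x v : W) l l' :
  is_derive x v f l -> is_derive x v f l' -> l = l'.
Proof. by move=> h [_ <-]; case: h. Qed.

Lemma is_derive_mul (W : normedModType R) (f g : W -> R) (x v : W) (l m : R) :
  is_derive x v f l -> is_derive x v g m ->
  is_derive x v (fun y => f y * g y) (l * g x + f x * m).
Proof.
move=> h1 h2; have h3 := is_deriveM h1 h2; apply: (is_derive_eq h3).
by rewrite addrC; congr (_ + _); exact: mulrC.
Qed.

Lemma is_derive_affine (a b s : R) : is_derive s 1 (fun t : R => a + t * b) b.
Proof.
have h : is_derive s 1 (fun t : R => t * b) b.
  by apply: is_derive_eq; rewrite !scaler0 add0r [_%:A]mulr1.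
by rewrite -[X in is_derive _ _ _ X]add0r; exact: (is_deriveD (is_derive_cst a s 1) h).
Qed.

Lemma is_deriveZdir f x v l a : is_derive x v f l -> is_derive x (a *: v) f (a * l).
Proof.
rewrite !is_derive_line0 => h.
have -> : (fun t : R => f (x + t *: (a *: v)))
   = (fun t : R => f (x + t *: v)) \o (fun t => t * a).
  by apply/funext => t /=; rewrite scalerA.
rewrite mulrC.
have h2 : is_derive (0:R) 1 (fun t : R => t * a) a.
  by apply: is_derive_eq; rewrite !scaler0 add0r [_%:A]mulr1.
by apply: (@is_derive1_comp _ (fun t : R => f (x + t *: v)) (fun t => t * a));
  rewrite ?mul0r.
Qed.

(** Directional derivatives alone need not be additive in the direction. The mean value theorem
    along [w] writes the second increment as [h] times a [w]-derivative at a nearby point, and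
    continuity of that derivative at [x] yields the limit. *)
Lemma is_deriveDdir f x v w l :
  (forall y, derivable f y w) -> {for x, continuous (fun y => 'D_w f y)} ->
  is_derive x v f l -> is_derive x (v + w) f (l + 'D_w f x).
Proof.
move=> dw cw [dv lv].
suff H : h^-1 *: (f (h *: (v + w) + x) - f x) @[h --> 0^'] --> l + 'D_w f x.
  constructor; first by apply/cvg_ex; exists (l + 'D_w f x).
  by apply: cvg_lim.
have -> : (fun h : R => h^-1 *: (f (h *: (v + w) + x) - f x)) =
   (fun h => h^-1 *: (f (h *: v + x) - f x)) \+
   (fun h => h^-1 *: (f (h *: (v + w) + x) - f (h *: v + x))).
  by apply/funext => h /=; rewrite -scalerDr; congr (_ *: _); ring.
apply: cvgD; first by rewrite -lv; exact: dv.
apply/cvgrPdist_le => e e0.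
move/cvgrPdist_le : cw => /(_ _ e0) /nbhs_ballP [d /= d0 hd].
(* Below this bound on [|h|], and with [|c| <= |h|], the point displaced by [h *: v + c *: w] stays
   in the ball of radius [d]. The summand 1 keeps the denominator positive. *)
have k0 : 0 < d / (`|v| + `|w| + 1) by rewrite divr_gt0// ltr_wpDl// addr_ge0.
near=> h.
have h0 : h != 0 by near: h; exact: nbhs_dnbhs_neq.
have hk : `|h| < d / (`|v| + `|w| + 1).
  near: h; apply: dnbhs0_lt; exact: k0.
(* Mean value theorem for [t |-> f (p + t *: w)] between 0 and [h], with one case for each sign of
   [h]. *)
have [c chI ->] : exists2 c, `|c| <= `|h| &
    f (h *: (v + w) + x) - f (h *: v + x) = 'D_w f (h *: v + x + c *: w) * h.
  pose p := h *: v + x; pose q (t : R) := f (p + t *: w).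
  have E1 : f (h *: (v + w) + x) = q h by rewrite /q /p scalerDr addrAC.
  have E0 : f (h *: v + x) = q 0 by rewrite /q /p scale0r addr0.
  have dq (t : R) : is_derive t 1 q ('D_w f (p + t *: w)).
    by rewrite -is_derive_line; apply/derivableP.
  have cq A : {within A, continuous q}.
    apply/continuous_subspaceT => t.
    by apply/differentiable_continuous/derivable1_diffP; case: (dq t).
  rewrite E1 E0; have [hp|hn] := ltP 0 h.
    have [c cI ->] := MVT hp (fun t _ => dq t) (cq _).
    exists c; last by rewrite subr0.
    by move: cI; rewrite in_itv/= => /andP[c0 ch]; rewrite !gtr0_norm// ltW.
  have {}hn : h < 0 by rewrite lt_neqAle h0.
  have [c cI E] := MVT hn (fun t _ => dq t) (cq _).
  exists c; last by rewrite -opprB E sub0r mulrN opprK.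
  by move: cI; rewrite in_itv/= => /andP[c0 ch]; rewrite !ltr0_norm// lerN2 ltW.
rewrite [_ *: _]mulrC mulfK//; apply: hd.
rewrite -ball_normE /=.
have -> : x - (h *: v + x + c *: w) = - (h *: v + c *: w).
  by rewrite addrAC [in LHS]opprD addrCA subrr addr0.
rewrite normrN; apply: le_lt_trans (ler_normD _ _) _; rewrite !normrZ.
apply: (@le_lt_trans _ _ (`|h| * (`|v| + `|w| + 1))).
  rewrite mulrDr mulr1 mulrDr -addrA lerD2l.
  by apply: ler_wpDr => //; rewrite ler_wpM2r.
by rewrite -ltr_pdivlMr// ltr_wpDl// addr_ge0.
Unshelve. all: by end_near. Qed.

End DirectionalDerivatives.

(** * Smooth functions and left invariant fields in the chart *)

Section SmoothFunctions.
Local Open Scope complex_scope.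
Context {R : realType}.
Local Notation V := 'rV[R]_3.
Implicit Types (f g : V -> R).

Definition pd (i : 'I_3) f : V -> R := fun x => 'D_(delta_mx 0 i) f x.

Lemma smoothP f : smooth f <->
  continuous f /\ forall i, (forall x, derivable f x (delta_mx 0 i)) /\ smooth (pd i f).
Proof.
split=> [sf|[cf df] [|n]].
- split; first by case: (sf 0%N).
  move=> i; split; first by case: (sf 1%N) => _ /(_ i) [].
  by move=> n; case: (sf n.+1) => _ /(_ i) [].
- by split.
- by split=> // i; have [d1 d2] := df i; split=> //; exact: d2.
Qed.

(** Coinduction: a class of continuous functions stable under partial derivatives consists of smooth
    functions, so no formula for iterated derivatives is ever needed. *)
Lemma smooth_coind (S : (V -> R) -> Prop) :
  (forall f, S f -> continuous f /\
     forall i, (forall x, derivable f x (delta_mx 0 i)) /\ S (pd i f)) ->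
  forall f, S f -> smooth f.
Proof.
move=> HS f Sf n; elim: n f Sf => [|n IH] f Sf; have [cf df] := HS f Sf; split=> //.
by move=> i; have [d1 /IH d2] := df i.
Qed.

Lemma smooth_continuous f : smooth f -> continuous f.
Proof. by case/smoothP. Qed.

Lemma smooth_pd f i : smooth f -> smooth (pd i f).
Proof. by case/smoothP => _ /(_ i) []. Qed.

Lemma smooth_is_derive f i x : smooth f -> is_derive x (delta_mx 0 i) f (pd i f x).
Proof. by case/smoothP => _ /(_ i) [H _]; exact/derivableP. Qed.

Lemma pdE f g i : (forall x, is_derive x (delta_mx 0 i) f (g x)) -> pd i f = g.
Proof. by move=> H; apply/funext => x; apply: derive_val. Qed.

Lemma pd_lin f g a i : smooth f -> smooth g ->
  pd i (fun x => a * f x + g x) = fun x => a * pd i f x + pd i g x.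
Proof.
move=> sf sg; apply: pdE => x.
have h1 := smooth_is_derive i x sf; have h2 := smooth_is_derive i x sg.
exact: (is_deriveD (is_deriveZ a h1) h2).
Qed.

Lemma smooth_lin f g a : smooth f -> smooth g -> smooth (fun x => a * f x + g x).
Proof.
pose S h := exists f g, [/\ smooth f, smooth g & h = fun x => a * f x + g x].
move=> sf sg; apply: (@smooth_coind S); last by exists f, g.
move=> _ [{}f [{}g [{}sf {}sg ->]]]; split.
  apply: continuous_add; last exact: smooth_continuous.
  by apply: continuous_mul; [exact: continuous_cst|exact: smooth_continuous].
move=> i; split; last by exists (pd i f), (pd i g); split;
  [exact: smooth_pd|exact: smooth_pd|exact: pd_lin].
move=> x.
have h1 := smooth_is_derive i x sf; have h2 := smooth_is_derive i x sg.
by case: (is_deriveD (is_deriveZ a h1) h2).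
Qed.

Lemma smooth_cst (a : R) : smooth (fun _ : V => a).
Proof.
apply: (@smooth_coind (fun h => exists a, h = fun=> a)); last by exists a.
move=> _ [b ->]; split; first exact: continuous_cst.
move=> i; split; first by move=> x; apply: derivable_cst.
by exists 0; apply/funext => x; exact: derive_cst.
Qed.

Lemma smoothD f g : smooth f -> smooth g -> smooth (fun x => f x + g x).
Proof.
by move=> sf sg; have := smooth_lin 1 sf sg; under eq_fun do rewrite mul1r.
Qed.




Lemma pdD f g i : smooth f -> smooth g -> pd i (fun x => f x + g x) = fun x => pd i f x + pd i g x.
Proof.
move=> sf sg; have := pd_lin 1 i sf sg.
by under eq_fun do rewrite mul1r; under [RHS]eq_fun do rewrite mul1r.
Qed.

Lemma continuous_coord (i : 'I_3) : continuous (fun x : V => x 0 i).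
Proof. exact: coord_continuous. Qed.

Lemma is_derive_coord (x v : V) (i : 'I_3) : is_derive x v (fun y : V => y 0 i) (v 0 i).
Proof.
apply/is_derive_line0.
have -> : (fun t : R => (x + t *: v) 0 i) = (fun t => x 0 i + t * v 0 i).
  by apply/funext => t; rewrite !mxE.
exact: is_derive_affine.
Qed.

Lemma pd_mulx f i : smooth f -> pd i (fun x : V => x 0 0 * f x) =
  fun x => (i == 0)%:R * f x + x 0 0 * pd i f x.
Proof.
move=> sf; apply: pdE => x.
have h1 := is_derive_coord x (delta_mx 0 i) 0.
have h2 := smooth_is_derive i x sf.
apply: (is_derive_eq (is_derive_mul h1 h2)).
by rewrite mxE eqxx /= eq_sym.
Qed.

Lemma smooth_mulx f : smooth f -> smooth (fun x : V => x 0 0 * f x).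
Proof.
(* The x-derivative of [x f] leaves a bare summand [f], so the class stable under derivatives is
   that of all [x f + g]. *)
pose S h := exists f g, [/\ smooth f, smooth g & h = fun x : V => x 0 0 * f x + g x].
move=> sf; apply: (@smooth_coind S); last first.
  by exists f, (fun=> 0); split=> //; [exact: smooth_cst|apply/funext=> x; rewrite addr0].
move=> _ [{}f [g [{}sf sg ->]]].
have dxf x i : derivable (fun x : V => x 0 0 * f x) x (delta_mx 0 i).
  by have [] := is_derive_mul (is_derive_coord x (delta_mx 0 i) 0) (smooth_is_derive i x sf).
split.
  apply: continuous_add; last exact: smooth_continuous.
  by apply: continuous_mul; [exact: continuous_coord|exact: smooth_continuous].
move=> i; split.
  by move=> x; apply: derivableD => //; have [] := smooth_is_derive i x sg.
exists (pd i f), (fun x => (i == 0)%:R * f x + pd i g x); split.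
- exact: smooth_pd.
- exact/smooth_lin/smooth_pd.
apply: pdE => x; have [h1 h2] := smooth_is_derive i x sg.
have -> : x 0 0 * pd i f x + ((i == 0)%:R * f x + pd i g x) =
  pd i (fun x : V => x 0 0 * f x) x + pd i g x by rewrite pd_mulx//; ring.
by apply: is_deriveD; split.
Qed.

Lemma smooth_dir f (x : V) i j a b : smooth f ->
  is_derive x (a *: delta_mx 0 i + b *: delta_mx 0 j) f (a * pd i f x + b * pd j f x).
Proof.
move=> sf.
have h y : is_derive y (b *: delta_mx 0 j) f (b * pd j f y).
  exact/is_deriveZdir/smooth_is_derive.
have E : (fun y => 'D_(b *: delta_mx 0 j) f y) = fun y => b * pd j f y.
  by apply/funext => y; exact: derive_val.
rewrite -[b * pd j f x]/((fun y => b * pd j f y) x) -E.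
apply: is_deriveDdir.
- by move=> y; case: (h y).
- rewrite E; apply: continuous_mul; first exact: continuous_cst.
  exact/smooth_continuous/smooth_pd.
- exact/is_deriveZdir/smooth_is_derive.
Qed.

(** The left invariant fields in coordinates: right multiplication by the subgroup of Y moves y at
    unit speed and drags z at speed x. *)
Definition fX f : V -> R := pd 0 f.
Definition fY f : V -> R := fun x => pd 1 f x + x 0 0 * pd 2%:R f x.
Definition fZ f : V -> R := pd 2%:R f.

Lemma smooth_fX f : smooth f -> smooth (fX f). Proof. exact: smooth_pd. Qed.
Lemma smooth_fZ f : smooth f -> smooth (fZ f). Proof. exact: smooth_pd. Qed.
Lemma smooth_fY f : smooth f -> smooth (fY f).
Proof. by move=> sf; apply: smoothD; [|apply: smooth_mulx]; exact: smooth_pd. Qed.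

Lemma fX_lin f g a : smooth f -> smooth g ->
  fX (fun x => a * f x + g x) = fun x => a * fX f x + fX g x.
Proof. exact: pd_lin. Qed.

Lemma fZ_lin f g a : smooth f -> smooth g ->
  fZ (fun x => a * f x + g x) = fun x => a * fZ f x + fZ g x.
Proof. exact: pd_lin. Qed.

Lemma fY_lin f g a : smooth f -> smooth g ->
  fY (fun x => a * f x + g x) = fun x => a * fY f x + fY g x.
Proof. by move=> sf sg; apply/funext => x; rewrite /fY !pd_lin//; ring. Qed.

Definition equivariant (r : nat) (eps : V -> int) f : Prop :=
  forall g0 g : V, lattice r g0 -> f (hmul g0 g) = (eps g0)%:~R * f g.

Lemma hmul_line (g0 g v : V) (t : R) :
  hmul g0 (g + t *: v) = hmul g0 g + t *: hpt (v 0 0) (v 0 1) (v 0 2%:R + g0 0 0 * v 0 1).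
Proof. by apply/rowP => i; case_ord; mxsimp; ring. Qed.


(** Left translation by [g0] is affine in the chart, so it maps lines to lines; the direction at
    [hmul g0 g] is the image of [v] under its linear part. The fields X, Y, Z are invariant under
    this, hence preserve equivariance. *)
Lemma equivariant_dir r eps f (g0 g v : V) l l' : equivariant r eps f -> lattice r g0 ->
  is_derive g v f l ->
  is_derive (hmul g0 g) (hpt (v 0 0) (v 0 1) (v 0 2%:R + g0 0 0 * v 0 1)) f l' ->
  l' = (eps g0)%:~R * l.
Proof.
move=> ef Lg0 /is_derive_line0 h1 /is_derive_line0 h2.
apply: (is_derive_unique h2).
have -> : (fun t => f (hmul g0 g + t *: hpt (v 0 0) (v 0 1) (v 0 2%:R + g0 0 0 * v 0 1)))
  = (fun t => (eps g0)%:~R * f (g + t *: v)).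
  by apply/funext => t; rewrite -hmul_line ef.
exact: is_deriveZ.
Qed.

Lemma equivariant_fX r eps f : smooth f -> equivariant r eps f -> equivariant r eps (fX f).
Proof.
move=> sf ef g0 g Lg0.
apply: (equivariant_dir ef Lg0 (smooth_is_derive 0 g sf)).
have -> : hpt ((delta_mx 0 0 : V) 0 0) ((delta_mx 0 0 : V) 0 1)
    ((delta_mx 0 0 : V) 0 2%:R + g0 0 0 * (delta_mx 0 0 : V) 0 1) = delta_mx 0 0.
  by apply/rowP => i; case_ord; mxsimp; ring.
exact: smooth_is_derive.
Qed.

Lemma equivariant_fZ r eps f : smooth f -> equivariant r eps f -> equivariant r eps (fZ f).
Proof.
move=> sf ef g0 g Lg0.
apply: (equivariant_dir ef Lg0 (smooth_is_derive 2%:R g sf)).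
have -> : hpt ((delta_mx 0 2%:R : V) 0 0) ((delta_mx 0 2%:R : V) 0 1)
    ((delta_mx 0 2%:R : V) 0 2%:R + g0 0 0 * (delta_mx 0 2%:R : V) 0 1) = delta_mx 0 2%:R.
  by apply/rowP => i; case_ord; mxsimp; ring.
exact: smooth_is_derive.
Qed.

Lemma equivariant_fY r eps f : smooth f -> equivariant r eps f -> equivariant r eps (fY f).
Proof.
move=> sf ef g0 g Lg0.
have := smooth_dir g 1 2%:R 1 (g 0 0) sf; set v := (X in is_derive g X) => h.
rewrite /fY -[pd 1 f g]mul1r.
apply: (equivariant_dir ef Lg0 h).
have -> : hpt (v 0 0) (v 0 1) (v 0 2%:R + g0 0 0 * v 0 1) =
    1 *: delta_mx 0 1 + (hmul g0 g) 0 0 *: delta_mx 0 2%:R.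
  by rewrite /v; apply/rowP => i; case_ord; mxsimp; ring.
have := smooth_dir (hmul g0 g) 1 2%:R 1 ((hmul g0 g) 0 0) sf.
by rewrite mul1r.
Qed.

End SmoothFunctions.

(** * The Dirac operator in coordinates *)

Section DiracFormula.
Local Open Scope complex_scope.
Context {R : realType}.
Local Notation V := 'rV[R]_3.
Local Notation C := R[i].
Implicit Types (f : V -> R) (F G : V -> C) (g : V).

(** Derivatives are those of real-valued functions, so operators act on complex functions through
    real and imaginary parts. *)
Definition cop (op : (V -> R) -> V -> R) F : V -> C :=
  fun g => op (fun h => complex.Re (F h)) g +i* op (fun h => complex.Im (F h)) g.

Definition csmooth F :=
  smooth (fun h => complex.Re (F h)) /\ smooth (fun h => complex.Im (F h)).

Lemma lder_frame0 d T f g : smooth f -> lder (frame d T 0) f g = - d * fX f g.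
Proof.
move=> sf; apply: derive_val.
have -> : hcoord (hmx g *m frame d T 0) = - d *: delta_mx 0 0.
  by apply/rowP => i; case_ord; rewrite /frame /=; mxsimp; ring.
exact/is_deriveZdir/smooth_is_derive.
Qed.

Lemma lder_frame1 d T f g : smooth f -> lder (frame d T 1) f g = - d * fY f g.
Proof.
move=> sf; apply: derive_val.
have -> : hcoord (hmx g *m frame d T 1) =
    - d *: (1 *: delta_mx 0 1 + g 0 0 *: delta_mx 0 2%:R).
  by apply/rowP => i; case_ord; rewrite /frame /=; mxsimp; ring.
by apply: is_deriveZdir; rewrite /fY -[pd 1 f g]mul1r; exact: smooth_dir.
Qed.

Lemma lder_frame2 d T f g : smooth f -> lder (frame d T 2%:R) f g = T^-1 * fZ f g.
Proof.
move=> sf; apply: derive_val.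
have -> : hcoord (hmx g *m frame d T 2%:R) = T^-1 *: delta_mx 0 2%:R.
  by apply/rowP => i; case_ord; rewrite /frame /=; mxsimp; ring.
exact/is_deriveZdir/smooth_is_derive.
Qed.

Lemma bracket_frame (d T : R) (i j : 'I_3) : bracket (frame d T i) (frame d T j) =
  (d ^+ 2 * (((i == 0) && (j == 1))%:R - ((i == 1) && (j == 0))%:R)) *: lieZ R.
Proof.
rewrite /bracket; case_ord; rewrite /frame /lieX /lieY /lieZ /=
  -?scalemxAl -?scalemxAr !mul_delta_mx_cond /= ?mulr0n ?mulr1n ?scaler0
  ?subrr ?subr0 ?sub0r ?mulr0 ?mulr1 ?scale0r ?scalerA // -?scaleNr;
  by congr (_ *: _); rewrite -?[_ *: - d]/(_ * - d); ring.
Qed.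

Lemma hmetric_lieZ (d T a : R) (k : 'I_3) : T != 0 ->
  hmetric d T (a *: lieZ R) (frame d T k) = a * T * (k == 2%:R)%:R.
Proof.
move=> T0; case_ord; rewrite /hmetric /frame /lieX /lieY /lieZ !mxE /=
  ?(mulr0, mul0r) ?mulr1 ?add0r ?(mulr0, mul0r) ?addr0 //.
by field.
Qed.

(** The only nonzero bracket is [[e_1, e_2] = d^2 T e_3] up to antisymmetry, so the Koszul formula
    gives [d^2 T / 2] up to sign on the six triples of distinct indices and 0 elsewhere. *)
Lemma christoffelE (d T : R) (i j k : 'I_3) : T != 0 ->
  christoffel d T i j k = d ^+ 2 * T / 2 *
   (nth [::] (nth [::] [:: [:: [:: 0; 0; 0]; [:: 0; 0; 1]; [:: 0; -1; 0]];
        [:: [:: 0; 0; -1]; [:: 0; 0; 0]; [:: 1; 0; 0]];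
        [:: [:: 0; -1; 0]; [:: 1; 0; 0]; [:: 0; 0; 0]]] i) j)`_k.
Proof.
move=> T0; rewrite /christoffel !bracket_frame !hmetric_lieZ//.
by case_ord => /=; field.
Qed.

Definition cvec (a b : C) : 'cV[C]_2 := \col_k [:: a; b]`_k.

Lemma ord2_lift : lift ord0 ord0 = 1 :> 'I_2. Proof. exact: val_inj. Qed.

Lemma cvec_eta (w : 'cV[C]_2) : w = cvec (w 0 0) (w 1 0).
Proof.
apply/colP => k; rewrite mxE; case: k => -[|[|//]] Hk /=;
  by congr (w _ _); apply: val_inj.
Qed.

Lemma cvecD a b a' b' : cvec a b + cvec a' b' = cvec (a + a') (b + b').
Proof. by apply/colP => k; rewrite !mxE; case: k => -[|[|//]]. Qed.

Lemma cvecZ c a b : c *: cvec a b = cvec (c * a) (c * b).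
Proof. by apply/colP => k; rewrite !mxE; case: k => -[|[|//]]. Qed.

Lemma gamma_cvec (i : 'I_3) a b : gamma R i *m cvec a b =
  cvec ([:: 'i%C * b; - b; 'i%C * a]`_i) ([:: 'i%C * a; a; - ('i%C * b)]`_i).
Proof.
apply/colP => k; rewrite !mxE !big_ord_recl big_ord0 ord2_lift !mxE /gamma.
by case: i => -[|[|[|//]]] Hi; case: k => -[|[|//]] Hk /=; rewrite !mxE /=; ring.
Qed.

(* The zeroth order part of D is (1/4) \sum_ijk Gamma_ij^k g_i g_j g_k = (c/4) g_1 g_2 g_3,
   with c = d^2 T and g_1 g_2 g_3 = -1. *)
Lemma dirac_zeroth (d T : R) (w : 'cV[C]_2) : T != 0 ->
  \sum_(i < 3) gamma R i *m (4^-1 *: \sum_(j < 3) \sum_(k < 3)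
      (christoffel d T i j k)%:C *: (gamma R j *m gamma R k *m w)) =
  (- (d ^+ 2 * T / 4))%:C *: w.
Proof.
move=> T0; rewrite [w]cvec_eta; move: (w 0 0) (w 1 0) => a b.
under eq_bigr => i _.
  under eq_bigr => j _ do under eq_bigr => k _ do
    rewrite christoffelE// -mulmxA !gamma_cvec !cvecZ.
  over.
set c := d ^+ 2 * T.
rewrite !big_ord_recl !big_ord0 /= !mulr0 mulr1 !mul0r mulrN1.
rewrite !addr0 !cvecD !cvecZ !gamma_cvec /= !cvecD.
case: a b => [a1 a2] [b1 b2].
congr (cvec _ _);
 apply/eqP; rewrite eq_complex /=; apply/andP; split; apply/eqP => /=; by field.
Qed.

Definition cX F := cop (@fX R) F.
Definition cY F := cop (@fY R) F.
Definition cZ F := cop (@fZ R) F.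

Lemma lder_spinorE (d T : R) (i : 'I_3) (sigma : V -> 'cV[C]_2) g : smooth_spinor sigma ->
  lder_spinor (frame d T i) sigma g =
    ([:: - d; - d; T^-1]`_i)%:C *:
    cvec ([:: cX (fun h => sigma h 0 0); cY (fun h => sigma h 0 0);
              cZ (fun h => sigma h 0 0)]`_i g)
         ([:: cX (fun h => sigma h 1 0); cY (fun h => sigma h 1 0);
              cZ (fun h => sigma h 1 0)]`_i g).
Proof.
move=> ss; rewrite [LHS]cvec_eta !mxE cvecZ.
have [[s1 s2] [s3 s4]] := (ss 0, ss 1).
have H (j : 'I_3) f : smooth f ->
    lder (frame d T j) f g = [:: - d; - d; T^-1]`_j * [:: fX f g; fY f g; fZ f g]`_j.
  move=> sf; case: j => -[|[|[|//]]] Hj /=.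
  - by rewrite -(@lder_frame0 d T) //; congr (lder (frame _ _ _) _ _); exact: val_inj.
  - by rewrite -(@lder_frame1 d T) //; congr (lder (frame _ _ _) _ _); exact: val_inj.
  - by rewrite -(@lder_frame2 d) //; congr (lder (frame _ _ _) _ _); exact: val_inj.
rewrite !H//; case: i => -[|[|[|//]]] Hi /=; congr cvec;
  by apply/eqP; rewrite eq_complex /= !mul0r subr0 addr0 !eqxx.
Qed.

Lemma diracE (d T : R) (sigma : V -> 'cV[C]_2) g : T != 0 -> smooth_spinor sigma ->
  let u h := sigma h 0 0 in let v h := sigma h 1 0 in
  Defs.dirac d T sigma g =
    cvec ('i%C * (T^-1)%:C * cZ u g - d%:C * 'i%C * (cX v g + 'i%C * cY v g))
         (- (d%:C * 'i%C * (cX u g - 'i%C * cY u g)) - 'i%C * (T^-1)%:C * cZ v g)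
    + (- (d ^+ 2 * T / 4))%:C *: sigma g.
Proof.
move=> T0 ss u v; rewrite -dirac_zeroth// /Defs.dirac /nabla.
under eq_bigr => i _ do rewrite mulmxDr lder_spinorE//.
rewrite big_split /=; congr (_ + _).
rewrite !big_ord_recl big_ord0 /= !cvecZ !gamma_cvec /= addr0 !cvecD.
have ii : 'i%C * 'i%C = -1 :> C by rewrite -expr2 sqr_i.
have dN : (- d)%:C = - d%:C :> C by rewrite rmorphN.
by congr cvec; rewrite dN; ring: ii.
Qed.

Lemma eigenspinorE (d T : R) (lambda : C) (sigma : V -> 'cV[C]_2) g :
  T != 0 -> smooth_spinor sigma ->
  let u h := sigma h 0 0 in let v h := sigma h 1 0 in
  let mu := lambda + (d ^+ 2 * T / 4)%:C in
  Defs.dirac d T sigma g = lambda *: sigma g <->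
  mu * u g = 'i%C * (T^-1)%:C * cZ u g - d%:C * 'i%C * (cX v g + 'i%C * cY v g) /\
  mu * v g = - (d%:C * 'i%C * (cX u g - 'i%C * cY u g)) - 'i%C * (T^-1)%:C * cZ v g.
Proof.
move=> T0 ss u v mu; rewrite diracE//.
rewrite rmorphN scaleNr; set w := cvec _ _; set c := (d ^+ 2 * T / 4)%:C.
have E : (w - c *: sigma g = lambda *: sigma g) <-> mu *: sigma g = w.
  by rewrite scalerDl -/c; split=> [<-|<-]; rewrite ?subrK ?addrK.
rewrite E [sigma g]cvec_eta cvecZ; split=> [/colP H|[-> ->]//].
by have [H0 H1] := (H 0, H 1); rewrite !mxE /= in H0 H1.
Qed.

End DiracFormula.

(** * Spin structures *)

Section SpinStructures.
Context {R : realType}.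
Local Notation V := 'rV[R]_3.

Lemma is_sign_unit (s : int) : is_sign s -> s \is a GRing.unit.
Proof. by case=> ->. Qed.

Lemma is_sign_sq (s : int) : is_sign s -> s * s = 1.
Proof. by case=> ->. Qed.

Lemma is_sign_exp (s a : int) : is_sign s -> is_sign (s ^ a).
Proof.
case=> ->; first by rewrite exp1rz; left.
by rewrite expN1r -signr_odd; case: odd; [right|left].
Qed.

Lemma sign_character (e : int -> int) : (forall a, is_sign (e a)) ->
  (forall a b, e (a + b) = e a * e b) -> forall a, e a = e 1 ^ a.
Proof.
move=> es eD.
have e0 : e 0 = 1.
  have := eD 0 0; rewrite addr0.
  by case: (es 0) => ->.
elim=> [|n IH|n IH]; first by rewrite e0.
- by rewrite intS addrC eD IH exprzDr ?is_sign_unit.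
- have : e (- (n.+1)%:Z) * e 1 = e (- n%:Z).
    by rewrite -eD; congr e; rewrite intS; ring.
  move=> /(congr1 (fun z => z * e 1)); rewrite -mulrA is_sign_sq// mulr1 => ->.
  have -> : - (n.+1)%:Z = - n%:Z + (- 1) by rewrite intS; ring.
  rewrite exprzDr ?is_sign_unit// IH; congr (_ * _).
Qed.

Definition lpt (r : nat) (a b c : int) : V := hpt (r%:R * a%:~R) b%:~R c%:~R.

Lemma lattice_lpt r a b c : lattice r (lpt r a b c).
Proof. by exists a, b, c. Qed.

Lemma lpt_mul r a b c a' b' c' :
  hmul (lpt r a b c) (lpt r a' b' c') = lpt r (a + a') (b + b') (c + c' + r%:Z * a * b').
Proof. by rewrite /lpt hmulE !(rmorphD, rmorphM) /= mulrDr -pmulrn. Qed.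

Lemma hpt_inj (x y z x' y' z' : R) : hpt x y z = hpt x' y' z' -> [/\ x = x', y = y' & z = z'].
Proof. by move=> /rowP H; have := (H 0, H 1, H 2%:R); rewrite !mxE /= => -[[-> ->] ->]. Qed.

Lemma lpt_inj r a b c a' b' c' : (0 < r)%N -> lpt r a b c = lpt r a' b' c' ->
  [/\ a = a', b = b' & c = c'].
Proof.
move=> r0 /hpt_inj [Ha /intr_inj -> /intr_inj ->]; split=> //.
by move/mulfI : Ha => /(_ _)/intr_inj; apply; rewrite pnatr_eq0 -lt0n.
Qed.

Section SpinStructure.
Variables (r : nat) (eps : V -> int).
Hypotheses (r0 : (0 < r)%N) (Heps : spin_structure r eps).

Let es a b c : is_sign (eps (lpt r a b c)).
Proof. by apply: (proj1 Heps); exact: lattice_lpt. Qed.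

Let eM a b c a' b' c' : eps (lpt r (a + a') (b + b') (c + c' + r%:Z * a * b')) =
  eps (lpt r a b c) * eps (lpt r a' b' c').
Proof. by rewrite -lpt_mul; apply: (proj2 Heps); exact: lattice_lpt. Qed.

Lemma delta1_lpt : delta1 r eps = eps (lpt r 1 0 0).
Proof. by rewrite /delta1 /lpt mulr1. Qed.
Lemma delta2_lpt : delta2 eps = eps (lpt r 0 1 0).
Proof. by rewrite /delta2 /lpt mulr0. Qed.
Lemma delta3_lpt : delta3 eps = eps (lpt r 0 0 1).
Proof. by rewrite /delta3 /lpt mulr0. Qed.

Lemma delta1_sign : is_sign (delta1 r eps). Proof. by rewrite delta1_lpt. Qed.
Lemma delta2_sign : is_sign (delta2 eps). Proof. by rewrite delta2_lpt. Qed.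
Lemma delta3_sign : is_sign (delta3 eps). Proof. by rewrite delta3_lpt. Qed.

Lemma spin_structureE a b c :
  eps (lpt r a b c) = delta1 r eps ^ a * delta2 eps ^ b * delta3 eps ^ c.
Proof.
have E1 : eps (lpt r a 0 0) = delta1 r eps ^ a.
  rewrite delta1_lpt (sign_character (e := fun a => eps (lpt r a 0 0)))// => x y.
  by have := eM x 0 0 y 0 0; rewrite !addr0 mulr0.
have E2 : eps (lpt r 0 b 0) = delta2 eps ^ b.
  rewrite delta2_lpt (sign_character (e := fun a => eps (lpt r 0 a 0)))// => x y.
  by have := eM 0 x 0 0 y 0; rewrite !addr0 mulr0 mul0r.
have E3 : eps (lpt r 0 0 c) = delta3 eps ^ c.
  rewrite delta3_lpt (sign_character (e := fun a => eps (lpt r 0 0 a)))// => x y.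
  by have := eM 0 0 x 0 0 y; rewrite !mulr0 !addr0.
rewrite -E1 -E2 -E3 [X in X * _]mulrC -!eM; congr (eps (lpt r _ _ _)); ring.
Qed.

(** The generators g(r,0,0) and g(0,1,0) commute up to the central element g(0,0,r), so the r-th
    power of delta3 is 1. *)
Lemma delta3_odd : odd r -> delta3 eps = 1.
Proof.
move=> odr; have := eM 1 0 0 0 1 0.
rewrite !spin_structureE !expr0z !expr1z !(mulr1, mul1r, add0r, addr0).
case: delta3_sign => [//|->]; rewrite expN1r -signr_odd absz_nat odr.
by case: delta1_sign => ->; case: delta2_sign => ->.
Qed.

End SpinStructure.

Lemma spin_structure_unique (r : nat) (eps eps' : V -> int) : (0 < r)%N ->
  spin_structure r eps -> spin_structure r eps' ->
  delta1 r eps = delta1 r eps' -> delta2 eps = delta2 eps' -> delta3 eps = delta3 eps' ->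
  forall g, lattice r g -> eps g = eps' g.
Proof.
move=> r0 H H' e1 e2 e3 g [a [b [c ->]]].
by rewrite -/(lpt r a b c) !spin_structureE// e1 e2 e3.
Qed.

Lemma spin_structure_exists (r : nat) (d1 d2 d3 : int) : (0 < r)%N ->
  is_sign d1 -> is_sign d2 -> is_sign d3 ->
  (exists eps : V -> int,
     [/\ spin_structure r eps, delta1 r eps = d1, delta2 eps = d2 & delta3 eps = d3])
  <-> (d3 = -1 -> ~~ odd r).
Proof.
move=> r0 s1 s2 s3; split=> [[eps [H _ _ <-]] d3N|Hd].
  by apply/negP => odr; move: d3N; rewrite (delta3_odd H odr).
(* The value is prescribed on the lattice, where the coordinates are unique by [lpt_inj], and set to
   1 elsewhere. *)
have /choice [eps Heps] : forall g : V, exists e : int,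
    forall a b c, g = lpt r a b c -> e = d1 ^ a * d2 ^ b * d3 ^ c.
  move=> g; have [[a [b [c ->]]]|ng] := pselect (lattice r g).
    exists (d1 ^ a * d2 ^ b * d3 ^ c) => a' b' c' H.
    by have [-> -> ->] := lpt_inj r0 H.
  by exists 1 => a b c Hg; case: ng; rewrite Hg; exact: lattice_lpt.
have E a b c : eps (lpt r a b c) = d1 ^ a * d2 ^ b * d3 ^ c by exact: Heps.
exists eps; split.
- split=> [g [a [b [c ->]]]|g h [a [b [c ->]]] [a' [b' [c' ->]]]].
    rewrite -/(lpt r a b c) E.
    have [] := (is_sign_exp a s1, is_sign_exp b s2, is_sign_exp c s3).
    by move=> [[]-> []->] []->; (by left) || (by right).
  rewrite -/(lpt r a b c) -/(lpt r a' b' c') lpt_mul !E.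
  rewrite !exprzDr ?is_sign_unit//.
  (* This is the contribution of the twist in the group law, the only obstruction to
     multiplicativity; it disappears when [d3] is 1 or r is even. *)
  have -> : d3 ^ (r%:Z * a * b') = 1.
    case: s3 => d3E; rewrite d3E; first by rewrite exp1rz.
    by rewrite expN1r -signr_odd !abszM !oddM absz_nat (negbTE (Hd d3E)).
  by ring.
- by rewrite (delta1_lpt r) E; rewrite !expr0z expr1z !mulr1.
- by rewrite (delta2_lpt r) E; rewrite !expr0z expr1z mulr1 mul1r.
- by rewrite (delta3_lpt r) E; rewrite !expr0z expr1z !mul1r.
Qed.

End SpinStructures.

(** * Averages along one-parameter subgroups and Fourier coefficients *)

Section Boundedness.
Context {R : realType}.
Local Notation V := 'rV[R]_3.
Implicit Types f : V -> R.

Lemma hpt_eta (g : V) : g = hpt (g 0 0) (g 0 1) (g 0 2%:R).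
Proof.
by apply/rowP => -[[|[|[|//]]] Hi]; rewrite mxE /=; congr (g _ _); exact: val_inj.
Qed.

Lemma continuous_bounded_box f (B : R) : continuous f ->
  exists K, forall g : V, (forall i, `|g 0 i| <= B) -> `|f g| <= K.
Proof.
move=> cf; have [B0|B0] := leP 0 B; last first.
  by exists 0 => g /(_ 0) gB; have := le_lt_trans gB B0; rewrite normr_lt0.
pose A := [set v : V | forall i, `[- B, B]%classic (v ord0 i)].
have cA : compact A.
  by apply: (@rV_compact _ _ (fun=> `[- B, B]%classic)) => _; exact: segment_compact.
have A0 : A !=set0 by exists 0 => i; rewrite mxE /= in_itv /= oppr_le0 B0.
have [|c _ Hc] := @EVT_max_rV _ _ (fun g => `|f g|) A A0 cA.
  apply: continuous_subspaceT => x.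
  by apply: (@continuous_comp _ _ _ f (fun y => `|y|)); [exact: cf|exact: norm_continuous].
exists `|f c| => g gB; apply: Hc; rewrite inE => i /=.
by rewrite in_itv /= -ler_norml; have := gB i.
Qed.

(** Every lattice orbit meets the box with x in [0, r] and y, z in [0, 1], where a continuous
    function is bounded, and [|f|] is constant on orbits. *)
Lemma equivariant_bounded r (eps : V -> int) f : (0 < r)%N -> spin_structure r eps ->
  continuous f -> equivariant r eps f -> exists K, forall g, `|f g| <= K.
Proof.
move=> r0 He cf ef.
have [K HK] := continuous_bounded_box (r%:R + 1) cf; exists K => g.
have r0' : 0 < r%:R :> R by rewrite ltr0n.
pose a := - Num.floor (g 0 0 / r%:R).
pose b := - Num.floor (g 0 1).
(* The translation by [r a] in x shears z by [r a y], which must be added before the integer part of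
   z is removed. *)
pose c := - Num.floor (g 0 2%:R + r%:R * a%:~R * g 0 1).
have := ef (lpt r a b c) g (lattice_lpt r a b c).
have -> : `|f g| = `|(eps (lpt r a b c))%:~R * f g|.
  have [] := proj1 He _ (lattice_lpt r a b c) => ->; first by rewrite mul1r.
  by rewrite mulN1r normrN.
move=> <-; apply: HK.
have fl (x : R) : `|x - (Num.floor x)%:~R| <= 1.
  have /andP[h1 h2] := floor_itv x; rewrite ger0_norm ?subr_ge0//.
  by rewrite lerBlDl ltW// -(intrD _ _ 1).
rewrite /lpt {1}[g]hpt_eta hmulE.
case=> -[|[|[|//]]] Hi; rewrite mxE /=.
- have -> : r%:R * a%:~R + g 0 0 = r%:R * (g 0 0 / r%:R - (Num.floor (g 0 0 / r%:R))%:~R).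
    by rewrite /a rmorphN /=; field; rewrite gt_eqF.
  rewrite normrM gtr0_norm//; apply: (@le_trans _ _ r%:R); last by rewrite lerDl.
  by rewrite -[leRHS]mulr1 ler_wpM2l// ltW.
- by rewrite /b rmorphN addrC; apply: (le_trans (fl _)); rewrite lerDr ltW.
- by rewrite /c rmorphN /= -addrA addrC; apply: (le_trans (fl _)); rewrite lerDr ltW.
Qed.

End Boundedness.

(** * Weighted integrals over segments: continuity, smoothness, integration by parts *)

Section ParametricIntegral.
Context {R : realType}.
Local Notation V := 'rV[R]_3.
Local Notation mu := (@lebesgue_measure R).
Implicit Types (f : V -> R) (k h : R -> R) (w v : V).

(** The weight [k] will be a cosine or a sine and [w] a period vector, so coefficients in x, y and z
    are instances of one construction. *)
Definition J w k f : V -> R := fun g => \int[mu]_(t in `[0, 1]) (f (g + t *: w) * k t).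

Lemma continuous_integrable h : continuous h -> mu.-integrable `[0, 1] (EFin \o h).
Proof.
move=> ch; apply: continuous_compact_integrable; first exact: segment_compact.
exact: continuous_subspaceT.
Qed.

Lemma continuous_line f (g w : V) : continuous f -> continuous (fun t : R => f (g + t *: w)).
Proof.
move=> cf t; apply: (@continuous_comp _ _ _ (fun t : R => g + t *: w) f); last exact: cf.
by apply: cvgD; [exact: cvg_cst|apply: cvgZr_tmp; exact: cvg_id].
Qed.

Lemma continuous_Jarg f k (g w : V) : continuous f -> continuous k ->
  continuous (fun t : R => f (g + t *: w) * k t).
Proof. by move=> cf ck; apply: continuous_mul => //; exact: continuous_line. Qed.

Lemma ge0_Rintegral01_le h (K : R) : continuous h -> (forall t, 0 <= t <= 1 -> `|h t| <= K) ->
  `|\int[mu]_(t in `[0, 1]) h t| <= K.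
Proof.
move=> ch hK.
apply: (le_trans (le_normr_Rintegral _ (continuous_integrable ch))) => //.
apply: (@le_trans _ _ (\int[mu]_(t in `[0, 1]) K)).
  have i1 : mu.-integrable `[0, 1] (EFin \o (fun t => `|h t|)).
    apply: continuous_integrable => t.
    by apply: (@continuous_comp _ _ _ h (fun y => `|y|)); [exact: ch|exact: norm_continuous].
  have i2 : mu.-integrable `[0, 1] (EFin \o (fun=> K)).
    by apply: continuous_integrable; exact: continuous_cst.
  by apply: (le_Rintegral _ i1 i2) => // t /=; rewrite in_itv /=; exact: hK.
rewrite Rintegral_cst//= lebesgue_measure_itv /= lte_fin ltr01 oppr0 adde0 /=.
by rewrite mulr1.
Qed.

Lemma J_lin w k f1 f2 (a : R) : continuous k -> continuous f1 -> continuous f2 ->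
  J w k (fun x => a * f1 x + f2 x) = fun x => a * J w k f1 x + J w k f2 x.
Proof.
move=> ck c1 c2; apply/funext => g; rewrite /J.
rewrite -RintegralZl//; last exact/continuous_integrable/continuous_Jarg.
rewrite -RintegralD//.
- by apply: eq_Rintegral => t _; ring.
- apply: continuous_integrable; apply: continuous_mul; first exact: continuous_cst.
  exact: continuous_Jarg.
- exact/continuous_integrable/continuous_Jarg.
Qed.

Lemma continuous_bounded01 h : continuous h -> exists2 K, 0 <= K &
  forall t, 0 <= t <= 1 -> `|h t| <= K.
Proof.
move=> ch.
have [|c _ Hc] := @EVT_max _ (fun t => `|h t|) 0 1 ler01.
  apply: continuous_subspaceT => t.
  by apply: (@continuous_comp _ _ _ h (fun y => `|y|)); [exact: ch|exact: norm_continuous].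
by exists `|h c| => // t ht; apply: Hc; rewrite in_itv.
Qed.

Lemma J_continuous w k f : continuous k -> continuous f -> continuous (J w k f).
Proof.
move=> ck cf; apply/continuousP_eps => g e e0.
have [K K0 HK] := continuous_bounded01 ck.
have K1 : 0 < K + 1 by rewrite ltr_wpDl.
have H : forall t : R, `[0, 1]%classic t -> \forall t' \near t & g' \near g,
    `|f (g + t' *: w) - f (g' + t' *: w)| <= e / (K + 1).
  move=> t _.
  have cF : continuous (fun p : R * V => f (p.2 + p.1 *: w)).
    move=> p; apply: (@continuous_comp _ _ _ (fun p : R * V => p.2 + p.1 *: w) f); last exact: cf.
    by apply: cvgD; [exact: cvg_snd|apply: cvgZr_tmp; exact: cvg_fst].
  have e2 : 0 < e / (K + 1) / 2 by rewrite !divr_gt0.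
  have /continuousP_eps/(_ (t, g) _ e2) H1 := cF.
  have cG : continuous (fun p : R * V => f (g + p.1 *: w)).
    move=> p; apply: (@continuous_comp _ _ _ (fun p : R * V => g + p.1 *: w) f); last exact: cf.
    by apply: cvgD; [exact: cvg_cst|apply: cvgZr_tmp; exact: cvg_fst].
  have /continuousP_eps/(_ (t, g) _ e2) H2 := cG.
  apply: filterS2 H1 H2 => -[t' g'] /= H1 H2.
  rewrite [e / _]splitr.
  apply: le_trans (ler_distD (f (g + t *: w)) _ _) _; apply: lerD => //.
  by rewrite distrC.
(* Compactness of [0, 1] makes the pointwise estimates uniform in the integration variable. *)
have HH := iffLR (compact_near_coveringP _) (@segment_compact R 0 1) V (nbhs g)
  (fun g' t => `|f (g + t *: w) - f (g' + t *: w)| <= e / (K + 1)) (nbhs_filter g) H.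
apply: (@filterS _ (nbhs g) (nbhs_filter g) _ _ _ HH) => g' {}HH.
rewrite /J -RintegralB//; try exact/continuous_integrable/continuous_Jarg.
under eq_Rintegral do rewrite -mulrBl.
apply: ge0_Rintegral01_le.
  by apply: continuous_mul => //; apply: continuous_sub; exact: continuous_line.
move=> t t01; rewrite normrM.
have h1 : `|f (g + t *: w) - f (g' + t *: w)| <= e / (K + 1).
  by apply: HH; rewrite set_itvE.
apply: (@le_trans _ _ (e / (K + 1) * (K + 1))).
  apply: ler_pM => //; apply: (le_trans (HK _ t01)); by rewrite lerDl.
by rewrite divfK// gt_eqF.
Qed.

Lemma J_is_derive w k f (v g : V) : continuous k -> continuous f ->
  (forall x, derivable f x v) -> continuous (fun x => 'D_v f x) ->
  is_derive g v (J w k f) (J w k (fun x => 'D_v f x) g).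
Proof.
move=> ck cf df cdf; apply/is_derive_line0.
pose F (s t : R) := f (g + s *: v + t *: w) * k t.
pose dF (s t : R) := 'D_v f (g + s *: v + t *: w) * k t.
have dFP (s t : R) : is_derive s 1 (F ^~ t) (dF s t).
  have -> : F ^~ t = fun s => k t * f ((g + t *: w) + s *: v).
    by apply/funext => x; rewrite /F mulrC addrAC.
  rewrite /dF mulrC; apply: is_deriveZ.
  by rewrite addrAC -is_derive_line; exact/derivableP.
have [K K0 HK] := continuous_bounded01 ck.
(* For [|s| < 1] and t in [0, 1] every coordinate of [g + s *: v + t *: w] is bounded by this sum,
   so the derivative of the integrand is dominated by a constant. *)
have [L HL] := continuous_bounded_box (\sum_i (`|g 0 i| + `|v 0 i| + `|w 0 i|)) cdf.
have bd (s t : R) : `]-1, 1[%classic s -> `[0, 1]%classic t ->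
    `|partial1of2 F s t| <= `|L| * K.
  rewrite /= !in_itv /= => s1 t01.
  have -> : partial1of2 F s t = dF s t by rewrite partial1of2E; apply: derive_val.
  rewrite normrM; apply: ler_pM => //; last exact: HK.
  apply: le_trans (ler_norm L); apply: HL => i; rewrite !mxE.
  apply: (@le_trans _ _ (`|g 0 i| + `|v 0 i| + `|w 0 i|)); last first.
    by rewrite (bigD1 i)//= lerDl sumr_ge0// => j _; rewrite !addr_ge0.
  apply: (le_trans (ler_normD _ _)); apply: lerD; last first.
    by rewrite normrM ler_piMl// ger0_norm; move: t01 => /andP[].
  apply: (le_trans (ler_normD _ _)); apply: lerD => //.
  by rewrite normrM ler_piMl// ler_norml; move: s1 => /andP[/ltW -> /ltW ->].
have I0 : `]-1, 1[%classic (0 : R) by rewrite /= in_itv /= oppr_lt0 ltr01.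
have iF (s : R) : mu.-integrable `[0, 1] (EFin \o F s).
  exact/continuous_integrable/continuous_Jarg.
have iG : mu.-integrable `[0, 1] (EFin \o (fun=> `|L| * K)).
  by apply: (@continuous_integrable (fun=> `|L| * K)); exact: continuous_cst.
have G0 (t : R) : 0 <= `|L| * K by rewrite mulr_ge0.
have dd (s t : R) : `]-1, 1[%classic s -> `[0, 1]%classic t -> derivable (F ^~ t) s 1.
  by move=> _ _; case: (dFP s t).
have mI : measurable `[(0 : R), 1] by [].
have D1 := @derivable_under_integral R _ _ mu F _ mI 0 (-1) 1 I0 (fun s _ => iF s) dd
  _ G0 iG bd.
have D2 := @differentiation_under_integral R _ _ mu F _ mI 0 (-1) 1 I0 (fun s _ => iF s) dd
  _ G0 iG bd.
have -> : (fun s : R => J w k f (g + s *: v)) = fun s => \int[mu]_(t in `[0, 1]) F s t.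
  by [].
constructor; first exact: D1.
rewrite -derive1E D2 /J; apply: eq_Rintegral => t _.
rewrite partial1of2E; have -> : 'D_v f (g + t *: w) * k t = dF 0 t.
  by rewrite /dF scale0r addr0.
exact: derive_val.
Qed.

Lemma J_smooth w k f : continuous k -> smooth f -> smooth (J w k f) /\
  forall i, pd i (J w k f) = J w k (pd i f).
Proof.
move=> ck sf.
have H (h : V -> R) i : smooth h ->
    forall x, is_derive x (delta_mx 0 i) (J w k h) (J w k (pd i h) x).
  move=> sh x; apply: J_is_derive => //.
  - exact: smooth_continuous.
  - by move=> y; case: (smooth_is_derive i y sh).
  - exact/smooth_continuous/smooth_pd.
split; last by move=> i; apply: pdE => x; exact: H.
pose S (h : V -> R) := exists2 f, smooth f & h = J w k f.
have SJ : S (J w k f) by exists f.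
move: (J w k f) SJ; apply: smooth_coind.
move=> _ [{}f {}sf ->]; split; first by apply: J_continuous => //; exact: smooth_continuous.
move=> i; split; first by move=> x; case: (H f i sf x).
by exists (pd i f); [exact: smooth_pd|apply: pdE => x; exact: H].
Qed.

Lemma J_bounded w k f (K : R) : continuous k -> (forall t, `|k t| <= 1) -> continuous f ->
  (forall g, `|f g| <= K) -> forall g, `|J w k f g| <= K.
Proof.
move=> ck k1 cf fK g; apply: ge0_Rintegral01_le; first exact: continuous_Jarg.
move=> t _; rewrite normrM -[leRHS]mulr1; apply: ler_pM => //.
Qed.

(* Integration by parts on a period: the boundary terms cancel since f and k have the same
   multiplier chi under translation by one period. *)
Lemma J_parts w (k dk : R -> R) f (chi : R) :
  (forall t : R, is_derive t 1 k (dk t)) -> continuous dk -> smooth f ->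
  (forall x, derivable f x w) -> continuous (fun x => 'D_w f x) ->
  (forall g, f (g + w) = chi * f g) -> chi * k 1 = k 0 ->
  J w k (fun x => 'D_w f x) = fun g => - J w dk f g.
Proof.
move=> hk cdk sf df cdf fw chik; apply/funext => g; rewrite /J.
pose phi (t : R) := f (g + t *: w).
have dphi (t : R) : is_derive t 1 phi ('D_w f (g + t *: w)).
  by rewrite -is_derive_line; exact/derivableP.
have ck : continuous k.
  by move=> t; apply/differentiable_continuous/derivable1_diffP; case: (hk t).
have cphi : continuous phi by apply: continuous_line; exact: smooth_continuous.
have LR (h dh : R -> R) : (forall t : R, is_derive t 1 h (dh t)) -> continuous h ->
    derivable_oo_LRcontinuous h 0 1.
  move=> dh_ ch; split; first by move=> t _; case: (dh_ t).
    exact/cvg_at_right_filter/ch.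
  exact/cvg_at_left_filter/ch.
have D1 (h dh : R -> R) : (forall t : R, is_derive t 1 h (dh t)) -> {in `]0, 1[, derive1 h =1 dh}.
  by move=> H t _; rewrite derive1E; apply: derive_val.
have := @Rintegration_by_parts R k phi dk (fun t => 'D_w f (g + t *: w)) 0 1 ltr01
  (continuous_subspaceT cdk) (LR _ _ hk ck) (D1 _ _ hk)
  (continuous_subspaceT (@continuous_line _ g w cdf)) (LR _ _ dphi cphi) (D1 _ _ dphi).
rewrite /phi scale1r scale0r addr0 fw mulrA [k 1 * chi]mulrC chik subrr add0r.
under eq_Rintegral do rewrite mulrC; move=> ->.
by congr (- _); apply: eq_Rintegral => t _; rewrite mulrC.
Qed.

End ParametricIntegral.

(** * Uniqueness of Fourier coefficients at the midpoint *)

Section FourierUniqueness.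
Context {R : realType}.
Local Notation mu := (@lebesgue_measure R).
Implicit Types (h phi psi : R -> R).

Lemma cos_mul_cos (a b : R) : cos a * cos b = 2^-1 * (cos (a + b) + cos (a - b)).
Proof. by rewrite cosD cosB; field. Qed.

Lemma cos_addpi (x : R) : cos (x + pi) = - cos x.
Proof. by rewrite cosD cospi sinpi; ring. Qed.

Lemma cos_subpi (x : R) : cos (x - pi) = - cos x.
Proof. by rewrite cosB cospi sinpi; ring. Qed.

Lemma continuous_cos_affine (a b : R) : continuous (fun t : R => cos (a * t + b)).
Proof.
move=> t; apply: (@continuous_comp _ _ _ (fun t : R => a * t + b) (@cos R)).
  apply: continuous_add; last exact: continuous_cst.
  by apply: continuous_mul; [exact: continuous_cst|move=> x; exact: cvg_id].
exact: continuous_cos.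
Qed.

Lemma Rintegral01_ge h (a b v : R) : continuous h -> 0 <= a -> a <= b -> b <= 1 ->
  (forall t, 0 <= t <= 1 -> 0 <= h t) -> (forall t, a <= t <= b -> v <= h t) ->
  v * (b - a) <= \int[mu]_(t in `[0, 1]) h t.
Proof.
move=> ch a0 ab b1 h0 hv.
have sub : `[a, b] `<=` `[0, 1].
  move=> t /=; rewrite !in_itv /= => /andP[at_ tb].
  by rewrite (le_trans a0 at_) (le_trans tb b1).
have -> : v * (b - a) = \int[mu]_(t in `[0, 1]) ((fun=> v) \_ `[a, b]) t.
  rewrite -Rintegral_mkcondr setIidr//.
  rewrite Rintegral_cst//= lebesgue_measure_itv /= lte_fin.
  by move: ab; rewrite le_eqVlt => /predU1P[->|->]; rewrite ?ltxx ?subrr.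
have i1 : mu.-integrable `[0, 1] (EFin \o ((fun=> v) \_ `[a, b])).
  rewrite -restrict_EFin; apply/integrable_restrict => //=; rewrite setIidr//.
  apply: continuous_compact_integrable; first exact: segment_compact.
  by apply: continuous_subspaceT; exact: continuous_cst.
apply: (le_Rintegral _ i1 (continuous_integrable ch)) => // t.
rewrite patchE /=; case: ifPn => [|_]; last by rewrite in_itv /=; exact: h0.
by rewrite inE /= in_itv /= => /hv.
Qed.

(* The powers of q concentrate at the midpoint of [0, 1]. *)
Let q (t : R) : R := (1 + cos (2 * pi * t - pi)) / 2.

Let qE t : q t = (1 - cos (2 * pi * t)) / 2.
Proof. by rewrite /q cos_subpi. Qed.

Let q_ge0 t : 0 <= q t.
Proof. by rewrite /q divr_ge0// -lerBlDl sub0r cos_geN1. Qed.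

Let continuous_q : continuous q.
Proof.
apply: continuous_mul; last exact: continuous_cst.
apply: continuous_add; [exact: continuous_cst|exact: continuous_cos_affine].
Qed.

Let continuous_qX n : continuous (fun t => q t ^+ n).
Proof.
elim: n => [|n IH]; first exact: continuous_cst.
by under eq_fun do rewrite exprS; exact: continuous_mul.
Qed.

Let q_mono (s t : R) : 0 <= t <= 1 -> 0 <= s -> s <= `|t - 2^-1| -> q t <= q (2^-1 + s).
Proof.
move=> /andP[t0 t1] s0 st.
have pi0 : 0 < pi :> R := pi_gt0 R.
rewrite /q ler_pM2r ?invr_gt0// lerD2l.
have -> : 2 * pi * (2^-1 + s) - pi = 2 * pi * s by field.
have -> : 2 * pi * t - pi = 2 * pi * (t - 2^-1) by field.
have -> : cos (2 * pi * (t - 2^-1)) = cos (2 * pi * `|t - 2^-1|).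
  by rewrite -cos_norm normrM gtr0_norm// mulr_gt0.
have tn : `|t - 2^-1| <= 2^-1 by rewrite ler_norml; lra.
have s2 : s <= 2^-1 := le_trans st tn.
by rewrite leNgt ltr_cos -?leNgt ?in_itv /=; nra.
Qed.

Let q_lt (s u : R) : 0 <= s -> s < u -> u <= 2^-1 -> q (2^-1 + u) < q (2^-1 + s).
Proof.
move=> s0 su u2; have pi0 : 0 < pi :> R := pi_gt0 R.
rewrite /q ltr_pM2r ?invr_gt0// ltrD2l.
have H x : 2 * pi * (2^-1 + x) - pi = 2 * pi * x by field.
by rewrite !H ltr_cos ?in_itv /=; nra.
Qed.

(** If [psi] were positive at 1/2, the integral of [psi q^n] would gain at least a multiple of
    [qb^n] near 1/2 and lose at most a multiple of [qa^n] away from it, with [qa < qb]; letting n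
    grow contradicts vanishing. *)
Lemma concentration psi : continuous psi ->
  (forall n, \int[mu]_(t in `[0, 1]) (psi t * q t ^+ n) = 0) -> psi 2^-1 <= 0.
Proof.
move=> cpsi H; rewrite leNgt; apply/negP => c0; set c := psi 2^-1 in c0.
have c2 : 0 < c / 2 by rewrite divr_gt0.
have /continuousP_eps/(_ 2^-1 _ c2) /nbhs_ballP[e /= e0 he] := cpsi.
pose s := Num.min (e / 2) 2^-1.
have s0 : 0 < s by rewrite lt_min divr_gt0//= invr_gt0.
have se : s < e by rewrite gt_min; apply/orP; left; rewrite ltr_pdivrMr// mulr_natr mulr2n ltrDl.
have s2 : s <= 2^-1 by rewrite ge_min lexx orbT.
have psige t : `|t - 2^-1| <= s -> c / 2 <= psi t.
  move=> ts; have /he : ball (2^-1 : R) e t.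
    by rewrite -ball_normE /= distrC (le_lt_trans ts).
  by rewrite -/c ler_norml => /andP[_]; lra.
have [M M0 HM] := continuous_bounded01 cpsi.
(* [qa] bounds [q] from above outside the s-neighbourhood of 1/2, and [qb] bounds it from below on
   the neighbourhood of half that radius. *)
pose qa := q (2^-1 + s); pose qb := q (2^-1 + s / 2).
have qab : qa < qb by apply: q_lt; lra.
have qb0 : 0 < qb := le_lt_trans (q_ge0 _) qab.
have key n : c / 2 * s <= M * (qa / qb) ^+ n.
  have : (c / 2 * qb ^+ n) * ((2^-1 + s / 2) - (2^-1 - s / 2)) <=
      \int[mu]_(t in `[0, 1]) (psi t * q t ^+ n + M * qa ^+ n).
    apply: Rintegral01_ge; try lra.
    - by apply: continuous_add; [exact: continuous_mul|exact: continuous_cst].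
    - move=> t t01; have [ts|ts] := leP `|t - 2^-1| s.
        by rewrite addr_ge0 ?mulr_ge0 ?exprn_ge0 ?q_ge0// (le_trans _ (psige _ ts))// ltW.
      have qt : q t ^+ n <= qa ^+ n.
        by rewrite lerXn2r ?nnegrE ?q_ge0// q_mono// ltW.
      have := HM _ t01; rewrite ler_norml => /andP[M1 _].
      apply: (@le_trans _ _ (- M * q t ^+ n + M * q t ^+ n)).
        by rewrite mulNr addNr.
      apply: lerD; last by rewrite ler_wpM2l.
      by rewrite ler_wpM2r// exprn_ge0 ?q_ge0.
    - move=> t ht; have ts : `|t - 2^-1| <= s / 2 by rewrite ler_norml; lra.
      rewrite -[leLHS]addr0 lerD//; last by rewrite mulr_ge0// exprn_ge0 ?q_ge0.
      apply: ler_pM; [exact: ltW|by rewrite exprn_ge0 ?q_ge0| |].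
        by apply: psige; apply: (le_trans ts); lra.
      rewrite lerXn2r ?nnegrE ?q_ge0//.
      have -> : q t = q (2^-1 + `|t - 2^-1|).
        rewrite /q; have -> : 2 * pi * (2^-1 + `|t - 2^-1|) - pi = 2 * pi * `|t - 2^-1| by field.
        have -> : 2 * pi * t - pi = 2 * pi * (t - 2^-1) by field.
        rewrite -[in LHS]cos_norm normrM gtr0_norm// mulr_gt0//; exact: pi_gt0.
      have [->//|ne] := eqVneq `|t - 2^-1| (s / 2).
      by apply/ltW/q_lt => //; [rewrite lt_neqAle ne|lra].
  rewrite RintegralD//; last 2 first.
  - by apply: continuous_integrable; exact: continuous_mul.
  - by apply: (@continuous_integrable _ (fun=> M * qa ^+ n)); exact: continuous_cst.
  rewrite H add0r Rintegral_cst//= lebesgue_measure_itv /= lte_fin ltr01 oppr0 adde0 /= mulr1.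
  have -> : (2^-1 + s / 2) - (2^-1 - s / 2) = s by field.
  by move=> h; rewrite expr_div_n [leRHS]mulrA ler_pdivlMr ?exprn_gt0// mulrAC.
have rho1 : `|qa / qb| < 1.
  by rewrite ger0_norm ?divr_ge0 ?q_ge0// ltr_pdivrMr// mul1r.
have : (fun n => M * (qa / qb) ^+ n) @ \oo --> M * 0.
  by apply: cvgM; [exact: cvg_cst|exact: cvg_expr].
have cs : 0 < c / 2 * s by rewrite mulr_gt0.
rewrite mulr0 => /cvgrPdist_lt/(_ _ cs)[N _ /(_ N (leqnn N))] /=.
rewrite sub0r normrN ltNge; move/negP; apply.
exact: le_trans (key N) (ler_norm _).
Qed.

(** Multiplication by a cosine of frequency [b0] that equals 1 at the midpoint turns the shifted
    frequencies into integers without changing the value at 1/2. Powers of [q] are trigonometric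
    polynomials, so they integrate to 0 against the product, and [concentration] applies. *)
Lemma fourier_unique01 phi (b0 : R) : continuous phi ->
  (forall (m : int) (s : R),
     \int[mu]_(t in `[0, 1]) (phi t * cos (2 * pi * (b0 + m%:~R) * t + s)) = 0) ->
  (forall (m : int) (s : R),
     \int[mu]_(t in `[0, 1]) (phi t * cos (2 * pi * (m%:~R - b0) * t + s)) = 0) ->
  phi 2^-1 = 0.
Proof.
move=> cphi H1 H2.
pose psi t := phi t * cos (2 * pi * b0 * t - pi * b0).
have cpsi : continuous psi by apply: continuous_mul => //; exact: continuous_cos_affine.
have lin a (f g : R -> R) : continuous f -> continuous g ->
    \int[mu]_(t in `[0, 1]) (a * (f t + g t)) =
    a * (\int[mu]_(t in `[0, 1]) f t + \int[mu]_(t in `[0, 1]) g t).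
  move=> cf cg; rewrite RintegralZl//; last by apply: continuous_integrable; exact: continuous_add.
  by rewrite RintegralD//; exact: continuous_integrable.
have H0 (m : int) (s : R) :
    \int[mu]_(t in `[0, 1]) (psi t * cos (2 * pi * m%:~R * t + s)) = 0.
  transitivity (\int[mu]_(t in `[0, 1]) (2^-1 *
     (phi t * cos (2 * pi * (b0 + m%:~R) * t + (s - pi * b0)) +
      phi t * cos (2 * pi * (m%:~R - b0) * t + (s + pi * b0))))).
    apply: eq_Rintegral => t _; rewrite /psi -mulrA [cos (_ - _) * _]mulrC cos_mul_cos.
    rewrite -mulrDr mulrCA; congr (_ * (_ * (cos _ + cos _))); ring.
  rewrite lin ?H1 ?H2 ?addr0 ?mulr0//; apply: continuous_mul => //; exact: continuous_cos_affine.
(* Multiplication by [q] shifts an integer frequency by -1, 0 or 1, so the vanishing passes from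
   [q^n] to [q^(n+1)]. *)
have Hn n (m : int) (s : R) :
    \int[mu]_(t in `[0, 1]) (psi t * q t ^+ n * cos (2 * pi * m%:~R * t + s)) = 0.
  elim: n m s => [|n IH] m s.
    by under eq_Rintegral do rewrite expr0 mulr1; exact: H0.
  have cc (a b : R) : continuous (fun t => psi t * q t ^+ n * cos (a * t + b)).
    by apply: continuous_mul; [exact: continuous_mul|exact: continuous_cos_affine].
  transitivity (\int[mu]_(t in `[0, 1]) (2^-1 *
     (psi t * q t ^+ n * cos (2 * pi * m%:~R * t + s) +
      - 2^-1 * (psi t * q t ^+ n * cos (2 * pi * (m + 1)%:~R * t + s) +
         psi t * q t ^+ n * cos (2 * pi * (m - 1)%:~R * t + s))))).
    apply: eq_Rintegral => t _; rewrite exprS qE.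
    have -> : 2 * pi * (m + 1)%:~R * t + s = (2 * pi * m%:~R * t + s) + 2 * pi * t.
      by rewrite intrD; ring.
    have -> : 2 * pi * (m - 1)%:~R * t + s = (2 * pi * m%:~R * t + s) - 2 * pi * t.
      by rewrite intrB; ring.
    by move: (2 * pi * m%:~R * t + s) => th; rewrite cosD cosB; field.
  rewrite lin//; last first.
    apply: continuous_mul; [exact: continuous_cst|exact: continuous_add].
  by rewrite lin// !IH !addr0 !mulr0 addr0 mulr0.
(* Only an upper bound comes from [concentration], so it is applied to both signs of the
   function. *)
have E (e : R) : e * e = 1 -> e * phi 2^-1 <= 0.
  move=> ee; have -> : e * phi 2^-1 = e * psi 2^-1.
    have E0 : 2 * pi * b0 / 2 - pi * b0 = 0 :> R by field.
    by rewrite /psi E0 cos0 mulr1.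
  apply: (@concentration (fun t => e * psi t)).
    by apply: continuous_mul => //; exact: continuous_cst.
  move=> n; under eq_Rintegral do rewrite -mulrA.
  rewrite RintegralZl//; last by apply: continuous_integrable; exact: continuous_mul.
  have := Hn n 0 0; under eq_Rintegral do rewrite mulr0 mul0r add0r cos0 mulr1.
  by move=> ->; rewrite mulr0.
apply/eqP; rewrite eq_le -[X in X <= _ ]mul1r (E 1) ?mulr1//=.
by rewrite -oppr_le0 -mulN1r E// mulrNN mulr1.
Qed.

End FourierUniqueness.

(** * Complex-valued functions of a real variable *)

Section ComplexDerivative.
Local Open Scope complex_scope.
Context {R : realType}.
Local Notation C := R[i].
Implicit Types (phi psi : R -> C) (l m : C) (s t : R).

Lemma complexP (x y : C) :
  complex.Re x = complex.Re y -> complex.Im x = complex.Im y -> x = y.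
Proof. by move=> h1 h2; apply/eqP; rewrite eq_complex h1 h2 !eqxx. Qed.

Definition cder phi l s :=
  is_derive s 1 (fun t => complex.Re (phi t)) (complex.Re l) /\
  is_derive s 1 (fun t => complex.Im (phi t)) (complex.Im l).

Lemma cder_eq phi l m s : cder phi l s -> l = m -> cder phi m s.
Proof. by move=> h <-. Qed.

Lemma cder_unique phi l m s : cder phi l s -> cder phi m s -> l = m.
Proof.
by move=> [h1 h2] [h3 h4]; apply: complexP;
  [exact: (is_derive_unique h1 h3)|exact: (is_derive_unique h2 h4)].
Qed.

Lemma cder_cst l s : cder (fun=> l) 0 s.
Proof. by split; exact: is_derive_cst. Qed.

Lemma cderD phi psi l m s : cder phi l s -> cder psi m s ->
  cder (fun t => phi t + psi t) (l + m) s.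
Proof.
move=> [h1 h2] [h3 h4]; split.
- have -> : (fun t => complex.Re (phi t + psi t)) =
    (fun t => complex.Re (phi t)) + (fun t => complex.Re (psi t)).
    by apply/funext => t; rewrite /= raddfD.
  by rewrite raddfD; exact: is_deriveD.
- have -> : (fun t => complex.Im (phi t + psi t)) =
    (fun t => complex.Im (phi t)) + (fun t => complex.Im (psi t)).
    by apply/funext => t; rewrite /= raddfD.
  by rewrite raddfD; exact: is_deriveD.
Qed.

Lemma cderM phi psi l m s : cder phi l s -> cder psi m s ->
  cder (fun t => phi t * psi t) (l * psi s + phi s * m) s.
Proof.
move=> [h1 h2] [h3 h4].
have := is_derive_mul h1 h3; have := is_derive_mul h2 h4.
have := is_derive_mul h1 h4; have := is_derive_mul h2 h3.
move=> k1 k2 k3 k4; split.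
- have -> : (fun t => complex.Re (phi t * psi t)) =
    (fun t => complex.Re (phi t) * complex.Re (psi t)) -
    (fun t => complex.Im (phi t) * complex.Im (psi t)).
    by apply/funext => t /=; rewrite ?fctE; case: (phi t) => ? ?; case: (psi t) => ? ?.
  apply: (is_derive_eq (is_deriveB k4 k3)).
  clear; by case: (phi s) => ? ?; case: (psi s) => ? ?; case: l => ? ?; case: m => ? ? /=; ring.
- have -> : (fun t => complex.Im (phi t * psi t)) =
    (fun t => complex.Re (phi t) * complex.Im (psi t)) +
    (fun t => complex.Im (phi t) * complex.Re (psi t)).
    by apply/funext => t /=; rewrite ?fctE; case: (phi t) => ? ?; case: (psi t) => ? ?.
  apply: (is_derive_eq (is_deriveD k2 k1)).
  clear; by case: (phi s) => ? ?; case: (psi s) => ? ?; case: l => ? ?; case: m => ? ? /=; ring.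
Qed.

Lemma cderZ phi l a s : cder phi l s -> cder (fun t => a * phi t) (a * l) s.
Proof. by move=> h; apply: (cder_eq (cderM (cder_cst a s) h)); rewrite mul0r add0r. Qed.

Lemma cder_real (f : R -> R) (a s : R) : is_derive s 1 f a -> cder (fun t => (f t)%:C) a%:C s.
Proof. by move=> h; split => //=; exact: is_derive_cst. Qed.

Lemma cder0_cst phi : (forall s, cder phi 0 s) -> forall s t, phi s = phi t.
Proof.
move=> h s t; apply: complexP.
- by apply: (@is_derive_0_is_cst _ (fun t => complex.Re (phi t))) => x; case: (h x).
- by apply: (@is_derive_0_is_cst _ (fun t => complex.Im (phi t))) => x; case: (h x).
Qed.

Lemma cisD s t : cis (s + t) = cis s * cis t :> C.
Proof. by rewrite /cis cosD sinD; apply: complexP => //=; ring. Qed.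

Lemma cis0 : cis 0 = 1 :> C.
Proof. by rewrite /cis cos0 sin0. Qed.

Lemma cis_mulN s : cis s * cis (- s) = 1 :> C.
Proof. by rewrite -cisD subrr cis0. Qed.


Lemma is_derive_mulc (a s : R) : is_derive s 1 (fun t : R => a * t) a.
Proof.
by have := is_derive_affine 0 a s; under eq_fun do rewrite add0r mulrC.
Qed.

Lemma is_derive_cos_mul (a s : R) : is_derive s 1 (fun t : R => cos (a * t)) (- (a * sin (a * s))).
Proof.
have h := @is_derive1_comp R (@cos R) (fun t => a * t) s _ _ (is_derive_cos (a * s)) (is_derive_mulc a s).
by apply: (is_derive_eq h); ring.
Qed.

Lemma is_derive_sin_mul (a s : R) : is_derive s 1 (fun t : R => sin (a * t)) (a * cos (a * s)).
Proof.
have h := @is_derive1_comp R (@sin R) (fun t => a * t) s _ _ (is_derive_sin (a * s)) (is_derive_mulc a s).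
by apply: (is_derive_eq h); ring.
Qed.

Lemma cder_cis (a s : R) : cder (fun t => cis (a * t)) ('i%C * a%:C * cis (a * s)) s.
Proof.
split=> /=.
- by apply: (is_derive_eq (is_derive_cos_mul a s)); ring.
- by apply: (is_derive_eq (is_derive_sin_mul a s)); ring.
Qed.

Lemma cder_exp_unique phi (a : R) : (forall s, cder phi ('i%C * a%:C * phi s) s) ->
  forall s, phi s = cis (a * s) * phi 0.
Proof.
move=> h s.
have H t : cder (fun t => cis (- a * t) * phi t) 0 t.
  apply: (cder_eq (cderM (cder_cis (- a) t) (h t))); rewrite rmorphN; ring.
have := cder0_cst H s 0; rewrite mulr0 cis0 mul1r => <-.
by rewrite mulNr mulrA cis_mulN mul1r.
Qed.

End ComplexDerivative.

(** * Fourier integrals of complex functions along a direction *)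

Section ComplexFunctions.
Local Open Scope complex_scope.
Context {R : realType}.
Local Notation V := 'rV[R]_3.
Local Notation C := R[i].
Local Notation mu := (@lebesgue_measure R).
Local Notation Re := complex.Re.
Local Notation Im := complex.Im.
Implicit Types (F G : V -> C) (f : V -> R) (g w : V) (a : C) (b : R).

Definition ccontinuous F := continuous (fun g => Re (F g)) /\ continuous (fun g => Im (F g)).

Lemma csmooth_continuous F : csmooth F -> ccontinuous F.
Proof. by move=> [h1 h2]; split; exact: smooth_continuous. Qed.

Let ReE a F G : (fun g => Re (a * F g + G g)) =
  (fun g => Re a * Re (F g) + (- Im a * Im (F g) + Re (G g))).
Proof. by apply/funext => g; case: a (F g) (G g) => ? ? [? ?] [? ?] /=; ring. Qed.

Let ImE a F G : (fun g => Im (a * F g + G g)) =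
  (fun g => Re a * Im (F g) + (Im a * Re (F g) + Im (G g))).
Proof. by apply/funext => g; case: a (F g) (G g) => ? ? [? ?] [? ?] /=; ring. Qed.

Lemma csmooth_lin a F G : csmooth F -> csmooth G -> csmooth (fun g => a * F g + G g).
Proof.
by move=> [f1 f2] [g1 g2]; split; rewrite ?ReE ?ImE; apply: smooth_lin => //; exact: smooth_lin.
Qed.

Lemma csmooth_cst a : csmooth (fun=> a).
Proof. by split; exact: smooth_cst. Qed.

Lemma csmoothZ a F : csmooth F -> csmooth (fun g => a * F g).
Proof.
by move=> sF; have := csmooth_lin a sF (csmooth_cst 0); under eq_fun do rewrite addr0.
Qed.

Lemma csmoothD F G : csmooth F -> csmooth G -> csmooth (fun g => F g + G g).
Proof.
by move=> sF sG; have := csmooth_lin 1 sF sG; under eq_fun do rewrite mul1r.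
Qed.

Definition op_linear (op : (V -> R) -> V -> R) :=
  forall f1 f2 (a : R), smooth f1 -> smooth f2 ->
    op (fun x => a * f1 x + f2 x) = fun x => a * op f1 x + op f2 x.

Lemma cop_lin op a F G : op_linear op -> csmooth F -> csmooth G ->
  cop op (fun g => a * F g + G g) = fun g => a * cop op F g + cop op G g.
Proof.
move=> opl [f1 f2] [g1 g2]; apply/funext => g; rewrite /cop ReE ImE.
rewrite !opl//; try exact: smooth_lin.
by case: a => ? ?; apply: complexP => /=; ring.
Qed.

Lemma op_linear_fX : op_linear (@fX R). Proof. by move=> f1 f2 a; exact: fX_lin. Qed.
Lemma op_linear_fY : op_linear (@fY R). Proof. by move=> f1 f2 a; exact: fY_lin. Qed.
Lemma op_linear_fZ : op_linear (@fZ R). Proof. by move=> f1 f2 a; exact: fZ_lin. Qed.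

Lemma cop_cst0 op : op_linear op -> cop op (fun=> 0) = fun=> 0.
Proof.
move=> opl; have h : op (fun=> 0) = fun=> 0.
  have := opl (fun=> 0) (fun=> 0) (-1) (@smooth_cst _ 0) (@smooth_cst _ 0).
  under eq_fun do rewrite mulr0 addr0.
  by move=> h; rewrite [LHS]h; apply/funext => x; rewrite mulN1r addNr.
by apply/funext => g; rewrite /cop /= h.
Qed.

Lemma copZ op a F : op_linear op -> csmooth F ->
  cop op (fun g => a * F g) = fun g => a * cop op F g.
Proof.
move=> opl sF; have := cop_lin a opl sF (csmooth_cst 0).
rewrite cop_cst0//; under eq_fun do rewrite addr0; move=> ->.
by apply/funext => g; rewrite addr0.
Qed.

Definition kc b (t : R) : R := cos (2 * pi * b * t).
Definition ks b (t : R) : R := sin (2 * pi * b * t).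

(* The integral over t in [0, 1] of F (g + t w) exp (- 2 pi i b t). *)
Definition cint w b F : V -> C := fun g =>
  (J w (kc b) (fun h => Re (F h)) g + J w (ks b) (fun h => Im (F h)) g) +i*
  (J w (kc b) (fun h => Im (F h)) g - J w (ks b) (fun h => Re (F h)) g).

Lemma continuous_kc b : continuous (kc b).
Proof.
move=> t; apply/differentiable_continuous/derivable1_diffP.
by case: (is_derive_cos_mul (2 * pi * b) t).
Qed.
Lemma continuous_ks b : continuous (ks b).
Proof.
move=> t; apply/differentiable_continuous/derivable1_diffP.
by case: (is_derive_sin_mul (2 * pi * b) t).
Qed.
Arguments continuous_kc : clear implicits.
Arguments continuous_ks : clear implicits.
#[local] Hint Resolve continuous_kc continuous_ks : core.

Lemma cint_lin w b a F G : ccontinuous F -> ccontinuous G ->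
  cint w b (fun g => a * F g + G g) = fun g => a * cint w b F g + cint w b G g.
Proof.
move=> [f1 f2] [g1 g2]; apply/funext => g; rewrite /cint ReE ImE.
have c1 (x : R) (h k : V -> R) : continuous h -> continuous k -> continuous (fun g => x * h g + k g).
  by move=> ch ck; apply: continuous_add => //; apply: continuous_mul => //; exact: continuous_cst.
rewrite !J_lin//; try exact: c1.
by case: a => ? ?; apply: complexP => /=; ring.
Qed.

Lemma ccontinuous0 : ccontinuous (fun=> 0).
Proof. by split; exact: continuous_cst. Qed.

Lemma J0 w k : J w k (fun=> 0) = fun=> (0 : R).
Proof.
apply/funext => g; rewrite /J; under eq_Rintegral do rewrite mul0r.
by rewrite Rintegral_cst//= mul0r.
Qed.

Lemma cintZ w b a F : ccontinuous F -> cint w b (fun g => a * F g) = fun g => a * cint w b F g.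
Proof.
move=> cF; have := cint_lin w b a cF ccontinuous0.
under eq_fun do rewrite addr0; move=> ->.
by apply/funext => g; rewrite /cint /= !J0 addr0 subr0 addr0.
Qed.

Lemma cint_smooth w b F : csmooth F -> csmooth (cint w b F).
Proof.
move=> [s1 s2]; split => /=; first by apply: smoothD; apply: (proj1 (J_smooth _ _ _)).
under eq_fun do rewrite addrC -mulN1r; apply: smooth_lin; by apply: (proj1 (J_smooth _ _ _)).
Qed.

Lemma cint_pd i w b F : csmooth F -> cop (pd i) (cint w b F) = cint w b (cop (pd i) F).
Proof.
move=> [s1 s2]; apply/funext => g; rewrite /cop /cint /=.
have [k1 e1] := J_smooth w (continuous_kc b) s1; have [k2 e2] := J_smooth w (continuous_kc b) s2.
have [k3 e3] := J_smooth w (continuous_ks b) s1; have [k4 e4] := J_smooth w (continuous_ks b) s2.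
congr (_ +i* _); first by rewrite pdD// e1 e4.
have -> : (fun h => J w (kc b) (fun x => Im (F x)) h - J w (ks b) (fun x => Re (F x)) h) =
  fun h => - 1 * J w (ks b) (fun x => Re (F x)) h + J w (kc b) (fun x => Im (F x)) h.
  by apply/funext => h; ring.
by rewrite pd_lin// e2 e3; ring.
Qed.

Lemma cint_mulx w b F : w 0 0 = 0 -> ccontinuous F ->
  cint w b (fun g => (g 0 0)%:C * F g) = fun g => (g 0 0)%:C * cint w b F g.
Proof.
move=> w0 [c1 c2]; apply/funext => g; rewrite /cint.
have H (k : R -> R) f : continuous k -> continuous f ->
    J w k (fun h => h 0 0 * f h) g = g 0 0 * J w k f g.
  move=> ck cf; rewrite /J -RintegralZl//; last exact/continuous_integrable/continuous_Jarg.
  by apply: eq_Rintegral => t _; rewrite !mxE w0 mulr0 addr0 mulrA.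
have -> : (fun h : V => Re ((h 0 0)%:C * F h)) = fun h : V => h 0 0 * Re (F h).
  by apply/funext => h; case: (F h) => ? ? /=; ring.
have -> : (fun h : V => Im ((h 0 0)%:C * F h)) = fun h : V => h 0 0 * Im (F h).
  by apply/funext => h; case: (F h) => ? ? /=; ring.
by rewrite !H//; apply: complexP => /=; ring.
Qed.

Lemma cint_translate w w' b F a : ccontinuous F -> (forall g, F (g + w') = a * F g) ->
  forall g, cint w b F (g + w') = a * cint w b F g.
Proof.
move=> cF Fw g; have <- : cint w b (fun g => F (g + w')) g = cint w b F (g + w').
  rewrite /cint /J; congr ((_ + _) +i* (_ - _)); apply: eq_Rintegral => t _ ; rewrite addrAC//.
by under eq_fun do rewrite Fw; rewrite cintZ.
Qed.

Lemma cint_bounded w b F (K : R) : ccontinuous F ->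
  (forall g, `|Re (F g)| <= K) -> (forall g, `|Im (F g)| <= K) ->
  forall g, `|Re (cint w b F g)| <= K + K /\ `|Im (cint w b F g)| <= K + K.
Proof.
move=> [c1 c2] h1 h2 g; rewrite /cint /=; split.
- apply: (le_trans (ler_normD _ _)); apply: lerD; apply: J_bounded => // t; [exact: cos_max|exact: sin_max].
- apply: (le_trans (ler_normB _ _)); apply: lerD; apply: J_bounded => // t; [exact: cos_max|exact: sin_max].
Qed.

Lemma cis_sign (chi : int) (x : R) : cis x = chi%:~R :> C -> cos x = chi%:~R /\ sin x = 0.
Proof. by rewrite -(rmorph_int (real_complex R)) => -[-> ->]. Qed.

(** The sign [chi] picked up over one period is also that of the exponential, so the boundary terms
    cancel. The period [l] stays as a factor on the left, which covers steps of length 1 and r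
    alike. *)
Lemma cint_parts i (l : R) b (chi : int) F : is_sign chi -> csmooth F ->
  (forall g, F (g + l *: delta_mx 0 i) = chi%:~R * F g) ->
  cis (2 * pi * b) = chi%:~R :> C ->
  forall g, l%:C * cint (l *: delta_mx 0 i) b (cop (pd i) F) g =
    'i%C * (2 * pi * b)%:C * cint (l *: delta_mx 0 i) b F g.
Proof.
move=> chis [s1 s2] Fw /cis_sign [cb sb] g; set w := l *: _.
have chichi : chi%:~R * chi%:~R = 1 :> R by rewrite -intrM is_sign_sq.
have Dw f h : smooth f -> is_derive h w f (l * pd i f h).
  by move=> sf; apply/is_deriveZdir/smooth_is_derive.
have H f (k dk : R -> R) : smooth f -> (forall g, f (g + w) = chi%:~R * f g) ->
    (forall t : R, is_derive t 1 k (dk t)) -> continuous dk -> chi%:~R * k 1 = k 0 ->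
    l * J w k (pd i f) g = - J w dk f g.
  move=> sf fw hk cdk kchi.
  have E : (fun x => 'D_w f x) = fun x => l * pd i f x.
    by apply/funext => x; have h := Dw f x sf; apply: derive_val.
  have cD : continuous (fun x => l * pd i f x).
    apply: continuous_mul; first exact: continuous_cst.
    exact/smooth_continuous/smooth_pd.
  have ck : continuous k.
    by move=> t; apply/differentiable_continuous/derivable1_diffP; case: (hk t).
  have := J_parts hk cdk sf _ _ fw kchi.
  have dw x : derivable f x w by case: (Dw f x sf).
  rewrite E => /(_ dw cD) /(congr1 (fun u => u g)) /= <-.
  rewrite /J -RintegralZl//; first by apply: eq_Rintegral => t _; rewrite mulrA.
  by apply/continuous_integrable/continuous_Jarg => //; exact/smooth_continuous/smooth_pd.
have JZ f (k : R -> R) (x : R) : continuous k -> continuous f -> J w (fun t => x * k t) f g = x * J w k f g.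
  move=> ck cf; rewrite /J -RintegralZl//; last exact/continuous_integrable/continuous_Jarg.
  by apply: eq_Rintegral => t _; rewrite mulrCA.
have Hc f : smooth f -> (forall g, f (g + w) = chi%:~R * f g) ->
    l * J w (kc b) (pd i f) g = 2 * pi * b * J w (ks b) f g.
  move=> sf fw.
  have h1 (t : R) : is_derive t 1 (kc b) (- (2 * pi * b) * ks b t).
    by apply: (is_derive_eq (is_derive_cos_mul (2 * pi * b) t)); rewrite mulNr.
  have h2 : continuous (fun t => - (2 * pi * b) * ks b t).
    by apply: continuous_mul => //; exact: continuous_cst.
  have h3 : chi%:~R * kc b 1 = kc b 0 by rewrite /kc mulr1 mulr0 cos0 cb.
  rewrite (H f _ _ sf fw h1 h2 h3) JZ//; first ring.
  exact: smooth_continuous.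
have Hs f : smooth f -> (forall g, f (g + w) = chi%:~R * f g) ->
    l * J w (ks b) (pd i f) g = - (2 * pi * b) * J w (kc b) f g.
  move=> sf fw.
  have h1 (t : R) : is_derive t 1 (ks b) (2 * pi * b * kc b t) by exact: is_derive_sin_mul.
  have h2 : continuous (fun t => (2 * pi * b) * kc b t).
    by apply: continuous_mul => //; exact: continuous_cst.
  have h3 : chi%:~R * ks b 1 = ks b 0 by rewrite /ks mulr1 mulr0 sin0 sb mulr0.
  rewrite (H f _ _ sf fw h1 h2 h3) JZ//; first ring.
  exact: smooth_continuous.
have r1 h : Re (F (h + w)) = chi%:~R * Re (F h).
  by rewrite Fw -(rmorph_int (real_complex R)); case: (F h) => ? ? /=; ring.
have r2 h : Im (F (h + w)) = chi%:~R * Im (F h).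
  by rewrite Fw -(rmorph_int (real_complex R)); case: (F h) => ? ? /=; ring.
rewrite /cint /cop /=.
have [a1 a2] := (Hc _ s1 r1, Hc _ s2 r2); have [a3 a4] := (Hs _ s1 r1, Hs _ s2 r2).
apply: complexP => /=.
- rewrite mul0r subr0 mulrDr a1 a4; ring.
- rewrite mul0r addr0 mulrBr a2 a3; ring.
Qed.

End ComplexFunctions.

(** * Transformation laws, completeness and orthogonality of coefficients *)

Section FourierCoefficients.
Local Open Scope complex_scope.
Context {R : realType}.
Local Notation V := 'rV[R]_3.
Local Notation C := R[i].
Local Notation mu := (@lebesgue_measure R).
Local Notation Re := complex.Re.
Local Notation Im := complex.Im.
Implicit Types (F G : V -> C) (f : V -> R) (g w : V) (a : C) (b : R).

Lemma csmooth_pd i F : csmooth F -> csmooth (cop (pd i) F).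
Proof. by move=> [s1 s2]; split; exact: smooth_pd. Qed.

Lemma cder_line i F g (l s : R) : csmooth F ->
  cder (fun t : R => F (g + t *: (l *: delta_mx 0 i)))
    (l%:C * cop (pd i) F (g + s *: (l *: delta_mx 0 i))) s.
Proof.
move=> [s1 s2]; split.
- apply/(@is_derive_line _ (fun h => Re (F h))).
  by rewrite /= mul0r subr0; apply/is_deriveZdir/smooth_is_derive.
- apply/(@is_derive_line _ (fun h => Im (F h))).
  by rewrite /= mul0r addr0; apply/is_deriveZdir/smooth_is_derive.
Qed.

Lemma exp_line i (l b : R) F : csmooth F ->
  (forall g, l%:C * cop (pd i) F g = 'i%C * (2 * pi * b)%:C * F g) ->
  forall g s, F (g + s *: (l *: delta_mx 0 i)) = cis (2 * pi * b * s) * F g.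
Proof.
move=> sF DF g s.
rewrite (@cder_exp_unique _ (fun t : R => F (g + t *: (l *: delta_mx 0 i))) (2 * pi * b)).
  by rewrite scale0r addr0.
by move=> t; apply: cder_eq; [exact: cder_line|rewrite DF].
Qed.

(** By [cint_parts] the coefficient solves a first order linear equation along its own direction, so
    it is an exponential there. *)
Lemma cint_shift i (l b : R) (chi : int) F : is_sign chi -> csmooth F ->
  (forall g, F (g + l *: delta_mx 0 i) = chi%:~R * F g) ->
  cis (2 * pi * b) = chi%:~R :> C ->
  forall g s, cint (l *: delta_mx 0 i) b F (g + s *: (l *: delta_mx 0 i)) =
    cis (2 * pi * b * s) * cint (l *: delta_mx 0 i) b F g.
Proof.
move=> cs sF Fw cb; apply: exp_line; first exact: cint_smooth.
by move=> g; rewrite cint_pd// (cint_parts cs).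
Qed.

Lemma cis_signN (chi : int) b : cis (2 * pi * b) = chi%:~R :> C ->
  cis (2 * pi * - b) = chi%:~R :> C.
Proof.
by rewrite mulrN /cis cosN sinN => /cis_sign [-> ->]; rewrite oppr0 -(rmorph_int (real_complex R)).
Qed.

Lemma cis_int (m : int) : cis (2 * pi * m%:~R) = 1 :> C.
Proof.
have H (n : nat) : cis (2 * pi * n%:R) = 1 :> C.
  elim: n => [|n IH]; first by rewrite mulr0 cis0.
  rewrite -[n.+1%:R]natr1 mulrDr cisD IH mul1r mulr1 /cis.
  have -> : 2 * pi = pi *+ 2 :> R by rewrite mulr2n; ring.
  by rewrite cos2pi sin2pi.
case: m => n; first exact: H.
by rewrite NegzE; apply: (@cis_signN 1); exact: H.
Qed.

(** The representative modulo 1 of the frequencies whose character has sign [chi]. *)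
Definition half_of (chi : int) : R := if chi == 1 then 0 else 2^-1.

Lemma cis_half (chi : int) : is_sign chi -> cis (2 * pi * half_of chi) = chi%:~R :> C.
Proof.
rewrite /half_of => -[->|->] /=; first by rewrite mulr0 cis0.
have -> : 2 * pi / 2 = pi :> R by field.
by rewrite /cis cospi sinpi; apply: complexP => //=; rewrite oppr0.
Qed.

Lemma cint_unique w (chi : int) F g : is_sign chi -> ccontinuous F ->
  (forall b, cis (2 * pi * b) = chi%:~R :> C -> cint w b F g = 0) ->
  F (g + 2^-1 *: w) = 0.
Proof.
move=> cs [c1 c2] H.
have kcN b : J w (kc (- b)) = J w (kc b).
  by rewrite /kc; congr J; apply/funext => t; rewrite mulrN mulNr cosN.
have ksN b f : continuous f -> J w (ks (- b)) f g = - J w (ks b) f g.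
  move=> cf; rewrite -[RHS]mulN1r /J -RintegralZl//; last first.
    by apply/continuous_integrable/continuous_Jarg => //; exact: continuous_ks.
  by apply: eq_Rintegral => t _; rewrite /ks mulrN mulNr sinN; ring.
(* The admissible frequencies are symmetric under [b |-> -b]; the two complex equations for b and -b
   separate the four real integrals. *)
have key b : cis (2 * pi * b) = chi%:~R :> C ->
  [/\ J w (kc b) (fun h => Re (F h)) g = 0, J w (ks b) (fun h => Re (F h)) g = 0,
      J w (kc b) (fun h => Im (F h)) g = 0 & J w (ks b) (fun h => Im (F h)) g = 0].
  move=> cb; have := H _ cb; have := H _ (cis_signN cb); rewrite /cint kcN !ksN//.
  move=> /eqP; rewrite eq_complex /= => /andP[/eqP h1 /eqP h2].
  move=> /eqP; rewrite eq_complex /= => /andP[/eqP h3 /eqP h4].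
  by split; lra.
have int0 f (b s : R) : continuous f -> J w (kc b) f g = 0 -> J w (ks b) f g = 0 ->
    \int[mu]_(t in `[0, 1]) (f (g + t *: w) * cos (2 * pi * b * t + s)) = 0.
  move=> cf h1 h2.
  transitivity (cos s * J w (kc b) f g + - sin s * J w (ks b) f g); last first.
    by rewrite h1 h2 !mulr0 addr0.
  have i1 : mu.-integrable `[0, 1] (EFin \o (fun t => f (g + t *: w) * kc b t)).
    by apply/continuous_integrable/continuous_Jarg => //; exact: continuous_kc.
  have i2 : mu.-integrable `[0, 1] (EFin \o (fun t => f (g + t *: w) * ks b t)).
    by apply/continuous_integrable/continuous_Jarg => //; exact: continuous_ks.
  rewrite /J -!RintegralZl// -RintegralD//; last 2 first.
  - apply: (@continuous_integrable _ (fun t => cos s * (f (g + t *: w) * kc b t))).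
    apply: continuous_mul; first exact: continuous_cst.
    by apply: continuous_Jarg => //; exact: continuous_kc.
  - apply: (@continuous_integrable _ (fun t => - sin s * (f (g + t *: w) * ks b t))).
    apply: continuous_mul; first exact: continuous_cst.
    by apply: continuous_Jarg => //; exact: continuous_ks.
  by apply: eq_Rintegral => t _; rewrite /kc /ks cosD; ring.
have cm (m : int) : cis (2 * pi * (half_of chi + m%:~R)) = chi%:~R :> C.
  by rewrite mulrDr cisD cis_half// cis_int mulr1.
have cm' (m : int) : cis (2 * pi * (m%:~R - half_of chi)) = chi%:~R :> C.
  by rewrite -opprB; apply: cis_signN; rewrite -rmorphN; exact: cm.
have fin f : continuous f -> (forall b, cis (2 * pi * b) = chi%:~R :> C ->
    J w (kc b) f g = 0 /\ J w (ks b) f g = 0) -> f (g + 2^-1 *: w) = 0.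
  move=> cf Hf.
  apply: (@fourier_unique01 R (fun t => f (g + t *: w)) (half_of chi)).
  - exact: continuous_line.
  - by move=> m s; have [h1 h2] := Hf _ (cm m); exact: int0.
  - by move=> m s; have [h1 h2] := Hf _ (cm' m); exact: int0.
apply: complexP => /=.
- by apply: (fin (fun h => Re (F h))) => // b /key[].
- by apply: (fin (fun h => Im (F h))) => // b /key[].
Qed.

(** Orthogonality of exponentials without computing an integral: integration by parts multiplies the
    coefficient by b, the differential equation by b', so b - b' annihilates it. For equal
    frequencies the integrand is constant. *)
Lemma cint_exp i (l b b' : R) (chi : int) F : is_sign chi -> csmooth F ->
  (forall g, l%:C * cop (pd i) F g = 'i%C * (2 * pi * b')%:C * F g) ->
  cis (2 * pi * b) = chi%:~R :> C -> cis (2 * pi * b') = chi%:~R :> C ->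
  forall g, cint (l *: delta_mx 0 i) b F g = (b == b')%:R * F g.
Proof.
move=> cs sF DF cb cb' g; set w := l *: _.
have Fs := exp_line sF DF.
have [bb|nb] := eqVneq b b'.
  have cst1 (k : R) : \int[mu]_(t in `[0, 1]) k = k.
    by rewrite Rintegral_cst//= lebesgue_measure_itv /= lte_fin ltr01 oppr0 adde0 /= mulr1.
  have E t : F (g + t *: w) = cis (2 * pi * b * t) * F g by rewrite Fs bb.
  have [c1 c2] := csmooth_continuous sF.
  have ij f k : continuous f -> continuous k ->
      mu.-integrable `[0, 1] (EFin \o (fun t => f (g + t *: w) * k t)).
    by move=> cf ck; exact/continuous_integrable/continuous_Jarg.
  have [ck csn] := (@continuous_kc R b, @continuous_ks R b).
  rewrite mul1r /cint /J; apply: complexP => /=.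
  - rewrite -(RintegralD _ (ij _ _ c1 ck) (ij _ _ c2 csn))//.
    rewrite -[RHS]cst1; apply: eq_Rintegral => t _; rewrite E /kc /ks /cis.
    move: (2 * pi * b * t) => th; case: (F g) => x y /=.
    transitivity ((cos th ^+ 2 + sin th ^+ 2) * x); first by ring.
    by rewrite cos2Dsin2 mul1r.
  - rewrite -(RintegralB _ (ij _ _ c2 ck) (ij _ _ c1 csn))//.
    rewrite -[RHS]cst1; apply: eq_Rintegral => t _; rewrite E /kc /ks /cis.
    move: (2 * pi * b * t) => th; case: (F g) => x y /=.
    transitivity ((cos th ^+ 2 + sin th ^+ 2) * y); first by ring.
    by rewrite cos2Dsin2 mul1r.
rewrite mul0r.
have Fw h : F (h + w) = chi%:~R * F h by have := Fs h 1; rewrite scale1r mulr1 cb'.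
have := cint_parts cs sF Fw cb g; rewrite -/w.
have sD := csmooth_continuous (csmooth_pd i sF).
have := cintZ w b l%:C sD => /(congr1 (fun u => u g)) /= <-.
have -> : (fun h => l%:C * cop (pd i) F h) = (fun h => 'i%C * (2 * pi * b')%:C * F h).
  by apply/funext => h; exact: DF.
rewrite cintZ; last exact: csmooth_continuous.
move/eqP; rewrite -subr_eq0 -mulrBl mulf_eq0 -mulrBr mulf_eq0 -rmorphB /=.
have i0 : ('i%C == 0 :> C) = false by rewrite eq_complex /= oner_eq0 andbF.
rewrite i0 /= => /orP[|/eqP//].
rewrite eq_complex /= => /andP[/eqP h _].
have /eqP : 2 * pi * (b - b') = 0 by move: h; lra.
by rewrite mulf_eq0 subr_eq0 (negbTE nb) orbF mulf_eq0 pnatr_eq0 /= gt_eqF// pi_gt0.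
Qed.

End FourierCoefficients.

(** * Hermite functions *)

Section HermiteFunctions.
Local Open Scope complex_scope.
Context {R : realType}.
Variable w : R.

(** Rodrigues form: [hpol k] is [exp(w x^2)] times the k-th derivative of [exp(- w x^2)], the
    Hermite polynomial in [sqrt(w) x] up to the factor [(- sqrt(w))^k]. *)
Fixpoint hpol k : {poly R} :=
  if k is k'.+1 then (hpol k')^`() - (2 * w) *: ('X * hpol k') else 1.

(** The value 0 at k = 0 says that nothing lies below the ground state and keeps the lowering
    formula uniform in k. *)
Definition hprev k : {poly R} := if k is k'.+1 then hpol k' else 0.

Definition pgauss (p : {poly R}) (x : R) : R := p.[x] * expR (- (w / 2) * x ^+ 2).

Lemma hpol_deriv k : (hpol k.+1)^`() = - (2 * w * k.+1%:R) *: hpol k.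
Proof.
elim: k => [|k IH].
  by rewrite /= derivC sub0r mulr1 derivN derivZ derivX mulr1 scaleNr.
rewrite [in LHS]/= -/(hpol k.+1) derivB derivZ derivM derivX mul1r IH derivZ.
have -> : hpol k.+1 = (hpol k)^`() - (2 * w) *: ('X * hpol k) by [].
rewrite -!mul_polyC.
have -> : (k.+2%:R : R) = k.+1%:R + 1 by rewrite -[k.+2%:R]natr1.
rewrite !polyCN !polyCM polyCD polyC1; ring.
Qed.

Lemma hprev_deriv k : (hpol k)^`() = - (2 * w * k%:R) *: hprev k.
Proof. by case: k => [|k]; rewrite ?hpol_deriv//= derivC scaler0. Qed.

Lemma hpol_neq0 k : 0 < w -> hpol k != 0.
Proof.
move=> w0; elim: k => [|k IH]; first exact: oner_neq0.
apply: contraNneq IH => h; have := hpol_deriv k; rewrite h deriv0 => /esym/eqP.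
by rewrite scaler_eq0 oppr_eq0 !mulf_eq0 !pnatr_eq0 /= gt_eqF.
Qed.

Lemma poly_neq0_root (p : {poly R}) : p != 0 -> exists x, p.[x] != 0.
Proof.
move=> p0; apply/not_existsP => H.
(* Otherwise the polynomial would vanish at as many distinct integers as its size. *)
have : (size [seq i%:R : R | i <- iota 0 (size p)] < size p)%N.
  apply: max_poly_roots => //.
    apply/allP => x _; rewrite /root; apply/negPn/negP; exact: H.
  by rewrite map_inj_uniq ?iota_uniq// => a b /eqP; rewrite eqr_nat => /eqP.
by rewrite size_map size_iota ltnn.
Qed.

Lemma is_derive_gauss (x : R) :
  is_derive x 1 (fun x => expR (- (w / 2) * x ^+ 2)) (- w * x * expR (- (w / 2) * x ^+ 2)).
Proof.
have h : is_derive x 1 (fun x : R => - (w / 2) * x ^+ 2) (- w * x).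
  have := is_derive_mul (is_derive_id x 1) (is_derive_id x 1) => h1.
  have := is_deriveZ (- (w / 2)) h1 => h2.
  by apply: (is_derive_eq h2); rewrite /GRing.scale /=; field.
have h3 := @is_derive1_comp R (@expR R) (fun x => - (w / 2) * x ^+ 2) x _ _ (is_derive_expR _) h.
by apply: (is_derive_eq h3); ring.
Qed.

Lemma is_derive_pgauss (p : {poly R}) (x : R) :
  is_derive x 1 (pgauss p) (pgauss (p^`() - w *: ('X * p)) x).
Proof.
have h1 : is_derive x 1 (horner p) (p^`()).[x].
  by rewrite derivE derive1E; apply/derivableP; exact: derivable_horner.
apply: (is_derive_eq (is_derive_mul h1 (is_derive_gauss x))).
by rewrite /pgauss hornerD hornerN hornerZ hornerM hornerX; ring.
Qed.

End HermiteFunctions.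

(** * Bounded solutions of second order equations *)

Section BoundedSolutions.
Local Open Scope complex_scope.
Context {R : realType}.
Local Notation C := R[i].
Local Notation Re := complex.Re.
Local Notation Im := complex.Im.

(** A nonzero slope of a convex function forces unbounded growth on one side. *)
Lemma convex_bounded_cst (W W1 W2 : R -> R) (K : R) :
  (forall x : R, is_derive x 1 W (W1 x)) -> (forall x : R, is_derive x 1 W1 (W2 x)) ->
  (forall x, 0 <= W2 x) -> (forall x, 0 <= W x <= K) -> forall x, W1 x = 0.
Proof.
move=> d1 d2 W20 WK.
have ct (f f' : R -> R) A : (forall x : R, is_derive x 1 f (f' x)) -> {within A, continuous f}.
  move=> df; apply/continuous_subspaceT => t.
  by apply/differentiable_continuous/derivable1_diffP; case: (df t).
have mono x y : x <= y -> W1 x <= W1 y.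
  rewrite le_eqVlt => /predU1P[->//|xy].
  have [c _ E] := MVT xy (fun t _ => d2 t) (ct _ _ _ d2).
  by rewrite -subr_ge0 E mulr_ge0// subr_ge0 ltW.
have K0 : 0 <= K by have /andP[h1 h2] := WK 0; exact: le_trans h1 h2.
move=> x0; apply/eqP; case: (ltgtP (W1 x0) 0) => // s0; exfalso.
(* Far enough to the left that the tangent at [x0] has risen by [K + 1], more than values in [0, K]
   allow; the other case is its mirror image. *)
- pose y := x0 - (K + 1) / (- W1 x0).
  have p : 0 < (K + 1) / (- W1 x0) by rewrite divr_gt0 ?oppr_gt0// ltr_wpDl.
  have yx : y < x0 by rewrite ltrBlDr ltrDl.
  have [c cI E] := MVT yx (fun t _ => d1 t) (ct _ _ _ d1).
  have cx : W1 c <= W1 x0 by apply: mono; move: cI; rewrite in_itv /= => /andP[_ /ltW].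
  have : W x0 - W y <= W1 x0 * (x0 - y).
    by rewrite E; apply: ler_wpM2r => //; rewrite subr_ge0 ltW.
  have -> : W1 x0 * (x0 - y) = - (K + 1) by rewrite /y; field; rewrite lt_eqF.
  have /andP[a1 a2] := WK x0; have /andP[a3 a4] := WK y; lra.
- pose y := x0 + (K + 1) / W1 x0.
  have p : 0 < (K + 1) / W1 x0 by rewrite divr_gt0// ltr_wpDl.
  have yx : x0 < y by rewrite ltrDl.
  have [c cI E] := MVT yx (fun t _ => d1 t) (ct _ _ _ d1).
  have cx : W1 x0 <= W1 c by apply: mono; move: cI; rewrite in_itv /= => /andP[/ltW].
  have : W1 x0 * (y - x0) <= W y - W x0.
    by rewrite E; apply: ler_wpM2r => //; rewrite subr_ge0 ltW.
  have -> : W1 x0 * (y - x0) = K + 1 by rewrite /y; field; rewrite gt_eqF.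
  have /andP[a1 a2] := WK x0; have /andP[a3 a4] := WK y; lra.
Qed.

(* |f|^2 is convex and bounded, hence constant. *)
Lemma bounded_solution_eq0 (f f1 Q : R -> C) (K : R) :
  (forall x, cder f (f1 x) x) -> (forall x, cder f1 (Q x * f x) x) ->
  (forall x, 0 < Re (Q x)) -> (forall x, `|Re (f x)| <= K) -> (forall x, `|Im (f x)| <= K) ->
  forall x, f x = 0.
Proof.
move=> d1 d2 Q0 bR bI x.
pose a y := Re (f y); pose b y := Im (f y).
pose a1 y := Re (f1 y); pose b1 y := Im (f1 y).
pose W y := a y * a y + b y * b y.
pose W1 y := (a1 y * a y + a y * a1 y) + (b1 y * b y + b y * b1 y).
pose W2 y := 2 * (a1 y * a1 y + b1 y * b1 y) + 2 * (Re (Q y) * W y).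
have da (y : R) : is_derive y 1 a (a1 y) by case: (d1 y).
have db (y : R) : is_derive y 1 b (b1 y) by case: (d1 y).
have da1 (y : R) : is_derive y 1 a1 (Re (Q y * f y)) by case: (d2 y).
have db1 (y : R) : is_derive y 1 b1 (Im (Q y * f y)) by case: (d2 y).
have dW (y : R) : is_derive y 1 W (W1 y).
  exact: (is_deriveD (is_derive_mul (da y) (da y)) (is_derive_mul (db y) (db y))).
have dW1 (y : R) : is_derive y 1 W1 (W2 y).
  apply: (is_derive_eq (is_deriveD
    (is_deriveD (is_derive_mul (da1 y) (da y)) (is_derive_mul (da y) (da1 y)))
    (is_deriveD (is_derive_mul (db1 y) (db y)) (is_derive_mul (db y) (db1 y))))).
  by rewrite /W2 /W /a /b; case: (f y) (Q y) => ? ? [? ?] /=; ring.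
have W0 y : 0 <= W y by rewrite addr_ge0// -expr2 sqr_ge0.
have W20 y : 0 <= W2 y.
  apply: addr_ge0; first by rewrite mulr_ge0// addr_ge0// -expr2 sqr_ge0.
  by rewrite mulr_ge0// mulr_ge0// ltW.
have WK y : 0 <= W y <= K * K + K * K.
  have sq (z : R) : `|z| <= K -> z * z <= K * K.
    by move=> zK; rewrite -expr2 -real_normK ?num_real// expr2; apply: ler_pM.
  by rewrite W0 /=; apply: lerD; apply: sq; [exact: bR|exact: bI].
have W10 := convex_bounded_cst dW dW1 W20 WK.
have : W2 x = 0.
  have h : is_derive x 1 W1 0.
    have -> : W1 = fun=> 0 by apply/funext.
    exact: is_derive_cst.
  exact: (is_derive_unique (dW1 x) h).
have s1 : 0 <= a1 x * a1 x + b1 x * b1 x by rewrite addr_ge0// -expr2 sqr_ge0.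
have s2 : 0 <= Re (Q x) * W x by rewrite mulr_ge0// ltW.
move=> h; have /eqP : Re (Q x) * W x = 0 by rewrite /W2 in h; lra.
rewrite mulf_eq0 gt_eqF//= /W -!expr2 paddr_eq0 ?sqr_ge0// !sqrf_eq0 => /andP[/eqP h1 /eqP h2].
exact: complexP.
Qed.

Lemma cder_gauss (w : R) (f : R -> C) : (forall x, cder f (- (w * x)%:C * f x) x) ->
  forall x, f x = f 0 * (pgauss w 1 x)%:C.
Proof.
move=> df x.
pose E (x : R) := expR (w / 2 * x ^+ 2).
have dE (y : R) : is_derive y 1 E (w * y * E y).
  have -> : E = fun x => expR (- (- w / 2) * x ^+ 2).
    by apply/funext => z; rewrite /E; congr expR; ring.
  by apply: (is_derive_eq (is_derive_gauss (- w) y)); rewrite opprK.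
have H t : cder (fun y => f y * (E y)%:C) 0 t.
  apply: (cder_eq (cderM (df t) (cder_real (dE t)))).
  by rewrite !rmorphM; ring.
have := cder0_cst H x 0.
rewrite /E expr0n /= mulr0 expR0 mulr1 => <-.
rewrite /pgauss hornerC mul1r -mulrA -rmorphM -expRD.
have -> : w / 2 * x ^+ 2 + - (w / 2) * x ^+ 2 = 0 :> R by ring.
by rewrite expR0 mulr1.
Qed.

End BoundedSolutions.

(** * Classification of bounded solutions of the ladder system *)

Section Ladder.
Local Open Scope complex_scope.
Context {R : realType}.
Local Notation C := R[i].
Local Notation Re := complex.Re.
Local Notation Im := complex.Im.
Variables (w d : R) (mu nu : C) (u0 u1 : R -> C) (v : nat -> R -> C).
Hypotheses (w0 : 0 < w) (d0 : 0 < d).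
Hypothesis Du : forall x, cder u0 (u1 x - (w * x)%:C * u0 x) x.
Hypothesis Lu : forall x, u1 x = 'i%C / d%:C * (mu - nu) * v 0%N x.
Hypothesis Dv : forall k x, cder (v k) (v k.+1 x - (w * x)%:C * v k x) x.
Hypothesis Rv : forall x, v 1%N x - (2 * (w * x))%:C * v 0%N x = 'i%C / d%:C * (mu + nu) * u0 x.
Hypothesis bv : forall k, exists K, forall x, `|Re (v k x)| <= K /\ `|Im (v k x)| <= K.

(** Minus the product of the two coupling constants in [Lu] and [Rv], hence the oscillator
    eigenvalue; [alpha k] is the constant left after k lowerings. *)
Let kappa : C := (mu ^+ 2 - nu ^+ 2) / d%:C ^+ 2.
Let alpha (k : nat) : C := (2 * w)%:C - kappa + (2 * w * k%:R)%:C.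

Let d0C : d%:C != 0 :> C.
Proof. by rewrite eq_complex /= eqxx andbT gt_eqF. Qed.

Let dwx (x a b : R) : is_derive x 1 (fun x => a * (b * x)) (a * b).
Proof.
have h := is_derive_mulc (a * b) x.
by under eq_fun do rewrite mulrA.
Qed.

Let ii : 'i%C * 'i%C = -1 :> C. Proof. by rewrite -expr2 sqr_i. Qed.

Let twoE (x : R) : (2 * x)%:C = 2 * x%:C :> C.
Proof. by rewrite rmorphM rmorph_nat. Qed.

(** The case k = 0 comes from differentiating [Rv] and eliminating [u0] by [Du] and [Lu].
    Differentiating the recurrence itself hits the factor [2 w x] and adds [2 w] to [alpha]. *)
Lemma ladder_rec k x :
  v k.+2 x = (2 * (w * x))%:C * v k.+1 x + alpha k * v k x.
Proof.
elim: k x => [|k IH] x.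
  have h1 := cderD (Dv 1 x) (cderZ (-1) (cderM (cder_real (dwx x 2 w)) (Dv 0 x))).
  have h2 := cderZ ('i%C / d%:C * (mu + nu)) (Du x).
  have E : (fun t => v 1%N t + - 1 * ((2 * (w * t))%:C * v 0%N t)) =
      fun t => 'i%C / d%:C * (mu + nu) * u0 t.
    by apply/funext => t; rewrite -Rv; ring.
  rewrite E in h1; have := cder_unique h1 h2.
  have -> (a b c : C) : a * (b - c * u0 x) = a * b - c * (a * u0 x) by ring.
  rewrite -Rv Lu => H.
  have K : 'i%C / d%:C * (mu + nu) * ('i%C / d%:C * (mu - nu) * v 0%N x) = - kappa * v 0%N x.
    rewrite /kappa; have -> : 'i%C / d%:C * (mu + nu) * ('i%C / d%:C * (mu - nu) * v 0%N x) =
      ('i%C * 'i%C) * ((mu ^+ 2 - nu ^+ 2) / d%:C ^+ 2) * v 0%N x by field.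
    by rewrite ii; ring.
  rewrite K twoE in H; rewrite /alpha mulr0 addr0 twoE.
  move/eqP: H; rewrite -subr_eq0 => /eqP H.
  by rewrite -[LHS]subr0 -H; ring.
have h1 := Dv k.+2 x.
have h2 := cderD (cderM (cder_real (dwx x 2 w)) (Dv k.+1 x)) (cderZ (alpha k) (Dv k x)).
have E : v k.+2 = (fun t => (2 * (w * t))%:C * v k.+1 t + alpha k * v k t).
  by apply/funext.
rewrite E in h1; have /eqP := cder_unique h1 h2; rewrite subr_eq => /eqP ->.
have -> : alpha k.+1 = alpha k + (2 * w)%:C.
  by rewrite /alpha -[k.+1%:R]natr1 mulrDr mulr1 rmorphD; ring.
by rewrite -/(v k.+2) IH !twoE; ring.
Qed.

Let v_vanish : exists k, forall x, v k x = 0.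
Proof.
(* Large enough that [w k] exceeds the real part of [kappa], which makes the real part of the
   potential [Q] below positive everywhere. *)
pose k := (Num.truncn (`|Re kappa| / w)).+1.
have kk : Re kappa < w * k%:R.
  apply: le_lt_trans (ler_norm _) _; rewrite mulrC -ltr_pdivrMr//.
  exact: truncnS_gt.
exists k; have [K HK] := bv k.
pose Q (x : R) := (w ^+ 2 * x ^+ 2 - w)%:C + alpha k.
pose f1 (x : R) := v k.+1 x - (w * x)%:C * v k x.
(* The recurrence eliminates [v k.+1] and [v k.+2], leaving [v k'' = Q v k]. *)
have d2 x : cder f1 (Q x * v k x) x.
  have h := cderD (Dv k.+1 x) (cderZ (-1) (cderM (cder_real (is_derive_mulc w x)) (Dv k x))).
  have E : f1 = fun t => v k.+1 t + - 1 * ((w * t)%:C * v k t).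
    by apply/funext => t; rewrite /f1; ring.
  rewrite E; apply: (cder_eq h); rewrite ladder_rec /Q twoE.
  have -> : w ^+ 2 * x ^+ 2 - w = (w * x) * (w * x) - w by ring.
  by rewrite rmorphB rmorphM /=; ring.
apply: (@bounded_solution_eq0 R _ f1 Q K) => //.
- exact: Dv.
- move=> x; rewrite /Q /alpha /=.
  case: (kappa) kk => a b /= kk.
  have h1 : 0 <= w ^+ 2 * x ^+ 2 by rewrite -exprMn sqr_ge0.
  have h2 : 0 <= w * k%:R by rewrite mulr_ge0// ltW.
  have lem (A B y : R) : 0 < y -> a < A -> 0 <= B -> 0 <= A -> 0 < B - y + (2 * y - a + 2 * A).
    by move=> y0 aA B0 A0; lra.
  by rewrite -[2 * w * _]mulrA; exact: lem.
- by move=> x; have [] := HK x.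
- by move=> x; have [] := HK x.
Qed.

(** The left side of the conclusion is [f' - w x f], the creation operator applied to [f], which
    takes the Hermite function of degree k to that of degree k + 1. *)
Let hermite_step (k : nat) (c : C) (f g : R -> C) :
  (forall x, f x = c * (pgauss w (hpol w k) x)%:C) ->
  (forall x, cder f (g x - (w * x)%:C * f x) x) ->
  forall x, g x - (2 * (w * x))%:C * f x = c * (pgauss w (hpol w k.+1) x)%:C.
Proof.
move=> fE df x.
have h := cderZ c (cder_real (is_derive_pgauss w (hpol w k) x)).
have E : f = fun x => c * (pgauss w (hpol w k) x)%:C by apply/funext.
have h1 := df x; rewrite {1}E in h1.
have := cder_unique h1 h.
have -> : g x - (2 * (w * x))%:C * f x = (g x - (w * x)%:C * f x) - (w * x)%:C * f x.
  by rewrite twoE; ring.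
move=> ->; rewrite fE mulrCA -mulrBr -rmorphM -rmorphB; congr (_ * _%:C).
by rewrite /pgauss /= !(hornerD, hornerN, hornerZ, hornerM, hornerX); ring.
Qed.

Theorem ladder_classification :
  (forall x, u0 x = 0 /\ v 0%N x = 0) \/
  exists k, [/\ mu ^+ 2 = nu ^+ 2 + (2 * w * k%:R * d ^+ 2)%:C, k = 0%N -> mu = - nu &
    exists c, forall x, u0 x = c * (pgauss w (hpol w k) x)%:C /\
      v 0%N x = c * ('i%C / d%:C * (mu + nu)) * (pgauss w (hprev w k) x)%:C].
Proof.
have i0 : 'i%C / d%:C != 0 :> C.
  by rewrite mulf_neq0 ?invr_neq0// eq_complex /= oner_eq0 andbF.
have ex : exists k, `[< forall x, v k x = 0 >].
  by have [k Hk] := v_vanish; exists k; apply/asboolP.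
case: (ex_minnP ex) => m /asboolP vm mmin {ex}.
have v_gauss k x : (forall y, v k.+1 y = 0) -> cder (v k) (- (w * x)%:C * v k x) x.
  by move=> vk; apply: (cder_eq (Dv k x)); rewrite vk sub0r mulNr.
have v_next k : (forall y, v k y = 0) -> forall y, v k.+1 y = 0.
  move=> vk y; have := Dv k y; rewrite vk mulr0 subr0 => h.
  have E : v k = fun=> 0 by apply/funext.
  by rewrite E in h; exact: cder_unique h (cder_cst 0 y).
have pg1 x : pgauss w (hpol w 0) x = pgauss w 1 x by [].
(* The least m with [v m = 0] is the degree in [u0]. If m = 0, then [Rv] reduces to
   [(mu + nu) u0 = 0]: either everything vanishes or [mu = - nu] and [u0] is a Gaussian by [Du]. *)
case: m vm mmin => [|k] vk mmin.
  have v1 := v_next _ vk.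
  have u0mu x : (mu + nu) * u0 x = 0.
    have := Rv x; rewrite v1 vk mulr0 subr0 -mulrA => /esym/eqP.
    by rewrite mulf_eq0 (negbTE i0) => /eqP.
  have [munu|munu] := eqVneq (mu + nu) 0; last first.
    by left => x; split=> //; have /eqP := u0mu x; rewrite mulf_eq0 (negbTE munu) => /eqP.
  right; exists 0%N; have muE : mu = - nu by apply/eqP; rewrite -addr_eq0 munu.
  split=> //; first by rewrite mulr0 mul0r addr0 muE sqrrN.
  exists (u0 0) => x; split; last by rewrite vk munu mulr0 mulr0 mul0r.
  rewrite pg1; apply: (cder_gauss (w := w)) => y.
  by apply: (cder_eq (Du y)); rewrite Lu vk mulr0 sub0r mulNr.
right; exists k.+1.
have [y0 vy0] : exists y, v k y != 0.
  apply/not_existsP => H; suff : (k.+1 <= k)%N by rewrite ltnn.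
  by apply: mmin; apply/asboolP => y; apply/eqP/negPn/negP; exact: H.
(* Quantization: [v k.+1] and [v k.+2] vanish at [y0] while [v k] does not, so the recurrence kills
   the constant. *)
have ak : alpha k = 0.
  have := ladder_rec k y0; rewrite (v_next _ vk) vk mulr0 add0r => /esym/eqP.
  by rewrite mulf_eq0 (negbTE vy0) orbF => /eqP.
have kap : kappa = (2 * w * k.+1%:R)%:C.
  move: ak; rewrite /alpha => /eqP; rewrite addrAC subr_eq0 => /eqP <-.
  by rewrite -[k.+1%:R]natr1 mulrDr mulr1 addrC rmorphD.
have alE j : alpha j = - (2 * w * (k.+1%:R - j.+1%:R))%:C.
  rewrite /alpha kap -rmorphB -rmorphD -rmorphN; congr (_ %:C).
  by rewrite -[j.+1%:R]natr1; ring.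
(* Climbing back from the Gaussian [v k]: raising [v i.+1] gives [alpha i] times [v i] by the
   recurrence, and [alpha i] is nonzero for i < k. *)
have vj j : (j <= k)%N -> exists c, forall x, v (k - j)%N x = c * (pgauss w (hpol w j) x)%:C.
  elim: j => [_|j IH jk].
    by rewrite subn0; exists (v k 0) => x; rewrite pg1; apply: (cder_gauss (w := w)) => y; exact: v_gauss.
  have [c Hc] := IH (ltnW jk).
  have E : (k - j)%N = (k - j.+1).+1 by rewrite subnSK.
  rewrite E in Hc; set i := (k - j.+1)%N in E Hc *.
  have ai : alpha i != 0.
    rewrite alE oppr_eq0 eq_complex /= eqxx andbT mulf_neq0 ?mulf_neq0 ?pnatr_eq0 ?gt_eqF//.
    by rewrite subr_gt0 ltr_nat ltnS -E leq_subr || rewrite subr_gt0 ltr_nat ltnS /i ltn_subrL (leq_ltn_trans _ jk).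
  exists ((alpha i)^-1 * c) => x.
  have := hermite_step Hc (Dv i.+1) x.
  rewrite ladder_rec addrAC subrr add0r => /(congr1 (fun z => (alpha i)^-1 * z)).
  by rewrite mulKf// mulrA.
have [c Hc] := vj k (leqnn k); rewrite subnn in Hc.
have munu0 : mu ^+ 2 - nu ^+ 2 = (2 * w * k.+1%:R * d ^+ 2)%:C.
  have -> : (2 * w * k.+1%:R * d ^+ 2)%:C = kappa * d%:C ^+ 2.
    by rewrite kap -rmorphXn -rmorphM.
  by rewrite /kappa divfK// expf_neq0.
(* This allows division by the coupling constant in [Rv], which recovers [u0] from the raised
   [v 0]. *)
have munu : mu + nu != 0.
  apply: contra_eqN munu0 => /eqP h.
  have -> : mu ^+ 2 - nu ^+ 2 = (mu + nu) * (mu - nu) by ring.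
  rewrite h mul0r eq_sym eq_complex /= eqxx andbT !mulf_neq0 ?pnatr_eq0 ?expf_neq0 ?gt_eqF//.
have q0 : 'i%C / d%:C * (mu + nu) != 0 by rewrite mulf_neq0.
split=> //; first by rewrite -munu0 addrC subrK.
exists (c / ('i%C / d%:C * (mu + nu))) => x; split; last by rewrite Hc divfK.
have := hermite_step Hc (Dv 0%N) x; rewrite Rv => /(congr1 (fun z => z / ('i%C / d%:C * (mu + nu)))).
by rewrite [LHS]mulrAC mulfV// mul1r => ->; rewrite mulrAC.
Qed.

End Ladder.

(** * Theta series *)

Section GeometricSeries.
Context {R : realType}.
Implicit Types (a b : nat -> R) (K : R).

Definition geo_bounded a K := forall k, `|a k| <= K * 2^-1 ^+ k.

Lemma geo_bounded_tail a K N M : geo_bounded a K ->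
  `|\sum_(N <= k < M) a k| <= 2 * K * 2^-1 ^+ N.
Proof.
move=> aK; have K0 : 0 <= K by have := aK 0%N; rewrite expr0 mulr1; apply: le_trans.
have [MN|NM] := leqP M N.
  by rewrite big_geq// normr0 mulr_ge0 ?mulr_ge0// exprn_ge0.
(* The sharper telescoping bound is the one that survives induction on M. *)
suff : `|\sum_(N <= k < M) a k| <= 2 * K * (2^-1 ^+ N - 2^-1 ^+ M).
  move=> h; apply: (le_trans h); rewrite ler_wpM2l ?mulr_ge0//.
  by rewrite lerBlDr lerDl exprn_ge0.
move/ltnW: NM; elim: M => [|M IH]; first by rewrite leqn0 => /eqP ->; rewrite big_geq// normr0 subrr mulr0.
rewrite leq_eqVlt => /predU1P[->|NM]; first by rewrite big_geq// normr0 subrr mulr0.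
rewrite big_nat_recr//=; apply: (le_trans (ler_normD _ _)).
apply: (le_trans (lerD (IH NM) (aK M))); rewrite exprS.
by rewrite le_eqVlt; apply/orP; left; apply/eqP; field.
Qed.

Lemma geo_cvg0 K : (fun n => K * 2^-1 ^+ n) @ \oo --> (0 : R).
Proof.
rewrite -[X in _ --> X](mulr0 K); apply: cvgM; first exact: cvg_cst.
apply: cvg_expr; rewrite ger0_norm ?invr_ge0// invf_lt1//; lra.
Qed.

Lemma geo_bounded_cvg a K : geo_bounded a K -> cvg (series a @ \oo).
Proof.
move=> aK; apply: normed_cvg => /=.
have K0 : 0 <= K by have := aK 0%N; rewrite expr0 mulr1; apply: le_trans.
apply: (@series_le_cvg _ _ (geometric K 2^-1)) => //.
- by move=> n /=.
- by move=> n; apply: mulr_ge0 => //; rewrite exprn_ge0// invr_ge0.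
- by apply: is_cvg_geometric_series; rewrite ger0_norm ?invr_ge0// invf_lt1// ltr1n.
Qed.

Definition sums a : R := limn (series a).

Lemma sums_tail a K N : geo_bounded a K ->
  `|sums a - \sum_(0 <= k < N) a k| <= 2 * K * 2^-1 ^+ N.
Proof.
move=> aK; have ca := geo_bounded_cvg aK.
have h : (fun M => `|series a M - \sum_(0 <= k < N) a k|) @ \oo --> `|sums a - \sum_(0 <= k < N) a k|.
  by apply: cvg_norm; apply: cvgB; [exact: ca|exact: cvg_cst].
rewrite -(cvg_lim _ h)//; apply: limr_le; first by apply/cvg_ex; eexists; exact: h.
near=> M; rewrite /series /=.
have NM : (N <= M)%N by near: M; exact: nbhs_infty_ge.
by rewrite (big_cat_nat (leq0n N) NM)//= addrAC subrr add0r geo_bounded_tail.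
Unshelve. all: by end_near. Qed.

Lemma sums_lin a b x K L : geo_bounded a K -> geo_bounded b L ->
  sums (fun k => x * a k + b k) = x * sums a + sums b.
Proof.
move=> aK bL; apply: cvg_lim => //.
have -> : series (fun k => x * a k + b k) = (fun n => x * series a n + series b n).
  by apply/funext => n; rewrite /series /= big_split /= mulr_sumr.
apply: cvgD; last exact: geo_bounded_cvg bL.
by apply: cvgM; [exact: cvg_cst|exact: geo_bounded_cvg aK].
Qed.

Lemma sums_cvg a K : geo_bounded a K -> (fun n => \sum_(0 <= k < n) a k) @ \oo --> sums a.
Proof. exact: geo_bounded_cvg. Qed.

Lemma small_geo K e : 0 < e -> exists N, K * 2^-1 ^+ N < e.
Proof.
move=> e0; have /cvgrPdist_lt/(_ _ e0) [N _ /(_ N (leqnn N))] := geo_cvg0 K.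
rewrite /= sub0r normrN => h; exists N; exact: le_lt_trans (ler_norm _) h.
Qed.

End GeometricSeries.

(** * Bilateral series: continuity, termwise derivatives, reindexing *)

Section BilateralSeries.
Context {R : realType}.
Local Notation V := 'rV[R]_3.
Implicit Types (t : int -> V -> R) (g : V).

(** Uniformity is asked only for bounded x, because y and z will enter the terms through a phase
    alone. *)
Definition dominated t := forall B, exists2 K, 0 <= K &
  forall m g, `|g 0 0| <= B -> `|t m g| <= K * 2^-1 ^+ `|m|%N.

(** Pairing k with - k - 1 turns a sum over the integers into an ordinary series. *)
Definition fold_int t k g := t (Posz k) g + t (Negz k) g.

Definition bisum t g := sums (fun k => fold_int t k g).

Lemma fold_int_bounded t K g : 0 <= K -> (forall m, `|t m g| <= K * 2^-1 ^+ `|m|%N) ->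
  geo_bounded (fun k => fold_int t k g) (2 * K).
Proof.
move=> K0 tK k; apply: (le_trans (ler_normD _ _)).
rewrite [2 * K]mulr_natl mulr2n mulrDl; apply: lerD; first exact: tK.
apply: (le_trans (tK _)); rewrite ler_wpM2l//= exprS ler_piMl ?exprn_ge0//.
by rewrite invf_le1// ler1n.
Qed.

Lemma dominated_fold t B : dominated t -> exists2 K, 0 <= K &
  forall g, `|g 0 0| <= B -> geo_bounded (fun k => fold_int t k g) K.
Proof.
move=> /(_ B) [K K0 HK]; exists (2 * K); first by rewrite mulr_ge0.
by move=> g gB; apply: fold_int_bounded => // m; exact: HK.
Qed.

Lemma bisum_lin t1 t2 (x : V -> R) : dominated t1 -> dominated t2 ->
  bisum (fun m g => x g * t1 m g + t2 m g) = fun g => x g * bisum t1 g + bisum t2 g.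
Proof.
move=> d1 d2; apply/funext => g.
have [K _ HK] := dominated_fold `|g 0 0| d1; have [L _ HL] := dominated_fold `|g 0 0| d2.
rewrite /bisum -(sums_lin _ (HK g _) (HL g _))//; congr sums; apply/funext => k.
by rewrite /fold_int; ring.
Qed.

Lemma bisum0 : bisum (fun _ _ => 0) = fun=> 0.
Proof.
apply/funext => g; apply: cvg_lim => //.
have -> : series (fun k => fold_int (fun _ _ => 0) k g) = fun=> 0.
  by apply/funext => n; rewrite /series /= big1// => k _; rewrite /fold_int addr0.
exact: cvg_cst.
Qed.

Lemma dominated0 : dominated (fun _ _ => 0).
Proof. by move=> B; exists 0 => // m g _; rewrite normr0 mul0r. Qed.

Lemma bisumZ t (x : V -> R) : dominated t -> bisum (fun m g => x g * t m g) = fun g => x g * bisum t g.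
Proof.
move=> dt; have := bisum_lin x dt dominated0; rewrite bisum0.
have -> : (fun m g => x g * t m g + 0) = (fun m g => x g * t m g).
  by apply/funext => m; apply/funext => g; rewrite addr0.
by move=> ->; apply/funext => g; rewrite addr0.
Qed.

Lemma near_coord0 g : \forall h \near g, `|(h : V) 0 0| <= `|g 0 0| + 1.
Proof.
have /continuousP_eps/(_ g 1 ltr01) h := @continuous_coord R 0.
apply: (@filterS _ (nbhs g) (nbhs_filter g) _ _ _ h) => g' /= {}h.
have -> : g' 0 0 = g 0 0 - (g 0 0 - g' 0 0) by ring.
by apply: (le_trans (ler_normB _ _)); rewrite lerD2l.
Qed.

Lemma continuous_partial t N : (forall m, continuous (t m)) ->
  continuous (fun g => \sum_(0 <= k < N) fold_int t k g).
Proof.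
move=> ct; elim: N => [|N IH].
  by under eq_fun do rewrite big_geq//; exact: continuous_cst.
under eq_fun do rewrite big_nat_recr//=.
by apply: continuous_add => //; apply: continuous_add; exact: ct.
Qed.

Lemma bisum_continuous t : (forall m, continuous (t m)) -> dominated t -> continuous (bisum t).
Proof.
move=> ct dt; apply/continuousP_eps => g e e0.
have [K K0 HK] := dominated_fold (`|g 0 0| + 1) dt.
have e4 : 0 < e / 4 by rewrite divr_gt0.
have [N HN] := small_geo (2 * K) e4.
have /continuousP_eps/(_ g _ e4) h1 := @continuous_partial t N ct.
have := @filterI _ (nbhs g) (nbhs_filter g) _ _ h1 (near_coord0 g).
apply: (@filterS _ (nbhs g) (nbhs_filter g)) => g' /= [h2 h3].
have t1 := sums_tail N (HK g _); have t2 := sums_tail N (HK g' h3).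
have {}t1 := t1 (ler_wpDr ler01 (lexx `|g 0 0|)).
rewrite /bisum; move: t1 t2 h2 HN.
move: (sums _) (sums _) (\sum_(0 <= k < N) _) (\sum_(0 <= k < N) _) (2 * K * _) => a b c d q.
rewrite !ler_norml => /andP[? ?] /andP[? ?] /andP[? ?] ?; apply/andP; split; lra.
Qed.

(** A finite part is handled by differentiability of its terms, the tail by the mean value theorem
    and the domination of [dt]. The bounds on [v 0 0] keep x within [|g 0 0| + 1] for [|h| <= 1]. *)
Lemma bisum_is_derive t dt (v g : V) : v 0 0 <= 1 -> 0 <= v 0 0 ->
  (forall m g, is_derive g v (t m) (dt m g)) -> dominated t -> dominated dt ->
  is_derive g v (bisum t) (bisum dt g).
Proof.
move=> v1 v0 Dt domt domd.
suff H : h^-1 *: (bisum t (h *: v + g) - bisum t g) @[h --> 0^'] --> bisum dt g.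
  by constructor; [apply/cvg_ex; exists (bisum dt g)|apply: cvg_lim].
apply/cvgrPdist_le => e e0.
have [K K0 HK] := dominated_fold (`|g 0 0| + 1) domd.
have [L L0 HL] := dominated_fold (`|g 0 0| + 1) domt.
have e4 : 0 < e / 2 by rewrite divr_gt0.
have [N HN] := small_geo (2 * (2 * K)) e4.
pose P g := \sum_(0 <= k < N) fold_int t k g.
pose dP g := \sum_(0 <= k < N) fold_int dt k g.
have DP : is_derive g v P (dP g).
  rewrite /P /dP; elim: N {HN P dP} => [|N IH].
    under eq_fun do rewrite big_geq//.
    by rewrite big_geq//; exact: is_derive_cst.
  under eq_fun do rewrite big_nat_recr//=.
  rewrite big_nat_recr//=.
  exact: (is_deriveD IH (is_deriveD (Dt (Posz N) g) (Dt (Negz N) g))).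
have {}DP : h^-1 *: (P (h *: v + g) - P g) @[h --> 0^'] --> dP g.
  by case: DP => DP <-; exact: DP.
move/cvgrPdist_le : DP => /(_ _ e4) DP.
near=> h.
have h0 : h != 0 by near: h; exact: nbhs_dnbhs_neq.
have h1 : `|h| <= 1 by near: h; apply: dnbhs0_le.
have DPh : `|dP g - h^-1 *: (P (h *: v + g) - P g)| <= e / 2 by near: h.
have gB : `|g 0 0| <= `|g 0 0| + 1 by rewrite lerDl.
have cB c : `|c| <= 1 -> `|(c *: v + g) 0 0| <= `|g 0 0| + 1.
  move=> c1; rewrite !mxE addrC; apply: (le_trans (ler_normD _ _)); rewrite lerD2l normrM.
  by rewrite -[leRHS]mulr1; apply: ler_pM => //; rewrite ger0_norm.
(* The error of the difference quotient, term by term; its geometric bound does not depend on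
   [h]. *)
pose a k := h^-1 * (fold_int t k (h *: v + g) - fold_int t k g) - fold_int dt k g.
have aB : geo_bounded a (2 * K).
  move=> k; rewrite /a.
  pose q (s : R) := fold_int t k (g + s *: v).
  have dq (s : R) : is_derive s 1 q (fold_int dt k (g + s *: v)).
    have h2 := is_deriveD (Dt (Posz k) (g + s *: v)) (Dt (Negz k) (g + s *: v)).
    exact: (proj1 (@is_derive_line _ (fold_int t k) _ _ _ _) h2).
  have cq A : {within A, continuous q}.
    apply/continuous_subspaceT => s.
    by apply/differentiable_continuous/derivable1_diffP; case: (dq s).
  have -> : fold_int t k (h *: v + g) = q h by rewrite /q addrC.
  have -> : fold_int t k g = q 0 by rewrite /q scale0r addr0.
  have [c ch ->] : exists2 c, `|c| <= `|h| & q h - q 0 = fold_int dt k (g + c *: v) * h.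
    have [hp|hn] := ltP 0 h.
      have [c cI ->] := MVT hp (fun s _ => dq s) (cq _).
      exists c; last by rewrite subr0.
      by move: cI; rewrite in_itv/= => /andP[c0 ch]; rewrite !gtr0_norm// ltW.
    have {}hn : h < 0 by rewrite lt_neqAle h0.
    have [c cI E] := MVT hn (fun s _ => dq s) (cq _).
    exists c; last by rewrite -opprB E sub0r mulrN opprK.
    by move: cI; rewrite in_itv/= => /andP[c0 ch]; rewrite !ltr0_norm// lerN2 ltW.
  rewrite mulrCA mulVf// mulr1; apply: (le_trans (ler_normB _ _)).
  rewrite [2 * K]mulr_natl mulr2n mulrDl; apply: lerD; apply: HK => //.
  by rewrite addrC; apply: cB; exact: le_trans ch h1.
have sa : sums a = h^-1 *: (bisum t (h *: v + g) - bisum t g) - bisum dt g.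
  have b1 := HL _ (cB _ h1); have b2 := HL _ gB; have b3 := HK _ gB.
  apply: cvg_lim => //.
  have -> : series a = fun n => h^-1 * (\sum_(0 <= k < n) fold_int t k (h *: v + g) -
      \sum_(0 <= k < n) fold_int t k g) - \sum_(0 <= k < n) fold_int dt k g.
    by apply/funext => n; rewrite /series /= -sumrB mulr_sumr -sumrB.
  apply: cvgB; last exact: sums_cvg b3.
  apply: cvgM; first exact: cvg_cst.
  by apply: cvgB; [exact: sums_cvg b1|exact: sums_cvg b2].
have := sums_tail N aB; rewrite sa.
have -> : \sum_(0 <= k < N) a k = h^-1 * (P (h *: v + g) - P g) - dP g.
  by rewrite /P /dP -sumrB mulr_sumr -sumrB.
have {}DPh : `|dP g - h^-1 * (P (h *: v + g) - P g)| <= e / 2 := DPh.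
move: HN DPh; move: (h^-1 *: _) (h^-1 * _) (bisum dt g) (dP g) (_ * 2^-1 ^+ N) => A B c D q.
rewrite !ler_norml => ? /andP[? ?] /andP[? ?]; apply/andP; split; lra.
Unshelve. all: by end_near. Qed.

Lemma dominated_shift t (a : int) : dominated t -> dominated (fun m => t (m + a)).
Proof.
move=> dt B; have [K K0 HK] := dt B.
exists (K * 2 ^+ `|a|%N); first by rewrite mulr_ge0// exprn_ge0.
move=> m g gB; apply: (le_trans (HK _ _ gB)); rewrite -mulrA ler_wpM2l//.
rewrite -(@ler_pM2l _ (2 ^+ (`|m|%N))) ?exprn_gt0// mulrCA -exprMn divff ?pnatr_eq0// expr1n mulr1.
have mm : (absz m <= absz (m + a)%R + absz a)%N by lia.
apply: (@le_trans _ _ (2 ^+ (absz (m + a)%R + absz a)%N * 2^-1 ^+ absz (m + a))).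
  by rewrite ler_wpM2r ?exprn_ge0// ler_weXn2l// ler1n.
by rewrite exprD mulrAC -exprMn divff ?pnatr_eq0// expr1n mul1r.
Qed.

(** The symmetric partial sums of the shifted and the original series differ by [t n - t (- n)],
    which tends to 0. *)
Lemma bisum_shift1 t : dominated t -> bisum (fun m => t (m + 1)) = bisum t.
Proof.
move=> dt; apply/funext => g.
have [K K0 HK] := dt `|g 0 0|.
have tK m : `|t m g| <= K * 2^-1 ^+ `|m|%N by apply: HK.
have tlim (s : bool) : (fun n : nat => t ((-1) ^+ s * n%:Z) g) @ \oo --> 0.
  apply/cvgrPdist_le => e e0; have /cvgrPdist_le/(_ _ e0) := geo_cvg0 K.
  apply: filterS => n; rewrite !sub0r !normrN; apply: le_trans.
  apply: (le_trans (tK _)); rewrite abszMsign absz_nat; exact: ler_norm.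
apply: cvg_lim => //.
have -> : series (fun k => fold_int (fun m => t (m + 1)) k g) =
    fun n => (\sum_(0 <= k < n) fold_int t k g + t ((-1) ^+ false * n%:Z) g)
       - t ((-1) ^+ true * n%:Z) g.
  apply/funext => n; rewrite /series /= expr0 expr1 mul1r mulN1r; elim: n => [|n IH].
    by rewrite !big_geq// oppr0 add0r subrr.
  rewrite !big_nat_recr//= IH /fold_int !NegzE.
  have -> : n%:Z + 1 = n.+1 by rewrite -addn1.
  have -> : - n.+1%:Z + 1 = - n%:Z by rewrite -addn1 PoszD; ring.
  by ring.
rewrite -[X in _ --> X]subr0 -[X in _ --> X - _]addr0.
apply: cvgB; last exact: (tlim true).
by apply: cvgD; [exact: (sums_cvg (fold_int_bounded K0 tK))|exact: (tlim false)].
Qed.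

Lemma bisum_shift t (a : int) : dominated t -> bisum (fun m => t (m + a)) = bisum t.
Proof.
move=> dt; elim: a => [|n IH|n IH].
- by congr bisum; apply/funext => m; rewrite addr0.
- rewrite -[RHS]IH -[RHS]bisum_shift1; last exact: dominated_shift.
  by congr bisum; apply/funext => m; congr t; rewrite -addn1 PoszD; ring.
- rewrite -[RHS]IH -[LHS]bisum_shift1; last exact: dominated_shift.
  congr bisum; apply/funext => m; congr t; rewrite -addn1 PoszD; ring.
Qed.

End BilateralSeries.

(** * Terms of theta series and their derivatives *)

Section ThetaTerms.
Local Open Scope complex_scope.
Context {R : realType}.
Local Notation V := 'rV[R]_3.
Implicit Types (p q : {poly R}) (g v : V).

Lemma is_derive_comp_dir (f : R -> R) (l : V -> R) g v (a c : R) :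
  is_derive g v l c -> is_derive (l g) 1 f a -> is_derive g v (fun h => f (l h)) (a * c).
Proof.
move=> /is_derive_line0 hl hf; apply/(@is_derive_line0 _ (fun h => f (l h))).
apply: (@is_derive1_comp _ f (fun t : R => l (g + t *: v))) => //.
by rewrite scale0r addr0.
Qed.

Lemma is_derive_scale (f : V -> R) g v (a l : R) :
  is_derive g v f l -> is_derive g v (fun h => a * f h) (a * l).
Proof. exact: is_deriveZ. Qed.

Lemma poly_exp_bound p : exists K (c : nat), 0 <= K /\
  forall x, `|p.[x]| <= K * expR (c%:R * `|x|).
Proof.
elim/poly_ind: p => [|p a [K [c [K0 HK]]]].
  by exists 0, 0%N; split=> // x; rewrite horner0 normr0 mul0r.
exists (K + `|a|), c.+1; split=> [|x]; first by rewrite addr_ge0.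
rewrite hornerMXaddC mulrDl; apply: (le_trans (ler_normD _ _)); apply: lerD.
  rewrite normrM -[c.+1%:R]natr1 mulrDl mul1r expRD mulrA; apply: ler_pM => //.
  by apply: le_trans (expR_ge1Dx _); rewrite lerDr.
by rewrite ler_peMr// -[leLHS]expR0 ler_expR mulr_ge0.
Qed.

Lemma gauss_bound (w c x : R) : 0 < w ->
  expR (c * `|x|) * expR (- (w / 2) * x ^+ 2) <= expR (c ^+ 2 / (2 * w)).
Proof.
move=> w0; rewrite -expRD ler_expR -[x ^+ 2]real_normK ?num_real//.
rewrite -subr_ge0; have -> : c ^+ 2 / (2 * w) - (c * `|x| + - (w / 2) * `|x| ^+ 2) =
  (w * `|x| - c) ^+ 2 / (2 * w) by field; rewrite gt_eqF.
by rewrite divr_ge0 ?sqr_ge0// mulr_ge0// ltW.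
Qed.

Variables (w n beta : R) (r : nat) (chi : int).
Hypotheses (w0 : 0 < w) (n0 : n != 0) (r0 : (0 < r)%N) (chis : is_sign chi).

(** [betam m] runs through the y-frequencies that lattice translations in x link to [beta]; [xim m]
    measures x from the centre [- betam m / n] of the corresponding oscillator. *)
Definition betam (m : int) : R := beta + n * r%:R * m%:~R.
Definition xim (m : int) (x : R) : R := x + betam m / n.

Lemma ximE m x : xim m x = x + beta / n + r%:R * m%:~R.
Proof. by rewrite /xim /betam; field. Qed.

Lemma betamE m x : betam m = n * (xim m x - x).
Proof. by rewrite /xim; field. Qed.

(** Frequencies and polynomials grow at most like exponentials of [|xi|], which the Gaussian absorbs
    with a factor [exp(- |xi|)] to spare. As [|xi|] exceeds [|m|] up to a constant, that factor
    gives the ratio 1/2. *)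
Lemma theta_bound (j : nat) p (B : R) : exists2 K, 0 <= K & forall m x, `|x| <= B ->
  `|betam m ^+ j * pgauss w p (xim m x)| <= K * 2^-1 ^+ absz m.
Proof.
have [L [c [L0 HL]]] := poly_exp_bound p.
(* [A] bounds [|betam m|] relative to [exp |xi|]. In [c'] the summand c pays for the polynomial, j
   for the powers of [betam m], and 1 for the spare exponential. *)
pose A := `|n| * (1 + `|B|); pose c' : R := c%:R + j%:R + 1.
have A0 : 0 <= A by rewrite mulr_ge0// addr_ge0.
exists (A ^+ j * L * expR (c' ^+ 2 / (2 * w)) * expR (`|B| + `|beta / n|)).
  by rewrite !mulr_ge0 ?exprn_ge0 ?expR_ge0.
move=> m x xB; set xi := xim m x.
have xB' : `|x| <= `|B| := le_trans xB (ler_norm _).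
have bA : `|betam m| <= A * expR `|xi|.
  rewrite (betamE m x) normrM -/xi -mulrA ler_wpM2l//.
  apply: (le_trans (ler_normB _ _)); rewrite mulrDl mul1r; apply: lerD.
    by apply: le_trans (expR_ge1Dx _); rewrite lerDr.
  by apply: (le_trans xB'); rewrite ler_peMr// -[leLHS]expR0 ler_expR.
have bAj : `|betam m ^+ j| <= A ^+ j * expR (j%:R * `|xi|).
  by rewrite normrX expRM_natl -exprMn; apply: lerXn2r; rewrite ?nnegrE ?mulr_ge0 ?expR_ge0.
have mxi : expR (- `|xi|) <= expR (`|B| + `|beta / n|) * 2^-1 ^+ absz m.
  have rm : (absz m)%:R <= `|xi| + (`|B| + `|beta / n|).
    have -> : (absz m)%:R = `|m%:~R| :> R by rewrite -intr_norm -abszE.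
    apply: (@le_trans _ _ `|r%:R * m%:~R|).
      by rewrite normrM ger0_norm// ler_peMl// ler1n.
    have -> : r%:R * m%:~R = xi - x - beta / n by rewrite /xi ximE; ring.
    rewrite addrA; apply: (le_trans (ler_normB _ _)); rewrite lerD2r.
    by apply: (le_trans (ler_normB _ _)); rewrite lerD2l.
  apply: (@le_trans _ _ (expR (`|B| + `|beta / n|) * expR (- (absz m)%:R))).
    by rewrite -expRD ler_expR; lra.
  rewrite ler_wpM2l ?expR_ge0// -[(absz m)%:R]mulr1 -mulrN expRM_natl lerXn2r ?nnegrE ?expR_ge0 ?invr_ge0//.
  by rewrite expRN lef_pV2 ?posrE ?expR_gt0// (le_trans _ (expR_ge1Dx 1)).
rewrite normrM /pgauss [`|p.[_] * _|]normrM [X in _ * (_ * X)]ger0_norm ?expR_ge0//.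
apply: (@le_trans _ _ (A ^+ j * expR (j%:R * `|xi|) * (L * expR (c%:R * `|xi|) *
    expR (- (w / 2) * xi ^+ 2)))).
  apply: ler_pM; [exact: normr_ge0|by apply: mulr_ge0; [exact: normr_ge0|exact: expR_ge0]| |].
    exact: bAj.
  by rewrite ler_wpM2r ?expR_ge0.
have -> : A ^+ j * expR (j%:R * `|xi|) * (L * expR (c%:R * `|xi|) * expR (- (w / 2) * xi ^+ 2)) =
  A ^+ j * L * ((expR (c' * `|xi|) * expR (- (w / 2) * xi ^+ 2)) * expR (- `|xi|)).
  have -> : expR (c' * `|xi|) = expR (c%:R * `|xi|) * expR (j%:R * `|xi|) * expR `|xi|.
    by rewrite -!expRD; congr expR; rewrite /c'; ring.
  have E : expR `|xi| * expR (- `|xi|) = 1 by rewrite -expRD subrr expR0.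
  set e1 := expR (_ * _); set e2 := expR (_ * _); set e3 := expR (_ * _).
  transitivity (A ^+ j * L * e1 * e2 * e3 * (expR `|xi| * expR (- `|xi|))).
    by rewrite E; ring.
  by ring.
apply: (@le_trans _ _ (A ^+ j * L * (expR (c' ^+ 2 / (2 * w)) *
    (expR (`|B| + `|beta / n|) * 2^-1 ^+ absz m)))); last by rewrite !mulrA.
apply: ler_wpM2l; first by rewrite mulr_ge0// exprn_ge0.
apply: ler_pM; [by rewrite mulr_ge0 ?expR_ge0|exact: expR_ge0|exact: gauss_bound|exact: mxi].
Qed.

Definition tcos m g : R := 2 * pi * (betam m * g 0 1 + n * g 0 2%:R).

(* The phase s runs through multiples of pi / 2, so that a term, its harmonic conjugate
   and all their derivatives belong to a single real family. *)
Definition tterm (j : nat) p (s : R) (m : int) g : R :=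
  (chi ^ m)%:~R * betam m ^+ j * pgauss w p (xim m (g 0 0)) * cos (tcos m g + s).

Definition dgauss p := p^`() - w *: ('X * p).

Lemma tterm_dominated j p s : dominated (tterm j p s).
Proof.
move=> B; have [K K0 HK] := theta_bound j p B; exists K => // m g gB.
rewrite /tterm normrM -!mulrA normrM.
have -> : `|(chi ^ m)%:~R| = 1 :> R.
  by case: (is_sign_exp m chis) => ->; rewrite ?rmorphN1 ?normrN normr1.
rewrite mul1r -[leRHS]mulr1; apply: ler_pM => //; last exact: cos_max.
exact: HK.
Qed.

Lemma is_derive_tcos m s g v : is_derive g v (fun h => cos (tcos m h + s))
  (2 * pi * (betam m * v 0 1 + n * v 0 2%:R) * cos (tcos m g + (s + pi / 2))).
Proof.
have h1 := is_derive_scale (betam m) (is_derive_coord g v 1).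
have h2 := is_derive_scale n (is_derive_coord g v 2%:R).
have h3 := is_deriveD (is_derive_scale (2 * pi) (is_deriveD h1 h2)) (is_derive_cst s g v).
have h := @is_derive_comp_dir (@cos R) (fun h => tcos m h + s) g v _ _ h3 (is_derive_cos _).
apply: (is_derive_eq h).
by rewrite addrA cosDpihalf addr0; ring.
Qed.

Lemma is_derive_tgauss p m g v : is_derive g v (fun h => pgauss w p (xim m (h 0 0)))
  (v 0 0 * pgauss w (dgauss p) (xim m (g 0 0))).
Proof.
have h1 := is_deriveD (is_derive_coord g v 0) (is_derive_cst (betam m / n) g v).
have h := @is_derive_comp_dir (pgauss w p) (fun h => xim m (h 0 0)) g v _ _ h1 (is_derive_pgauss w p _).
by apply: (is_derive_eq h); rewrite addr0 mulrC.
Qed.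

Lemma is_derive_tterm j p s m g v : is_derive g v (tterm j p s m)
  (v 0 0 * tterm j (dgauss p) s m g + v 0 1 * (2 * pi * tterm j.+1 p (s + pi / 2) m g) +
   v 0 2%:R * (2 * pi * n * tterm j p (s + pi / 2) m g)).
Proof.
have h := is_derive_mul (is_derive_scale ((chi ^ m)%:~R * betam m ^+ j) (is_derive_tgauss p m g v))
  (is_derive_tcos m s g v).
apply: (is_derive_eq h); rewrite /tterm exprS; ring.
Qed.

Lemma continuous_of_derive (f : R -> R) (f' : R -> R) :
  (forall x : R, is_derive x 1 f (f' x)) -> continuous f.
Proof. by move=> df x; apply/differentiable_continuous/derivable1_diffP; case: (df x). Qed.

Lemma continuous_tterm j p s m : continuous (tterm j p s m).
Proof.
apply: continuous_mul.
  apply: continuous_mul; first exact: continuous_cst.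
  move=> g; apply: (@continuous_comp _ _ _ (fun g : V => xim m (g 0 0)) (pgauss w p)).
    by apply: continuous_add; [exact: continuous_coord|exact: continuous_cst].
  exact: (continuous_of_derive (is_derive_pgauss w p)).
move=> g; apply: (@continuous_comp _ _ _ (fun g : V => tcos m g + s) (@cos R)).
  apply: continuous_add; last exact: continuous_cst.
  apply: continuous_mul; first exact: continuous_cst.
  by apply: continuous_add; apply: continuous_mul;
    [exact: continuous_cst|exact: continuous_coord|exact: continuous_cst|exact: continuous_coord].
exact: continuous_cos.
Qed.

(* The closure properties shared by a single term and by the full theta series. *)
Record theta_family (F : nat -> {poly R} -> R -> V -> R) : Prop := ThetaFamily {
  theta_continuous : forall j p s, continuous (F j p s);
  theta_dx : forall j p s g, is_derive g (delta_mx 0 0) (F j p s) (F j (dgauss p) s g);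
  theta_dy : forall j p s g, is_derive g (delta_mx 0 1) (F j p s)
    (2 * pi * F j.+1 p (s + pi / 2) g);
  theta_dz : forall j p s g, is_derive g (delta_mx 0 2%:R) (F j p s)
    (2 * pi * n * F j p (s + pi / 2) g);
  theta_pi : forall j p s g, F j p (s + pi) g = - F j p s g;
  theta_beta : forall j p s g, F j.+1 p s g = n * (F j ('X * p) s g - g 0 0 * F j p s g);
  theta_lin : forall j p q a s g, F j (a *: p + q) s g = a * F j p s g + F j q s g }.

Lemma tterm_pi j p s m g : tterm j p (s + pi) m g = - tterm j p s m g.
Proof. by rewrite /tterm addrA cos_addpi mulrN. Qed.

Lemma tterm_beta j p s m g :
  tterm j.+1 p s m g = n * (tterm j ('X * p) s m g - g 0 0 * tterm j p s m g).
Proof.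
rewrite /tterm exprS /pgauss hornerM hornerX; move: (betam m ^+ j) => bj.
by rewrite (betamE m (g 0 0)); ring.
Qed.

Lemma tterm_lin j p q a s m g :
  tterm j (a *: p + q) s m g = a * tterm j p s m g + tterm j q s m g.
Proof. by rewrite /tterm /pgauss hornerD hornerZ; ring. Qed.

Let e0 : (delta_mx 0 0 : V) 0 0 = 1 /\ (delta_mx 0 0 : V) 0 1 = 0 /\ (delta_mx 0 0 : V) 0 2%:R = 0.
Proof. by rewrite !mxE. Qed.
Let e1 : (delta_mx 0 1 : V) 0 0 = 0 /\ (delta_mx 0 1 : V) 0 1 = 1 /\ (delta_mx 0 1 : V) 0 2%:R = 0.
Proof. by rewrite !mxE. Qed.
Let e2 : (delta_mx 0 2%:R : V) 0 0 = 0 /\ (delta_mx 0 2%:R : V) 0 1 = 0 /\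
  (delta_mx 0 2%:R : V) 0 2%:R = 1.
Proof. by rewrite !mxE. Qed.

Let tterm_dx j p s m g : is_derive g (delta_mx 0 0) (tterm j p s m) (tterm j (dgauss p) s m g).
Proof.
apply: (is_derive_eq (is_derive_tterm j p s m g _)).
by case: e0 => -> [-> ->]; rewrite mul1r !mul0r !addr0.
Qed.
Let tterm_dy j p s m g : is_derive g (delta_mx 0 1) (tterm j p s m)
  (2 * pi * tterm j.+1 p (s + pi / 2) m g).
Proof.
apply: (is_derive_eq (is_derive_tterm j p s m g _)).
by case: e1 => -> [-> ->]; rewrite mul1r !mul0r !addr0 add0r.
Qed.
Let tterm_dz j p s m g : is_derive g (delta_mx 0 2%:R) (tterm j p s m)
  (2 * pi * n * tterm j p (s + pi / 2) m g).
Proof.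
apply: (is_derive_eq (is_derive_tterm j p s m g _)).
by case: e2 => -> [-> ->]; rewrite mul1r !mul0r !add0r.
Qed.

Lemma theta_family_tterm m : theta_family (fun j p s => tterm j p s m).
Proof.
split=> *; [exact: continuous_tterm|exact: tterm_dx|exact: tterm_dy|exact: tterm_dz|
  exact: tterm_pi|exact: tterm_beta|exact: tterm_lin].
Qed.

Lemma dominatedZ t (x : R) : dominated t -> dominated (fun m (g : V) => x * t m g).
Proof.
move=> dt B; have [K K0 HK] := dt B; exists (`|x| * K); first by rewrite mulr_ge0.
by move=> m g gB; rewrite normrM -mulrA ler_wpM2l// HK.
Qed.

Lemma theta_family_bisum : theta_family (fun j p s => bisum (tterm j p s)).
Proof.
have D := tterm_dominated.
split.
- by move=> j p s; apply: bisum_continuous => // m; exact: continuous_tterm.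
- by move=> j p s g; apply: bisum_is_derive => //; rewrite ?(proj1 e0).
- move=> j p s g.
  have <- : bisum (fun m g => 2 * pi * tterm j.+1 p (s + pi / 2) m g) g =
      2 * pi * bisum (tterm j.+1 p (s + pi / 2)) g by rewrite (bisumZ (fun=> _)).
  by apply: bisum_is_derive => //; rewrite ?(proj1 e1)//; exact: dominatedZ.
- move=> j p s g.
  have <- : bisum (fun m g => 2 * pi * n * tterm j p (s + pi / 2) m g) g =
      2 * pi * n * bisum (tterm j p (s + pi / 2)) g by rewrite (bisumZ (fun=> _)).
  by apply: bisum_is_derive => //; rewrite ?(proj1 e2)//; exact: dominatedZ.
- move=> j p s g; have <- : bisum (fun m g => - 1 * tterm j p s m g) g = - bisum (tterm j p s) g.
    by rewrite (bisumZ (fun=> _))// mulN1r.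
  congr (bisum _ g); apply/funext => m; apply/funext => h; rewrite tterm_pi; ring.
- move=> j p s g.
  have E1 := bisum_lin (fun g : V => - g 0 0) (D j p s) (D j ('X * p) s).
  (* The combination with coefficient x is [n^-1] times the term with one more power of [betam m],
     which is dominated. *)
  have E2 : dominated (fun m g => - g 0 0 * tterm j p s m g + tterm j ('X * p) s m g).
    have -> : (fun m g => - g 0 0 * tterm j p s m g + tterm j ('X * p) s m g) =
        (fun m g => n^-1 * tterm j.+1 p s m g).
      apply/funext => m; apply/funext => h; rewrite tterm_beta mulKf//; ring.
    exact: dominatedZ.
  have := bisumZ (fun=> n) E2; rewrite E1 => /(congr1 (fun u => u g)) /=.
  have -> : - g 0 0 * bisum (tterm j p s) g + bisum (tterm j ('X * p) s) g =
    bisum (tterm j ('X * p) s) g - g 0 0 * bisum (tterm j p s) g by ring.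
  move=> <-; congr (bisum _ g); apply/funext => m; apply/funext => h.
  by rewrite tterm_beta; ring.
- move=> j p q a s g.
  rewrite -[RHS]/((fun g => (fun=> a) g * bisum (tterm j p s) g + bisum (tterm j q s) g) g).
  rewrite -bisum_lin//; congr (bisum _ g); apply/funext => m; apply/funext => h.
  by rewrite tterm_lin.
Qed.

Section Family.
Variable F : nat -> {poly R} -> R -> V -> R.
Hypothesis HF : theta_family F.

Lemma theta_smooth j p s : smooth (F j p s).
Proof.
pose S (f : V -> R) := exists a j p s, f = fun g => a * F j p s g.
have SF : S (F j p s) by exists 1, j, p, s; apply/funext => g; rewrite mul1r.
move: (F j p s) SF; apply: smooth_coind => _ [a [{}j [{}p [{}s ->]]]].
split; first by apply: continuous_mul; [exact: continuous_cst|exact: theta_continuous].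
have H (i : 'I_3) : exists b j' p' s',
    forall g, is_derive g (delta_mx 0 i) (F j p s) (b * F j' p' s' g).
  case: i => -[|[|[|//]]] Hi.
  - exists 1, j, (dgauss p), s => g; rewrite mul1r.
    have -> : Ordinal Hi = 0 :> 'I_3 by exact: val_inj.
    exact: (theta_dx HF).
  - exists (2 * pi), j.+1, p, (s + pi / 2) => g.
    have -> : Ordinal Hi = 1 :> 'I_3 by exact: val_inj.
    exact: (theta_dy HF).
  - exists (2 * pi * n), j, p, (s + pi / 2) => g.
    have -> : Ordinal Hi = 2%:R :> 'I_3 by exact: val_inj.
    exact: (theta_dz HF).
move=> i; have [b [j' [p' [s' Hd]]]] := H i.
have Hd' g : is_derive g (delta_mx 0 i) (fun g => a * F j p s g) (a * b * F j' p' s' g).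
  by rewrite -mulrA; exact: is_derive_scale.
split; first by move=> g; case: (Hd' g).
by exists (a * b), j', p', s'; apply: pdE.
Qed.

(** A phase shift by - pi / 2 turns the cosine into a sine, so this is the series with complex
    exponentials. *)
Definition ctheta p : V -> R[i] := fun g => F 0 p 0 g +i* F 0 p (- (pi / 2)) g.

Lemma csmooth_ctheta p : csmooth (ctheta p).
Proof. by split; exact: theta_smooth. Qed.

Let half_pi j p g : F j p (0 + pi / 2) g = - F j p (- (pi / 2)) g.
Proof.
rewrite -(theta_pi HF); congr (F j p _ g).
by rewrite add0r; field.
Qed.

Let half_pi' j p g : F j p (- (pi / 2) + pi / 2) g = F j p 0 g.
Proof. by rewrite addNr. Qed.

Lemma ctheta_X p : cX (ctheta p) = ctheta (dgauss p).
Proof.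
apply/funext => g; rewrite /cX /cop /fX /ctheta /=.
by rewrite (pdE (theta_dx HF _ _ _)) (pdE (theta_dx HF _ _ _)).
Qed.

Lemma ctheta_Z p : cZ (ctheta p) = fun g => 'i%C * (2 * pi * n)%:C * ctheta p g.
Proof.
apply/funext => g; rewrite /cZ /cop /fZ /ctheta /=.
rewrite (pdE (theta_dz HF _ _ _)) (pdE (theta_dz HF _ _ _)) half_pi half_pi'.
by apply: complexP => /=; ring.
Qed.

(** The derivative in y produces [betam m = n (xi - x)] and the part [x d/dz] of Y produces [n x];
    the explicit x cancels and multiplication by [xi] remains. *)
Lemma ctheta_Y p : cY (ctheta p) = fun g => 'i%C * (2 * pi * n)%:C * ctheta ('X * p) g.
Proof.
apply/funext => g; rewrite /cY /cop /fY /ctheta /=.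
rewrite !(pdE (theta_dy HF _ _ _)) !(pdE (theta_dz HF _ _ _)) !half_pi !half_pi'.
by rewrite !(theta_beta HF); apply: complexP => /=; ring.
Qed.

Lemma ctheta_lin a p q g : ctheta (a *: p + q) g = a%:C * ctheta p g + ctheta q g.
Proof. by rewrite /ctheta !(theta_lin HF); apply: complexP => /=; ring. Qed.

End Family.

End ThetaTerms.

(** * Equivariance and Fourier coefficients of theta series *)

Section ThetaSections.
Local Open Scope complex_scope.
Context {R : realType}.
Local Notation V := 'rV[R]_3.
Local Notation C := R[i].
Local Notation Re := complex.Re.
Local Notation Im := complex.Im.
Implicit Types (p q : {poly R}) (g v : V).

Lemma cis_sign_int (chi : int) (x : R) (a : int) : is_sign chi ->
  cis (2 * pi * x) = chi%:~R :> C -> cis (2 * pi * (x * a%:~R)) = (chi ^ a)%:~R :> C.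
Proof.
move=> cs cx.
have H (k : nat) : cis (2 * pi * (x * k%:R)) = (chi ^ k)%:~R :> C.
  elim: k => [|k IH]; first by rewrite !mulr0 cis0 expr0z.
  have -> : 2 * pi * (x * k.+1%:R) = 2 * pi * (x * k%:R) + 2 * pi * x.
    by rewrite -[k.+1%:R]natr1; ring.
  rewrite cisD IH cx.
  by rewrite -intrM -!exprnP exprSr.
case: a => k; first exact: H.
rewrite NegzE rmorphN mulrN (cis_signN (H k.+1)); congr (_%:~R).
Qed.

Lemma J_bounded_line w (k : R -> R) (f : V -> R) (K : R) g : continuous k ->
  (forall t, `|k t| <= 1) -> continuous f ->
  (forall t : R, `|f (g + t *: w)| <= K) -> `|J w k f g| <= K.
Proof.
move=> ck k1 cf fK; apply: ge0_Rintegral01_le; first exact: continuous_Jarg.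
by move=> t _; rewrite normrM -[leRHS]mulr1; apply: ler_pM.
Qed.

Lemma cint_bounded_line w b (F : V -> C) (K : R) g : ccontinuous F ->
  (forall t : R, `|Re (F (g + t *: w))| <= K /\ `|Im (F (g + t *: w))| <= K) ->
  `|Re (cint w b F g)| <= K + K /\ `|Im (cint w b F g)| <= K + K.
Proof.
move=> [c1 c2] FK; have [ck csn] := (@continuous_kc R b, @continuous_ks R b).
have bk t : `|kc b t| <= 1 by exact: cos_max.
have bs t : `|ks b t| <= 1 by exact: sin_max.
rewrite /cint /=; split.
- apply: (le_trans (ler_normD _ _)); apply: lerD; apply: J_bounded_line => // t; by case: (FK t).
- apply: (le_trans (ler_normB _ _)); apply: lerD; apply: J_bounded_line => // t; by case: (FK t).
Qed.

Lemma csmooth_sum (I : Type) (s : seq I) (F : I -> V -> C) :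
  (forall i, csmooth (F i)) -> csmooth (fun g => \sum_(i <- s) F i g).
Proof.
move=> sF; elim: s => [|i s IH].
  by under eq_fun do rewrite big_nil; exact: csmooth_cst.
by under eq_fun do rewrite big_cons; exact: csmoothD.
Qed.

Lemma cint_sum w b (I : Type) (s : seq I) (F : I -> V -> C) g : (forall i, csmooth (F i)) ->
  cint w b (fun g => \sum_(i <- s) F i g) g = \sum_(i <- s) cint w b (F i) g.
Proof.
move=> sF; elim: s => [|i s IH].
  rewrite big_nil; under eq_fun do rewrite big_nil.
  by rewrite /cint /= !J0; apply: complexP => /=; ring.
rewrite big_cons -IH; under eq_fun do rewrite big_cons.
have := cint_lin w b 1 (csmooth_continuous (sF i)) (csmooth_continuous (csmooth_sum s sF)).
move=> /(congr1 (fun u => u g)) /=; rewrite mul1r => <-.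
by congr (cint w b _ g); apply/funext => h; rewrite mul1r.
Qed.

Variables (w n beta : R) (r : nat) (d1 d2 d3 Nr : int).
Hypotheses (w0 : 0 < w) (n0 : n != 0) (r0 : (0 < r)%N).
Hypotheses (s1 : is_sign d1) (s2 : is_sign d2) (s3 : is_sign d3).
Hypotheses (HN : n * r%:R = Nr%:~R) (Hbeta : cis (2 * pi * beta) = d2%:~R :> C)
  (Hn : cis (2 * pi * n) = d3%:~R :> C).

Local Notation tt := (tterm w n beta r d1).
Definition theta p : V -> C := ctheta (fun j p s => bisum (tt j p s)) p.
Definition thetam m p : V -> C := ctheta (fun j p s => tt j p s m) p.

Let fam : theta_family w n (fun j p s => bisum (tt j p s)).
Proof. exact: theta_family_bisum. Qed.
Let famm m : theta_family w n (fun j p s => tt j p s m).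
Proof. exact: theta_family_tterm. Qed.

Lemma csmooth_theta p : csmooth (theta p). Proof. exact: csmooth_ctheta fam p. Qed.
Lemma csmooth_thetam m p : csmooth (thetam m p). Proof. exact: csmooth_ctheta (famm m) p. Qed.

(** Translation by [r a] in x moves the Gaussian centre, and its shear of z moves the y-frequency,
    both from index m to m + a; summation over m then restores equivariance. *)
Lemma tterm_lattice p s m a b c g :
  tt 0 p s m (hmul (lpt r a b c) g) = (d1 ^ a * d2 ^ b * d3 ^ c)%:~R * tt 0 p s (m + a) g.
Proof.
rewrite /lpt [g]hpt_eta hmulE /tterm /tcos ![hpt _ _ _ _ _]mxE /=.
have -> : xim n beta r m (r%:R * a%:~R + g 0 0) = xim n beta r (m + a) (g 0 0).
  by rewrite !ximE// intrD; ring.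
(* The remaining phase: the character of y, a multiple of 2 pi because [n r = Nr] is an integer, and
   the central character. *)
set B := 2 * pi * (beta * b%:~R) + (2 * pi * (Nr * m * b)%:~R + 2 * pi * (n * c%:~R)).
have -> : 2 * pi * (betam n beta r m * (b%:~R + g 0 1) +
    n * (c%:~R + g 0 2%:R + r%:R * a%:~R * g 0 1)) + s =
  (2 * pi * (betam n beta r (m + a) * g 0 1 + n * g 0 2%:R) + s) + B.
  by rewrite /B !intrM -HN /betam intrD; ring.
have /cis_sign [cB sB] : cis B = (d2 ^ b * d3 ^ c)%:~R :> C.
  rewrite /B !cisD (cis_sign_int b s2 Hbeta) (cis_sign_int c s3 Hn).
  by rewrite cis_int mul1r -intrM.
rewrite [cos (_ + B)]cosD cB sB mulr0 subr0 !intrM !expr0.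
have -> : (d1 ^ (m + a))%:~R = (d1 ^ m)%:~R * (d1 ^ a)%:~R :> R.
  by rewrite -intrM exprzDr// is_sign_unit.
have : (d1 ^ a)%:~R * (d1 ^ a)%:~R = 1 :> R by rewrite -intrM is_sign_sq//; exact: is_sign_exp.
move: ((d1 ^ m)%:~R) ((d1 ^ a)%:~R) ((d2 ^ b)%:~R) ((d3 ^ c)%:~R) (pgauss _ _ _) (cos _) => A x y z G c0 xx.
transitivity ((x * x) * (A * 1 * G * (c0 * (y * z)))); last by ring.
by rewrite xx; ring.
Qed.

Lemma bisum_lattice p s a b c g :
  bisum (tt 0 p s) (hmul (lpt r a b c) g) = (d1 ^ a * d2 ^ b * d3 ^ c)%:~R * bisum (tt 0 p s) g.
Proof.
have D : dominated (tt 0 p s) by exact: tterm_dominated.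
have <- := congr1 (fun u => u g) (bisum_shift a D).
have := bisumZ (fun=> (d1 ^ a * d2 ^ b * d3 ^ c)%:~R) (dominated_shift a D).
move=> /(congr1 (fun u => u g)) /= <-.
rewrite /bisum; congr sums; apply/funext => k.
by rewrite /fold_int !tterm_lattice.
Qed.

Lemma theta_lattice p a b c g :
  theta p (hmul (lpt r a b c) g) = (d1 ^ a * d2 ^ b * d3 ^ c)%:~R * theta p g.
Proof.
rewrite /theta /ctheta !bisum_lattice -(rmorph_int (real_complex R)).
by apply: complexP => /=; ring.
Qed.

Lemma theta_cint_z p (n' : R) : cis (2 * pi * n') = d3%:~R :> C ->
  forall g, cint (1 *: delta_mx 0 2%:R) n' (theta p) g = (n' == n)%:R * theta p g.
Proof.
move=> Hn'; apply: (cint_exp s3) => //; first exact: csmooth_theta.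
by move=> g; rewrite mul1r -/(fZ) [LHS](congr1 (fun u => u g) (ctheta_Z fam p)).
Qed.

Lemma thetam_cint_y m p (b : R) : cis (2 * pi * b) = d2%:~R :> C ->
  forall g, cint (1 *: delta_mx 0 1) b (thetam m p) g =
    (b == betam n beta r m)%:R * thetam m p g.
Proof.
move=> Hb; apply: (cint_exp s2) => //; first exact: csmooth_thetam.
- move=> g; rewrite mul1r /cop /thetam /ctheta /=.
  rewrite (pdE (theta_dy (famm m) _ _ _)) (pdE (theta_dy (famm m) _ _ _)).
  have e1 : tt 1 p (0 + pi / 2) m g = - (betam n beta r m) * tt 0 p (- (pi / 2)) m g.
    have -> : 0 + pi / 2 = - (pi / 2) + pi :> R by field.
    by rewrite tterm_pi /tterm expr1 expr0; ring.
  have e2 : tt 1 p (- (pi / 2) + pi / 2) m g = betam n beta r m * tt 0 p 0 m g.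
    by rewrite addNr /tterm expr1 expr0; ring.
  by rewrite e1 e2; apply: complexP => /=; ring.
- have -> : 2 * pi * betam n beta r m = 2 * pi * beta + 2 * pi * (Nr * m)%:~R.
    by rewrite intrM -HN /betam; ring.
  by rewrite cisD Hbeta cis_int mulr1.
Qed.

Definition thetaN N p g : C :=
  \sum_(0 <= k < N) (thetam (Posz k) p g + thetam (Negz k) p g).

Lemma csmooth_thetaN N p : csmooth (thetaN N p).
Proof. by apply: csmooth_sum => k; apply: csmoothD; exact: csmooth_thetam. Qed.

Lemma thetaN_tail p (B : R) : exists K, forall N g, `|g 0 0| <= B ->
  `|Re (theta p g - thetaN N p g)| <= K * 2^-1 ^+ N /\
  `|Im (theta p g - thetaN N p g)| <= K * 2^-1 ^+ N.
Proof.
have D s : dominated (tt 0 p s) by exact: tterm_dominated.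
have [K K0 HK] := dominated_fold B (D 0).
have [L L0 HL] := dominated_fold B (D (- (pi / 2))).
exists (2 * K + 2 * L) => N g gB.
have RS : Re (thetaN N p g) = \sum_(0 <= k < N) fold_int (tt 0 p 0) k g.
  by rewrite /thetaN raddf_sum; apply: eq_bigr => k _.
have IS : Im (thetaN N p g) = \sum_(0 <= k < N) fold_int (tt 0 p (- (pi / 2))) k g.
  by rewrite /thetaN raddf_sum; apply: eq_bigr => k _.
rewrite !raddfB /= RS IS; split.
- apply: (le_trans (sums_tail N (HK g gB))).
  by rewrite ler_wpM2r ?exprn_ge0 ?invr_ge0// lerDl mulr_ge0.
- apply: (le_trans (sums_tail N (HL g gB))).
  by rewrite ler_wpM2r ?exprn_ge0 ?invr_ge0// lerDr mulr_ge0.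
Qed.

(** No exchange of sum and integral: x is constant along the path, so the tail bound is uniform
    there, and the coefficient differs from [z] by at most a multiple of [2^-N] for every N > 0. *)
Lemma theta_cint_y p (b : R) g (z : C) : cis (2 * pi * b) = d2%:~R :> C ->
  (forall N, (0 < N)%N -> \sum_(0 <= k < N)
     ((b == betam n beta r (Posz k))%:R * thetam (Posz k) p g +
      (b == betam n beta r (Negz k))%:R * thetam (Negz k) p g) = z) ->
  cint (1 *: delta_mx 0 1) b (theta p) g = z.
Proof.
move=> Hb HS; set v := 1 *: _.
have cN N : (0 < N)%N -> cint v b (thetaN N p) g = z.
  move=> N0; rewrite -(HS N N0) /thetaN cint_sum; last first.
    by move=> k; apply: csmoothD; exact: csmooth_thetam.
  apply: eq_bigr => k _; rewrite -!thetam_cint_y//.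
  have c m := csmooth_continuous (csmooth_thetam m p).
  have := cint_lin v b 1 (c (Posz k)) (c (Negz k)).
  move=> /(congr1 (fun u => u g)) /=; rewrite mul1r => <-.
  by congr (cint v b _ g); apply/funext => h; rewrite mul1r.
have [K HK] := thetaN_tail p `|g 0 0|.
pose D N (h : V) : C := -1 * thetaN N p h + theta p h.
have sD N : csmooth (D N) by apply: csmooth_lin; [exact: csmooth_thetaN|exact: csmooth_theta].
have DK N (t : R) : `|Re (D N (g + t *: v))| <= K * 2^-1 ^+ N /\
    `|Im (D N (g + t *: v))| <= K * 2^-1 ^+ N.
  rewrite /D mulN1r addrC; apply: HK.
  by rewrite /v !mxE /= !mulr0 addr0.
have E N : (0 < N)%N -> cint v b (D N) g = cint v b (theta p) g - z.
  move=> N0; rewrite -(cN N N0).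
  have := cint_lin v b (-1) (csmooth_continuous (csmooth_thetaN N p)) (csmooth_continuous (csmooth_theta p)).
  move=> /(congr1 (fun u => u g)) /= ->; ring.
have small (x : R) : (forall N, (0 < N)%N -> `|x| <= 2 * K * 2^-1 ^+ N) -> x = 0.
  move=> Hx; apply/eqP; rewrite -normr_eq0; apply/negP => /negP xn0.
  have x0 : 0 < `|x| by rewrite lt_neqAle eq_sym xn0 normr_ge0.
  have [N HNx] := small_geo (2 * K) x0.
  have := Hx N.+1 isT; rewrite leNgt => /negP; apply; apply: le_lt_trans HNx.
  have K0 : 0 <= 2 * K * 2^-1 ^+ N.+1 by apply: le_trans (Hx N.+1 isT).
  by rewrite exprS mulrCA in K0 *; lra.
apply/eqP; rewrite -subr_eq0; apply/eqP; apply: complexP; apply: small => N N0;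
  rewrite -(E N N0) -mulrA mulr_natl mulr2n;
  by have [] := cint_bounded_line b (csmooth_continuous (sD N)) (DK N).
Qed.

Lemma betam_inj m m' : betam n beta r m = betam n beta r m' -> m = m'.
Proof.
move=> /addrI /mulfI H; apply/intr_inj/H.
by rewrite mulf_neq0// pnatr_eq0 -lt0n.
Qed.

Lemma theta_cint_y_self p g :
  cint (1 *: delta_mx 0 1) beta (theta p) g = thetam 0 p g.
Proof.
have b0 : betam n beta r 0 = beta by rewrite /betam mulr0 addr0.
have bE m : (beta == betam n beta r m) = (m == 0).
  by apply/eqP/eqP => [h|->//]; apply/esym/betam_inj; rewrite b0.
apply: theta_cint_y => // -[//|N] _.
rewrite big_nat_recl//= !bE eqxx mul1r mul0r addr0 big1 ?addr0// => k _.
by rewrite !bE !mul0r addr0.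
Qed.

Lemma theta_cint_y_other p (b : R) g : cis (2 * pi * b) = d2%:~R :> C ->
  (forall m, b != betam n beta r m) -> cint (1 *: delta_mx 0 1) b (theta p) g = 0.
Proof.
move=> Hb bm; apply: theta_cint_y => // N _; apply: big1 => k _.
by rewrite !(negbTE (bm _)) !mul0r addr0.
Qed.

End ThetaSections.

(** * Fourier coefficients of sections *)

Section Sections.
Local Open Scope complex_scope.
Context {R : realType}.
Local Notation V := 'rV[R]_3.
Local Notation C := R[i].
Local Notation Re := complex.Re.
Local Notation Im := complex.Im.
Local Notation mu := (@lebesgue_measure R).
Implicit Types (F G : V -> C) (g v : V).

Lemma J_mul_re w b (F : V -> C) g : ccontinuous F ->
  cint w b F g = (\int[mu]_(t in `[0, 1]) Re (F (g + t *: w) * cis (- (2 * pi * b * t)))) +i*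
    (\int[mu]_(t in `[0, 1]) Im (F (g + t *: w) * cis (- (2 * pi * b * t)))).
Proof.
move=> [c1 c2].
have ij (f : V -> R) (k : R -> R) : continuous f -> continuous k ->
    mu.-integrable `[0, 1] (EFin \o (fun t => f (g + t *: w) * k t)).
  by move=> cf ck; exact/continuous_integrable/continuous_Jarg.
have [ck csn] := (@continuous_kc R b, @continuous_ks R b).
rewrite /cint /J -(RintegralD _ (ij _ _ c1 ck) (ij _ _ c2 csn))//.
rewrite -(RintegralB _ (ij _ _ c2 ck) (ij _ _ c1 csn))//.
congr (_ +i* _); apply: eq_Rintegral => t _; rewrite /kc /ks /cis cosN sinN;
  by case: (F _) => x y /=; ring.
Qed.

(** A character along the path is absorbed by the exponential of the integral and only shifts its
    frequency. *)
Lemma cint_twist w b c (F G : V -> C) g h : ccontinuous F -> ccontinuous G ->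
  (forall t : R, F (g + t *: w) = cis (- (2 * pi * c * t)) * G (h + t *: w)) ->
  cint w b F g = cint w (b + c) G h.
Proof.
move=> cF cG FG; rewrite !J_mul_re//.
have E (t : R) : F (g + t *: w) * cis (- (2 * pi * b * t)) =
    G (h + t *: w) * cis (- (2 * pi * (b + c) * t)).
  by rewrite FG mulrAC -cisD mulrC; congr (_ * cis _); ring.
by congr (_ +i* _); apply: eq_Rintegral => t _; rewrite E.
Qed.

Variables (r : nat) (eps : V -> int).
Hypotheses (r0 : (0 < r)%N) (Heps : spin_structure r eps).
Let d1 := delta1 r eps.
Let d2 := delta2 eps.
Let d3 := delta3 eps.

Definition csection F := [/\ csmooth F, equivariant r eps (fun g => Re (F g)) &
  equivariant r eps (fun g => Im (F g))].

Lemma csectionP F : csection F <-> csmooth F /\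
  forall a b c g, F (hmul (lpt r a b c) g) = (d1 ^ a * d2 ^ b * d3 ^ c)%:~R * F g.
Proof.
split=> [[sF e1 e2]|[sF eF]]; split=> //.
- move=> a b c g; rewrite -(spin_structureE Heps) -(rmorph_int (real_complex R)).
  apply: complexP; first by rewrite (e1 _ g (lattice_lpt r a b c)); case: (F g) => x y /=; ring.
  by rewrite (e2 _ g (lattice_lpt r a b c)); case: (F g) => x y /=; ring.
- move=> g0 g [a [b [c ->]]]; rewrite -/(lpt r a b c) eF (spin_structureE Heps).
  by rewrite -(rmorph_int (real_complex R)); case: (F g) => x y /=; ring.
- move=> g0 g [a [b [c ->]]]; rewrite -/(lpt r a b c) eF (spin_structureE Heps).
  by rewrite -(rmorph_int (real_complex R)); case: (F g) => x y /=; ring.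
Qed.

Lemma csection_smooth F : csection F -> csmooth F. Proof. by case. Qed.

Lemma csection_lin a F G : csection F -> csection G -> csection (fun g => a * F g + G g).
Proof.
move=> /csectionP[sF eF] /csectionP[sG eG]; apply/csectionP; split; first exact: csmooth_lin.
by move=> x y z g; rewrite eF eG; ring.
Qed.

Lemma csection_cX F : csection F -> csection (cX F).
Proof.
move=> [[s1 s2] e1 e2]; split; first by split; exact: smooth_fX.
  exact: equivariant_fX.
exact: equivariant_fX.
Qed.

Lemma csection_cY F : csection F -> csection (cY F).
Proof.
move=> [[s1 s2] e1 e2]; split; first by split; exact: smooth_fY.
  exact: equivariant_fY.
exact: equivariant_fY.
Qed.

Lemma csection_bounded F : csection F -> exists K, forall g, `|Re (F g)| <= K /\ `|Im (F g)| <= K.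
Proof.
move=> [[s1 s2] e1 e2].
have [K HK] := equivariant_bounded r0 Heps (smooth_continuous s1) e1.
have [L HL] := equivariant_bounded r0 Heps (smooth_continuous s2) e2.
exists (Num.max K L) => g; rewrite !le_max; split; first by rewrite HK.
by rewrite HL orbT.
Qed.

Local Notation ey := (1 *: delta_mx 0 1 : V).
Local Notation ez := (1 *: delta_mx 0 2%:R : V).

Lemma csection_ez F g : csection F -> F (g + ez) = d3%:~R * F g.
Proof.
move=> /csectionP[_ eF]; have := eF 0 0 1 g; rewrite !expr0z expr1z !mul1r => <-.
congr F; rewrite [g]hpt_eta; move: (g 0 0) (g 0 1) (g 0 2%:R) => x y z.
by rewrite /lpt hmulE; apply/rowP => i; case_ord; mxsimp; ring.
Qed.

Lemma csection_ey F g : csection F -> F (g + ey) = d2%:~R * F g.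
Proof.
move=> /csectionP[_ eF]; have := eF 0 1 0 g; rewrite !expr0z expr1z mul1r mulr1 => <-.
congr F; rewrite [g]hpt_eta; move: (g 0 0) (g 0 1) (g 0 2%:R) => x y z.
by rewrite /lpt hmulE; apply/rowP => i; case_ord; mxsimp; ring.
Qed.

(** Left translations by g(0,1,0) and g(0,0,1) are plain coordinate translations, so z and y admit
    ordinary Fourier expansions before x is considered. *)
Definition coef (n b : R) F : V -> C := cint ey b (cint ez n F).

Let sd2 : is_sign d2. Proof. exact: delta2_sign Heps. Qed.
Let sd3 : is_sign d3. Proof. exact: delta3_sign Heps. Qed.

Section Coefficient.
Variables (n b : R).
Hypotheses (Hn : cis (2 * pi * n) = d3%:~R :> C) (Hb : cis (2 * pi * b) = d2%:~R :> C).

Let cn F : csection F -> csmooth (cint ez n F).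
Proof. by move=> [sF _ _]; exact: cint_smooth. Qed.

Lemma csmooth_coef F : csection F -> csmooth (coef n b F).
Proof. by move=> sF; exact/cint_smooth/cn. Qed.

Let cn_ey F g : csection F -> cint ez n F (g + ey) = d2%:~R * cint ez n F g.
Proof.
move=> sF; apply: cint_translate; first by apply: csmooth_continuous; case: sF.
by move=> h; exact: csection_ey.
Qed.

Lemma coef_lin a F G : csection F -> csection G ->
  coef n b (fun g => a * F g + G g) = fun g => a * coef n b F g + coef n b G g.
Proof.
move=> sF sG; rewrite /coef cint_lin; [|exact/csmooth_continuous/csection_smooth..].
by rewrite cint_lin//; exact/csmooth_continuous/cn.
Qed.

Lemma coef_scale a F : csection F -> coef n b (fun g => a * F g) = fun g => a * coef n b F g.
Proof.
move=> sF; rewrite /coef cintZ; last exact/csmooth_continuous/csection_smooth.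
by rewrite cintZ//; exact/csmooth_continuous/cn.
Qed.

Lemma coef_X F : csection F -> coef n b (cX F) = cop (pd 0) (coef n b F).
Proof.
move=> sF; rewrite /coef; have -> : cX F = cop (pd 0) F by [].
by rewrite (cint_pd 0 ey b (cn sF)) (cint_pd 0 ez n (csection_smooth sF)).
Qed.

Lemma coef_Z F : csection F -> coef n b (cZ F) = fun g => 'i%C * (2 * pi * n)%:C * coef n b F g.
Proof.
move=> sF; rewrite /coef /cZ.
have -> : cint ez n (cop (@fZ R) F) = fun g => 'i%C * (2 * pi * n)%:C * cint ez n F g.
  apply/funext => g; have := cint_parts sd3 (csection_smooth sF) (fun g => csection_ez g sF) Hn g.
  by rewrite mul1r.
by rewrite cintZ//; exact/csmooth_continuous/cn.
Qed.

(** Neither integration moves x, so [Y = d/dy + x d/dz] acts on the coefficient by the symbol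
    [b + n x] up to 2 pi i. *)
Lemma coef_Y F : csection F ->
  coef n b (cY F) = fun g => 'i%C * (2 * pi * (b + n * g 0 0))%:C * coef n b F g.
Proof.
move=> sF; have sF' := csection_smooth sF; rewrite /coef.
have -> : cY F = fun g => 1 * cop (pd 1) F g + (g 0 0)%:C * cop (@fZ R) F g.
  apply/funext => g; rewrite /cY /cop /fY /fZ mul1r.
  by apply: complexP => /=; ring.
have sD i := csmooth_pd i sF'.
have cx (G : V -> C) : ccontinuous G -> ccontinuous (fun g => (g 0 0)%:C * G g).
  move=> [c1 c2]; split.
    have -> : (fun g => Re ((g 0 0)%:C * G g)) = fun g : V => g 0 0 * Re (G g).
      by apply/funext => g; case: (G g) => x y /=; ring.
    by apply: continuous_mul; [exact: continuous_coord|].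
  have -> : (fun g => Im ((g 0 0)%:C * G g)) = fun g : V => g 0 0 * Im (G g).
    by apply/funext => g; case: (G g) => x y /=; ring.
  by apply: continuous_mul; [exact: continuous_coord|].
have cD i : ccontinuous (cop (pd i) F) := csmooth_continuous (sD i).
have ez0 : ez 0 0 = 0 by rewrite !mxE mulr0.
have ey0 : ey 0 0 = 0 by rewrite !mxE mulr0.
have sG := cn sF; have cG := csmooth_continuous sG.
have -> : cint ez n (fun g => 1 * cop (pd 1) F g + (g 0 0)%:C * cop (@fZ R) F g) =
    fun g => 1 * cop (pd 1) (cint ez n F) g +
             'i%C * (2 * pi * n)%:C * ((g 0 0)%:C * cint ez n F g).
  rewrite cint_lin//; last by apply: cx; exact: (cD 2%:R).
  have EZ g : cint ez n (cop (@fZ R) F) g = 'i%C * (2 * pi * n)%:C * cint ez n F g.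
    have := cint_parts sd3 sF' (fun g => csection_ez g sF) Hn g.
    by rewrite mul1r.
  apply/funext => g; rewrite (cint_pd 1 ez n sF') cint_mulx//; last exact: (cD 2%:R).
  rewrite EZ; move: (cint ez n _ g) (cint ez n F g) => x y; ring.
rewrite cint_lin; first last.
- have -> : (fun g : V => 'i%C * (2 * pi * n)%:C * ((g 0 0)%:C * cint ez n F g)) =
      fun g : V => (g 0 0)%:C * ('i%C * (2 * pi * n)%:C * cint ez n F g).
    by apply/funext => g; move: (cint ez n F g) => x; ring.
  exact: (cx _ (csmooth_continuous (csmoothZ _ sG))).
- exact: (csmooth_continuous (csmooth_pd 1 sG)).
rewrite cintZ; last exact: (cx _ cG).
rewrite cint_mulx//; apply/funext => g.
have := cint_parts sd2 sG (fun g => cn_ey g sF) Hb g.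
rewrite !mul1r => ->; move: (cint ey b _ g) => x.
by rewrite !(rmorphD, rmorphM) /=; ring.
Qed.

Lemma coef_bounded F : csection F ->
  exists K, forall g, `|Re (coef n b F g)| <= K /\ `|Im (coef n b F g)| <= K.
Proof.
move=> sF; have [K HK] := csection_bounded sF.
exists ((K + K) + (K + K)) => g; apply: cint_bounded; first exact/csmooth_continuous/cn.
- by move=> h; have [] := cint_bounded ez n (csmooth_continuous (csection_smooth sF))
    (fun g => proj1 (HK g)) (fun g => proj2 (HK g)) h.
- by move=> h; have [] := cint_bounded ez n (csmooth_continuous (csection_smooth sF))
    (fun g => proj1 (HK g)) (fun g => proj2 (HK g)) h.
Qed.

(** Translation by g(r m,0,0) shears z by [r m y]; under the central character n the shear becomes a
    shift of the y-frequency by [n r m]. *)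
Lemma coef_translate F (m : int) (x : R) : csection F ->
  coef n b F (hpt (x + r%:R * m%:~R) 0 0) =
  (d1 ^ m)%:~R * coef n (b + n * r%:R * m%:~R) F (hpt x 0 0).
Proof.
move=> sF; have sG := cn sF; have sF' := csection_smooth sF.
have G1 g : cint ez n F (hmul (lpt r m 0 0) g) = (d1 ^ m)%:~R * cint ez n F g.
  have <- := congr1 (fun u => u g) (cintZ ez n (d1 ^ m)%:~R (csmooth_continuous sF')).
  have FE h : F (hmul (lpt r m 0 0) h) = (d1 ^ m)%:~R * F h.
    by move/csectionP : sF => [_ ->]; rewrite !expr0z !mulr1.
  have P (t : R) : F (hmul (lpt r m 0 0) g + t *: ez) = (d1 ^ m)%:~R * F (g + t *: ez).
    rewrite -FE hmul_line; congr (F (_ + _ *: _)).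
    by apply/rowP => i; case_ord; mxsimp; ring.
  by rewrite /cint /J; congr ((_ + _) +i* (_ - _)); apply: eq_Rintegral => t _; rewrite P.
rewrite -[RHS](congr1 (fun u => u (hpt x 0 0)) (cintZ ey (b + n * r%:R * m%:~R) (d1 ^ m)%:~R (csmooth_continuous sG))).
apply: cint_twist; [exact: csmooth_continuous|exact/csmooth_continuous/csmoothZ|].
move=> t; rewrite -G1.
have -> : hmul (lpt r m 0 0) (hpt x 0 0 + t *: ey) =
    (hpt (x + r%:R * m%:~R) 0 0 + t *: ey) + (r%:R * m%:~R * t) *: ez.
  by apply/rowP => i; case_ord; mxsimp; ring.
rewrite (cint_shift sd3 sF' (fun g => csection_ez g sF) Hn) mulrA -cisD.
have -> : - (2 * pi * (n * r%:R * m%:~R) * t) + 2 * pi * n * (r%:R * m%:~R * t) = 0 by ring.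
by rewrite cis0 mul1r.
Qed.

Lemma coef_shift F (x y z : R) : csection F ->
  coef n b F (hpt x y z) = cis (2 * pi * b * y) * cis (2 * pi * n * z) * coef n b F (hpt x 0 0).
Proof.
move=> sF; have sG := cn sF.
have -> : hpt x y z = (hpt x 0 0 + z *: ez) + y *: ey.
  by apply/rowP => i; case_ord; mxsimp; ring.
have H1 := cint_shift sd2 sG (fun g => cn_ey g sF) Hb (hpt x 0 0 + z *: ez) y.
have H2 g := cint_shift sd3 (csection_smooth sF) (fun g => csection_ez g sF) Hn g z.
have H3 := cint_translate ey b (csmooth_continuous sG) H2 (hpt x 0 0).
rewrite H3 in H1.
rewrite mulrA in H1.
exact: H1.
Qed.

Lemma coef_cder F (c x : R) : csection F ->
  cder (fun t => coef n b F (hpt (t + c) 0 0)) (coef n b (cX F) (hpt (x + c) 0 0)) x.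
Proof.
move=> sF; have E (t : R) : hpt (t + c) 0 0 = hpt c 0 0 + t *: (1 *: delta_mx 0 0) :> V.
  by apply/rowP => i; case_ord; mxsimp; ring.
have -> : (fun t => coef n b F (hpt (t + c) 0 0)) =
    (fun t : R => coef n b F (hpt c 0 0 + t *: (1 *: delta_mx 0 0))).
  by apply/funext => t; rewrite E.
apply: (cder_eq (cder_line 0 (hpt c 0 0) 1 x (csmooth_coef sF))).
by rewrite mul1r -E coef_X.
Qed.

End Coefficient.

Lemma coef_vanish F : csection F ->
  (forall n b, cis (2 * pi * n) = d3%:~R :> C -> cis (2 * pi * b) = d2%:~R :> C ->
     forall x, coef n b F (hpt x 0 0) = 0) -> forall g, F g = 0.
Proof.
move=> sF H g; have sF' := csection_smooth sF.
have G0 n x y z : cis (2 * pi * n) = d3%:~R :> C -> cint ez n F (hpt x y z) = 0.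
  (* [cint_unique] evaluates at the midpoint of the path, so the base point is moved back by half a
     period. *)
  move=> Hn; have -> : hpt x y z = hpt x (y - 2^-1) z + 2^-1 *: ey.
    by apply/rowP => i; case_ord; mxsimp; ring.
  apply: (cint_unique sd2); first exact/csmooth_continuous/cint_smooth.
  move=> b Hb; apply: (etrans (coef_shift Hn Hb x (y - 2^-1) z sF)).
  by rewrite H// mulr0.
rewrite [g]hpt_eta; move: (g 0 0) (g 0 1) (g 0 2%:R) => x y z.
have -> : hpt x y z = hpt x y (z - 2^-1) + 2^-1 *: ez.
  by apply/rowP => i; case_ord; mxsimp; ring.
apply: (cint_unique sd3); first exact: csmooth_continuous.
by move=> n Hn; exact: G0.
Qed.

End Sections.

(** * The eigenvalue system on Fourier coefficients *)

Section Eigensystem.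
Local Open Scope complex_scope.
Context {R : realType}.
Local Notation V := 'rV[R]_3.
Local Notation C := R[i].
Implicit Types (F G P Q : V -> C) (g v : V).

(** On a coefficient of central character n = s tau, recentred at - b / n, these are the
    annihilation and creation operators [d/dx + w x] and [d/dx - w x] with w = 2 pi tau. *)
Definition low (s : R) F : V -> C := fun g => - (s%:C * 'i%C) * cY F g + cX F g.
Definition raise (s : R) F : V -> C := fun g => s%:C * 'i%C * cY F g + cX F g.

Definition pq_system (d T s : R) (mu : C) P Q := forall g,
  mu * P g = s%:C * ('i%C * (T^-1)%:C) * cZ P g - d%:C * 'i%C * raise s Q g /\
  mu * Q g = - (d%:C * 'i%C * low s P g) - s%:C * ('i%C * (T^-1)%:C) * cZ Q g.

Definition sgb (b : bool) : R := (-1) ^+ b.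

Definition halfspin (b : bool) (sigma : V -> 'cV[C]_2) : V -> C :=
  fun h => sigma h (if b then 1 else 0) 0.

(* Changing the sign of the central character exchanges the two components. *)
Lemma eigen_pq (b : bool) (d T : R) (lambda : C) (sigma : V -> 'cV[C]_2) :
  T != 0 -> smooth_spinor sigma ->
  (forall g, Defs.dirac d T sigma g = lambda *: sigma g) <->
  pq_system d T (sgb b) (lambda + (d ^+ 2 * T / 4)%:C) (halfspin b sigma) (halfspin (~~ b) sigma).
Proof.
move=> T0 ss; split=> H g; have E := eigenspinorE d lambda g T0 ss.
- have [E1 E2] := proj1 E (H g); rewrite /halfspin /sgb; case: b => /=.
    split; [rewrite E2|rewrite E1]; rewrite /raise /low expr1 rmorphN1; ring.
  split; [rewrite E1|rewrite E2]; rewrite /raise /low expr0; ring.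
- apply/E; move: (H g); rewrite /halfspin /sgb; case: (b) => /= -[H1 H2].
    rewrite H1 H2 /raise /low expr1 rmorphN1; split; ring.
  rewrite H1 H2 /raise /low expr0; split; ring.
Qed.

Section Classification.
Variables (r : nat) (eps : V -> int).
Hypotheses (r0 : (0 < r)%N) (Heps : spin_structure r eps).
Variables (d T : R) (mu : C) (sb : bool) (tau b : R).
Hypotheses (d0 : 0 < d) (T0 : 0 < T) (tau0 : 0 < tau).
Let s := sgb sb.
Let n := s * tau.
Hypotheses (Hn : cis (2 * pi * n) = (delta3 eps)%:~R :> C)
  (Hb : cis (2 * pi * b) = (delta2 eps)%:~R :> C).
Local Notation csec := (csection r eps).
Local Notation cf := (coef n b).

Let ss : s * s = 1. Proof. by rewrite /s /sgb -expr2 sqrr_sign. Qed.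
Let n0 : n != 0.
Proof. by rewrite /n mulf_neq0 ?(gt_eqF tau0)// /s /sgb signr_eq0. Qed.
Let ii : 'i%C * 'i%C = -1 :> C. Proof. by rewrite -expr2 sqr_i. Qed.
Let d0C : d%:C != 0 :> C.
Proof. by rewrite eq_complex /= eqxx andbT gt_eqF. Qed.

Lemma csection_cZ F : csec F -> csec (cZ F).
Proof.
move=> [[s1 s2] e1 e2]; split; first by split; exact: smooth_fZ.
  exact: equivariant_fZ.
exact: equivariant_fZ.
Qed.

Lemma csection_low F : csec F -> csec (low s F).
Proof. by move=> sF; apply: (csection_lin Heps); [exact: csection_cY|exact: csection_cX]. Qed.

Lemma csection_raise F : csec F -> csec (raise s F).
Proof. by move=> sF; apply: (csection_lin Heps); [exact: csection_cY|exact: csection_cX]. Qed.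

Lemma coef_low F (x : R) : csec F -> cf (low s F) (hpt (x - b / n) 0 0) =
  cf (cX F) (hpt (x - b / n) 0 0) + (2 * pi * tau * x)%:C * cf F (hpt (x - b / n) 0 0).
Proof.
move=> sF; rewrite /low (coef_lin n b _ (csection_cY sF) (csection_cX sF)).
rewrite (coef_Y Heps Hn Hb sF) [hpt _ _ _ _ _]mxE /=.
move: (cf F _) (cf (cX F) _) => A B.
have -> : b + n * (x - b / n) = n * x by field.
have -> : 2 * pi * (n * x) = s * (2 * pi * tau * x) by rewrite /n; ring.
move: (2 * pi * tau * x) => y.
transitivity (B - ('i%C * 'i%C) * ((s * s)%:C * y%:C) * A); last by rewrite ii ss; ring.
by rewrite !rmorphM; ring.
Qed.

Lemma coef_raise F (x : R) : csec F -> cf (raise s F) (hpt (x - b / n) 0 0) =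
  cf (cX F) (hpt (x - b / n) 0 0) - (2 * pi * tau * x)%:C * cf F (hpt (x - b / n) 0 0).
Proof.
move=> sF; rewrite /raise (coef_lin n b _ (csection_cY sF) (csection_cX sF)).
rewrite (coef_Y Heps Hn Hb sF) [hpt _ _ _ _ _]mxE /=.
move: (cf F _) (cf (cX F) _) => A B.
have -> : b + n * (x - b / n) = n * x by field.
have -> : 2 * pi * (n * x) = s * (2 * pi * tau * x) by rewrite /n; ring.
move: (2 * pi * tau * x) => y.
transitivity (B + ('i%C * 'i%C) * ((s * s)%:C * y%:C) * A); last by rewrite ii ss; ring.
by rewrite !rmorphM; ring.
Qed.

Lemma cder_coef_low F (x : R) : csec F ->
  cder (fun t => cf F (hpt (t - b / n) 0 0))
    (cf (low s F) (hpt (x - b / n) 0 0) - (2 * pi * tau * x)%:C * cf F (hpt (x - b / n) 0 0)) x.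
Proof.
move=> sF; apply: (cder_eq (coef_cder n b (- (b / n)) x sF)).
by rewrite (coef_low x sF) addrK.
Qed.

Let nu : C := (2 * pi * tau / T)%:C.

Lemma coef_pq P Q : csec P -> csec Q -> pq_system d T s mu P Q ->
  forall g, cf (raise s Q) g = 'i%C / d%:C * (mu + nu) * cf P g /\
            cf (low s P) g = 'i%C / d%:C * (mu - nu) * cf Q g.
Proof.
move=> sP sQ H g.
have sZP := csection_cZ sP; have sZQ := csection_cZ sQ.
have sR := csection_raise sQ; have sL := csection_low sP.
have i0 : d%:C * 'i%C != 0 :> C by rewrite mulf_neq0// eq_complex /= oner_eq0 andbF.
have snu : s%:C * ('i%C * (T^-1)%:C) * ('i%C * (2 * pi * n)%:C) = - nu.
  transitivity (('i%C * 'i%C) * ((s * s)%:C * ((2 * pi * tau)%:C * (T^-1)%:C)) : C).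
    by rewrite /n !rmorphM; ring.
  by rewrite ii ss /nu !rmorphM /=; ring.
have di : 'i%C / d%:C = - (d%:C * 'i%C)^-1 :> C.
  apply: (mulIf i0); rewrite mulNr mulVf// -mulrA mulKf ?ii// .
split.
- have E : (fun g => mu * P g) = fun g => s%:C * ('i%C * (T^-1)%:C) * cZ P g +
      (fun g => - (d%:C * 'i%C) * raise s Q g) g.
    by apply/funext => h; rewrite (proj1 (H h)) mulNr.
  have := congr1 (fun F => cf F g) E.
  have sR' : csec (fun g => - (d%:C * 'i%C) * raise s Q g).
    have := csection_lin Heps (- (d%:C * 'i%C) - 1) sR sR.
    by under eq_fun do rewrite mulrBl mul1r subrK.
  rewrite (coef_scale n b _ sP) (coef_lin n b _ sZP sR') (coef_scale n b _ sR) (coef_Z Heps b Hn sP).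
  move: (cf P g) (cf (raise s Q) g) => A B; rewrite mulrA snu => EE.
  apply: (mulfI i0); rewrite di mulrA mulrA mulrN mulfV// mulN1r.
  apply: (can_inj opprK); rewrite mulNr opprK mulrDl EE; ring.
- have E : (fun g => mu * Q g) = fun g => - (s%:C * ('i%C * (T^-1)%:C)) * cZ Q g +
      (fun g => - (d%:C * 'i%C) * low s P g) g.
    by apply/funext => h; rewrite (proj2 (H h)); ring.
  have := congr1 (fun F => cf F g) E.
  have sL' : csec (fun g => - (d%:C * 'i%C) * low s P g).
    have := csection_lin Heps (- (d%:C * 'i%C) - 1) sL sL.
    by under eq_fun do rewrite mulrBl mul1r subrK.
  rewrite (coef_scale n b _ sQ) (coef_lin n b _ sZQ sL') (coef_scale n b _ sL) (coef_Z Heps b Hn sQ).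
  move: (cf Q g) (cf (low s P) g) => A B; rewrite mulrA mulNr snu opprK => EE.
  apply: (mulfI i0); rewrite di mulrA mulrA mulrN mulfV// mulN1r.
  apply: (can_inj opprK); rewrite mulNr opprK mulrBl EE; ring.
Qed.

(** Each iterate of [low s] on [Q] is again an equivariant section, so its coefficients are bounded;
    this supplies the boundedness hypothesis of the ladder. Recentring at - b / n turns [b + n x]
    into [n x]. *)
Theorem coef_classification P Q : csec P -> csec Q -> pq_system d T s mu P Q ->
  (forall x, cf P (hpt x 0 0) = 0 /\ cf Q (hpt x 0 0) = 0) \/
  exists k, [/\ mu ^+ 2 = nu ^+ 2 + (2 * (2 * pi * tau) * k%:R * d ^+ 2)%:C,
    k = 0%N -> mu = - nu &
    exists c, forall x,
      cf P (hpt (x - b / n) 0 0) = c * (pgauss (2 * pi * tau) (hpol (2 * pi * tau) k) x)%:C /\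
      cf Q (hpt (x - b / n) 0 0) = c * ('i%C / d%:C * (mu + nu)) *
        (pgauss (2 * pi * tau) (hprev (2 * pi * tau) k) x)%:C].
Proof.
move=> sP sQ H; have E := coef_pq sP sQ H.
have w0 : 0 < 2 * pi * tau by rewrite !mulr_gt0// pi_gt0.
have sk k : csec (iter k (low s) Q) by elim: k => [//|k IH]; exact: csection_low.
pose v k x := cf (iter k (low s) Q) (hpt (x - b / n) 0 0).
have [| | | | |H0|H0] := @ladder_classification R (2 * pi * tau) d mu nu
  (fun x => cf P (hpt (x - b / n) 0 0)) (fun x => cf (low s P) (hpt (x - b / n) 0 0)) v w0 d0.
- by move=> x; exact: cder_coef_low.
- by move=> x; exact: (proj2 (E _)).
- by move=> k x; exact: cder_coef_low.
- move=> x; rewrite -(proj1 (E _)) /v /= (coef_raise x sQ) (coef_low x sQ).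
  have -> : (2 * (2 * pi * tau * x))%:C = 2 * (2 * pi * tau * x)%:C :> C.
    by rewrite rmorphM rmorph_nat.
  move: (cf Q _) (cf (cX Q) _) => A B; ring.
- by move=> k; have [K HK] := coef_bounded r0 Heps n b (sk k); exists K => x; exact: HK.
- by left => x; have := H0 (x + b / n); rewrite /v /= addrK.
- by right; have [k [? ? [c Hc]]] := H0; exists k; split=> //; exists c.
Qed.

Section ThetaEigen.
Variables (Nr : int) (k : nat).
Hypothesis HN : n * r%:R = Nr%:~R.
Let w := 2 * pi * tau.
Hypothesis Hmu : mu ^+ 2 = nu ^+ 2 + (2 * w * k%:R * d ^+ 2)%:C.
Hypothesis Hk0 : k = 0%N -> mu = - nu.

Let w0 : 0 < w. Proof. by rewrite /w !mulr_gt0// pi_gt0. Qed.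
Let sd1 := delta1_sign Heps.
Let sd2 := delta2_sign Heps.
Let sd3 := delta3_sign Heps.
Local Notation Th := (theta w n b r (delta1 r eps)).

Lemma csection_theta p : csec (Th p).
Proof.
apply/(csectionP Heps); split; first exact: csmooth_theta.
by move=> x y z g; rewrite (@theta_lattice R w n b r _ (delta2 eps) (delta3 eps) Nr).
Qed.

Let fam := theta_family_bisum b w0 n0 r0 sd1.

Let wn : s%:C * 'i%C * ('i%C * (2 * pi * n)%:C) = - w%:C :> C.
Proof.
transitivity (('i%C * 'i%C) * ((s * s)%:C * w%:C) : C).
  by rewrite /n /w !rmorphM; ring.
by rewrite ii ss; ring.
Qed.

Lemma theta_low p : low s (Th p) = Th p^`().
Proof.
apply/funext => g; rewrite /low [cX _](ctheta_X fam p) [cY _](ctheta_Y fam p).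
have -> : dgauss w p = (- w) *: ('X * p) + p^`() by rewrite /dgauss addrC scaleNr.
rewrite (ctheta_lin fam) mulrA mulNr wn opprK rmorphN.
by rewrite /theta; move: (ctheta _ ('X * p) g) (ctheta _ p^`() g) => A B; ring.
Qed.

Lemma theta_raise p : raise s (Th p) = Th (p^`() - (2 * w) *: ('X * p)).
Proof.
apply/funext => g; rewrite /raise [cX _](ctheta_X fam p) [cY _](ctheta_Y fam p).
have -> : dgauss w p = (- w) *: ('X * p) + p^`() by rewrite /dgauss addrC scaleNr.
have -> : p^`() - (2 * w) *: ('X * p) = (- (2 * w)) *: ('X * p) + p^`() by rewrite addrC scaleNr.
have tw : (2 * w)%:C = 2 * w%:C :> C by rewrite rmorphM rmorph_nat.
have nC (x : R) : (- x)%:C = - x%:C :> C by rewrite rmorphN.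
rewrite /theta !(ctheta_lin fam) mulrA wn !nC tw.
by move: (ctheta _ ('X * p) g) (ctheta _ p^`() g) => A B; ring.
Qed.

(** The pair of adjacent degrees found by [coef_classification], with constant c = 1, summed over
    the linked frequencies. *)
Definition thetaP : V -> C := Th (hpol w k).
Definition thetaQ : V -> C := fun g => 'i%C / d%:C * (mu + nu) * Th (hprev w k) g.

Lemma csectionZ a F : csec F -> csec (fun g => a * F g).
Proof.
move=> sF; have := csection_lin Heps (a - 1) sF sF.
by under eq_fun do rewrite mulrBl mul1r subrK.
Qed.

Lemma csection_thetaP : csec thetaP. Proof. exact: csection_theta. Qed.
Lemma csection_thetaQ : csec thetaQ. Proof. exact/csectionZ/csection_theta. Qed.

Lemma theta_pq : pq_system d T s mu thetaP thetaQ.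
Proof.
move=> g.
have i0 : d%:C * 'i%C != 0 :> C by rewrite mulf_neq0// eq_complex /= oner_eq0 andbF.
have snu : s%:C * ('i%C * (T^-1)%:C) * ('i%C * (2 * pi * n)%:C) = - nu.
  transitivity (('i%C * 'i%C) * ((s * s)%:C * ((2 * pi * tau)%:C * (T^-1)%:C)) : C).
    by rewrite /n !rmorphM; ring.
  by rewrite ii ss /nu !rmorphM /=; ring.
have dii : d%:C * 'i%C * ('i%C / d%:C) = -1 :> C.
  by rewrite mulrACA divff// mulr1 || (rewrite mulrA -[X in X / _]mulrA ii mulrN1 mulNr divff).
have sT p := csection_smooth (csection_theta p).
have cZP p h : cZ (Th p) h = 'i%C * (2 * pi * n)%:C * Th p h.
  by rewrite [cZ _](ctheta_Z fam p).
have lowP : low s thetaP g = - (2 * w * k%:R)%:C * Th (hprev w k) g.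
  rewrite /thetaP theta_low hprev_deriv -[X in Th X]addr0 /theta (ctheta_lin fam) rmorphN.
  have -> : ctheta (fun j p s => bisum (tterm w n b r (delta1 r eps) j p s)) 0 g = 0.
    have := ctheta_lin fam (-1) (0 : {poly R}) 0 g.
    by rewrite scaleN1r oppr0 addr0 rmorphN1 mulN1r addNr => ->.
  by rewrite addr0.
set c2 := 'i%C / d%:C * (mu + nu).
have raiseQ : raise s thetaQ g = c2 * raise s (Th (hprev w k)) g.
  rewrite /raise /thetaQ /cX /cY (copZ _ (@op_linear_fX R) (sT _)) (copZ _ (@op_linear_fY R) (sT _)).
  by rewrite -/c2; move: (cop _ _ g) (cop _ _ g) => A B; ring.
have ZQ : cZ thetaQ g = c2 * ('i%C * (2 * pi * n)%:C * Th (hprev w k) g).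
  by rewrite /thetaQ /cZ (copZ _ (@op_linear_fZ R) (sT _)) -cZP.
(* Raising reproduces the recursion of [hpol]; at k = 0 the identity holds only because [mu = - nu]
   makes [c2] vanish. *)
have rQ : c2 * raise s (Th (hprev w k)) g = c2 * thetaP g.
  rewrite theta_raise /thetaP; case: (k) Hk0 => [|k'] Hk'; last by [].
  by rewrite /c2 (Hk' erefl) addNr mulr0 !mul0r.
rewrite raiseQ ZQ rQ lowP cZP; split.
- rewrite mulrA snu /c2 /thetaP; move: (Th (hpol w k) g) => A.
  transitivity (- nu * A - (d%:C * 'i%C * ('i%C / d%:C)) * ((mu + nu) * A)).
    by rewrite dii mulN1r opprK mulrDl addrCA mulNr addNr addr0.
  move: ('i%C / d%:C) (d%:C * 'i%C) nu mu => a e x y. ring.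

- rewrite {1}/thetaQ -/c2; move: (Th _ g) => A.
  have -> : s%:C * ('i%C * (T^-1)%:C) * (c2 * ('i%C * (2 * pi * n)%:C * A)) =
      (s%:C * ('i%C * (T^-1)%:C) * ('i%C * (2 * pi * n)%:C)) * (c2 * A) by ring.
  rewrite snu; apply: (mulfI i0).
  (* The quantization condition in factored form matches the product of the two coupling
     constants. *)
  have key : (2 * w * k%:R)%:C * (d%:C * d%:C) = (mu - nu) * (mu + nu) :> C.
    by rewrite -expr2 -rmorphXn -rmorphM -[LHS](addKr (nu ^+ 2)) -Hmu; ring.
  have -> : d%:C * 'i%C * (mu * (c2 * A)) = (d%:C * 'i%C * ('i%C / d%:C)) * (mu * (mu + nu) * A).
    by rewrite /c2; ring.
  have -> : d%:C * 'i%C * (- (d%:C * 'i%C * (- (2 * w * k%:R)%:C * A)) - - nu * (c2 * A)) =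
    ('i%C * 'i%C) * ((2 * w * k%:R)%:C * (d%:C * d%:C)) * A +
    (d%:C * 'i%C * ('i%C / d%:C)) * (nu * (mu + nu) * A) by rewrite /c2; ring.
  by rewrite key dii ii; ring.
Qed.

End ThetaEigen.

End Classification.

End Eigensystem.

(** * Exponentials and coefficients for the trivial central character *)

Section Torus.
Local Open Scope complex_scope.
Context {R : realType}.
Local Notation V := 'rV[R]_3.
Local Notation C := R[i].
Implicit Types (F G P Q : V -> C) (g v : V).

Section Exponential.
Variables a b : R.

Let phase g : R := 2 * pi * (a * g 0 0 + b * g 0 1).

Definition texp g : C := cis (phase g).

Let is_derive_phase_cos (A s : R) g v : is_derive g v (fun h => A * cos (phase h + s))
  (A * (2 * pi * (a * v 0 0 + b * v 0 1)) * cos (phase g + (s + pi / 2))).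
Proof.
have h1 := is_derive_scale a (is_derive_coord g v 0).
have h2 := is_derive_scale b (is_derive_coord g v 1).
have h3 := is_deriveD (is_derive_scale (2 * pi) (is_deriveD h1 h2)) (is_derive_cst s g v).
have h := @is_derive_comp_dir R (@cos R) (fun h => phase h + s) g v _ _ h3 (is_derive_cos _).
apply: (is_derive_eq (is_derive_scale A h)).
by rewrite addrA cosDpihalf addr0; ring.
Qed.

Let smooth_phase_cos A s : smooth (fun g => A * cos (phase g + s)).
Proof.
pose S (f : V -> R) := exists A s, f = fun g => A * cos (phase g + s).
apply: (@smooth_coind R S); last by exists A, s.
move=> _ [{}A [{}s ->]].
have H (i : 'I_3) g := is_derive_phase_cos A s g (delta_mx 0 i).
split.
  apply: (@continuous_mul R); first exact: continuous_cst.
  move=> g; apply: (@continuous_comp _ _ _ (fun g : V => phase g + s) cos); last exact: continuous_cos.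
  apply: continuous_add; last exact: continuous_cst.
  apply: continuous_mul; first exact: continuous_cst.
  apply: continuous_add; apply: continuous_mul; (exact: continuous_cst || exact: continuous_coord).
move=> i; split; first by move=> g; case: (H i g).
by do 2 eexists; apply: pdE => g; exact: H.
Qed.

Let texp_cos : (fun g => complex.Re (texp g)) = fun g => 1 * cos (phase g + 0).
Proof. by apply/funext => g; rewrite mul1r addr0. Qed.

Let texp_sin : (fun g => complex.Im (texp g)) = fun g => 1 * cos (phase g + - (pi / 2)).
Proof.
apply/funext => g; rewrite mul1r /texp /cis /=.
rewrite -[sin _]opprK -cosDpihalf.
have -> : phase g + pi / 2 = phase g + - (pi / 2) + pi by field.
by rewrite cos_addpi opprK.
Qed.

Lemma csmooth_texp : csmooth texp.
Proof. by split; rewrite ?texp_cos ?texp_sin; exact: smooth_phase_cos. Qed.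

Lemma texp_pd i : cop (pd i) texp = fun g =>
  'i%C * (2 * pi * (a * (delta_mx 0 i : V) 0 0 + b * (delta_mx 0 i : V) 0 1))%:C * texp g.
Proof.
apply/funext => g; rewrite /cop texp_cos texp_sin.
rewrite (pdE (fun x => is_derive_phase_cos 1 0 x (delta_mx 0 i))).
rewrite (pdE (fun x => is_derive_phase_cos 1 (- (pi / 2)) x (delta_mx 0 i))).
rewrite add0r cosDpihalf addNr addr0 /texp /cis.
by apply: complexP => /=; ring.
Qed.

Lemma texp_X : cX texp = fun g => 'i%C * (2 * pi * a)%:C * texp g.
Proof. by rewrite [cX _]texp_pd; apply/funext => g; rewrite !mxE /= mulr1 mulr0 addr0. Qed.

Lemma texp_Z : cZ texp = fun g => 0.
Proof.
by rewrite [cZ _]texp_pd; apply/funext => g; rewrite !mxE /= !mulr0 addr0 mulr0 rmorph0 mulr0 mul0r.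
Qed.

Lemma texp_Y : cY texp = fun g => 'i%C * (2 * pi * b)%:C * texp g.
Proof.
have -> : cY texp = fun g => 1 * cop (pd 1) texp g + (g 0 0)%:C * cZ texp g.
  apply/funext => g; rewrite mul1r /cZ /cY /cop /fY /fZ.
  by move: (pd _ _ g) (pd _ _ g) (pd _ _ g) (pd _ _ g) => x y z t; apply: complexP => /=; ring.
apply/funext => g; rewrite texp_Z mulr0 addr0 mul1r texp_pd.
by rewrite !mxE /= mulr0 add0r mulr1.
Qed.

Lemma texp0 : texp 0 = 1.
Proof. by rewrite /texp /phase !mxE !mulr0 addr0 mulr0 cis0. Qed.

End Exponential.
End Torus.

Section Torus.
Local Open Scope complex_scope.
Context {R : realType}.
Local Notation V := 'rV[R]_3.
Local Notation C := R[i].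
Implicit Types (F G P Q : V -> C) (g v : V).
Local Notation ex r := (r%:R *: delta_mx 0 0 : V).

Variables (r : nat) (eps : V -> int).
Hypotheses (r0 : (0 < r)%N) (Heps : spin_structure r eps) (H3 : delta3 eps = 1).
Local Notation csec := (csection r eps).
Let sd1 := delta1_sign Heps.
Let sd2 := delta2_sign Heps.
Let C0 : cis (2 * pi * 0) = (delta3 eps)%:~R :> C.
Proof. by rewrite mulr0 cis0 H3. Qed.

Section Coefficient.
Variables a b : R.
Hypotheses (Ha : cis (2 * pi * (r%:R * a)) = (delta1 r eps)%:~R :> C)
  (Hb : cis (2 * pi * b) = (delta2 eps)%:~R :> C).

Lemma csection_texp : csec (texp a b).
Proof.
apply/(csectionP Heps); split; first exact: csmooth_texp.
move=> m n p g; rewrite H3 exp1rz mulr1 intrM.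
rewrite -(cis_sign_int m sd1 Ha) -(cis_sign_int n sd2 Hb) -!cisD /texp; congr cis.
rewrite /lpt [g]hpt_eta; move: (g 0 0) (g 0 1) (g 0 2%:R) => x y z.
by rewrite hmulE; mxsimp; ring.
Qed.

(** The path in x has length r while its parameter runs over [0, 1], so frequency a in x is
    frequency [r a] in the parameter. *)
Definition tcoef F : C := cint (ex r) (r%:R * a) (coef 0 b F) 0.

Lemma tcoef_lin c F G : csec F -> csec G ->
  tcoef (fun g => c * F g + G g) = c * tcoef F + tcoef G.
Proof.
move=> sF sG; rewrite /tcoef (coef_lin 0 b c sF sG).
exact: (congr1 (fun u => u 0) (cint_lin _ _ c (csmooth_continuous (csmooth_coef 0 b sF))
  (csmooth_continuous (csmooth_coef 0 b sG)))).
Qed.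

(** For n = 0 the frequency shift of [coef_translate] disappears, so the coefficient is periodic in
    x up to delta1 and can be expanded once more. *)
Lemma coef0_translate F g : csec F ->
  coef 0 b F (g + ex r) = (delta1 r eps)%:~R * coef 0 b F g.
Proof.
move=> sF; rewrite [g]hpt_eta; move: (g 0 0) (g 0 1) (g 0 2%:R) => x y z.
have -> : hpt x y z + ex r = hpt (x + r%:R * 1%:~R) y z.
  by apply/rowP => i; case_ord; mxsimp; ring.
have E1 := coef_shift Heps C0 Hb (x + r%:R * 1%:~R) y z sF.
have E2 := coef_shift Heps C0 Hb x y z sF.
have := coef_translate Heps b C0 1 x sF.
rewrite expr1z !mul0r addr0 => E3; rewrite E3 in E1; rewrite E1 E2.
by rewrite mulrCA.
Qed.

Lemma tcoef_X F : csec F -> tcoef (cX F) = 'i%C * (2 * pi * a)%:C * tcoef F.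
Proof.
move=> sF; rewrite /tcoef (coef_X 0 b sF).
have := cint_parts sd1 (csmooth_coef 0 b sF) (fun g => coef0_translate g sF) Ha 0.
have rC : r%:R%:C != 0 :> C by rewrite eq_complex /= eqxx andbT pnatr_eq0 -lt0n.
move: (cint _ _ _ _) (cint _ _ _ _) => A B H; apply: (mulfI rC); rewrite H.
by rewrite !rmorphM; ring.
Qed.

Lemma tcoef_scale c F : csec F -> tcoef (fun g => c * F g) = c * tcoef F.
Proof.
move=> sF; rewrite /tcoef (coef_scale 0 b c sF).
exact: (congr1 (fun u => u 0) (cintZ _ _ c (csmooth_continuous (csmooth_coef 0 b sF)))).
Qed.

Lemma tcoef_Y F : csec F -> tcoef (cY F) = 'i%C * (2 * pi * b)%:C * tcoef F.
Proof.
move=> sF; rewrite /tcoef (coef_Y Heps C0 Hb sF).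
under eq_fun do rewrite mul0r addr0.
exact: (congr1 (fun u => u 0) (cintZ _ _ _ (csmooth_continuous (csmooth_coef 0 b sF)))).
Qed.

Lemma tcoef_Z F : csec F -> tcoef (cZ F) = 0.
Proof.
move=> sF; rewrite /tcoef (coef_Z Heps b C0 sF) mulr0 rmorph0 mulr0.
rewrite (congr1 (fun u => u 0) (cintZ _ _ 0 (csmooth_continuous (csmooth_coef 0 b sF)))).
by rewrite mul0r.
Qed.

Lemma tcoef_coef_eq0 F : csec F -> tcoef F = 0 ->
  forall x, cint (ex r) (r%:R * a) (coef 0 b F) (hpt x 0 0) = 0.
Proof.
move=> sF F0 x; have rR : r%:R != 0 :> R by rewrite pnatr_eq0 -lt0n.
have -> : hpt x 0 0 = 0 + (x / r%:R) *: ex r.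
  by apply/rowP => i; case_ord; mxsimp; field.
rewrite (cint_shift sd1 (csmooth_coef 0 b sF) (fun g => coef0_translate g sF) Ha).
by rewrite -/(tcoef F) F0 mulr0.
Qed.

End Coefficient.

Lemma tcoef_texp a b a' b' :
  cis (2 * pi * (r%:R * a)) = (delta1 r eps)%:~R :> C ->
  cis (2 * pi * b) = (delta2 eps)%:~R :> C ->
  cis (2 * pi * (r%:R * a')) = (delta1 r eps)%:~R :> C ->
  cis (2 * pi * b') = (delta2 eps)%:~R :> C ->
  tcoef a b (texp a' b') = ((a == a') && (b == b'))%:R.
Proof.
move=> Ha Hb Ha' Hb'; have sm := csmooth_texp a' b'.
have E1 : cint (1 *: delta_mx 0 2%:R) 0 (texp a' b') = texp a' b'.
  apply/funext => g; rewrite (cint_exp (chi := 1) (b' := 0) _ sm)//.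
  - by rewrite eqxx mul1r.
  - by left.
  - move=> h; rewrite -/(fZ) [cop _ _ _](congr1 (fun u => u h) (texp_Z a' b')).
    by rewrite !mulr0 mul0r.
  - by rewrite mulr0 cis0.
  - by rewrite mulr0 cis0.
have E2 : cint (1 *: delta_mx 0 1) b (texp a' b') = fun g => (b == b')%:R * texp a' b' g.
  apply/funext => g; rewrite (cint_exp sd2 (b' := b') sm)// => h.
  by rewrite texp_pd !mxE /= mulr0 add0r mulr1 mul1r.
rewrite /tcoef /coef E1 E2.
rewrite (congr1 (fun u => u 0) (cintZ _ _ _ (csmooth_continuous sm))).
rewrite (cint_exp sd1 (b' := r%:R * a') sm)//; last first.
  by move=> h; rewrite texp_pd !mxE /= mulr0 addr0 mulr1 !rmorphM; ring.
rewrite texp0 mulr1 -natrM mulnb andbC; congr ((_ && _)%:R).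
by apply/eqP/eqP => [/mulfI->//|->//]; rewrite pnatr_eq0 -lt0n.
Qed.

Lemma coef0_eq0 F b : csec F -> cis (2 * pi * b) = (delta2 eps)%:~R :> C ->
  (forall a, cis (2 * pi * (r%:R * a)) = (delta1 r eps)%:~R :> C -> tcoef a b F = 0) ->
  forall x, coef 0 b F (hpt x 0 0) = 0.
Proof.
move=> sF Hb H x; have rR : r%:R != 0 :> R by rewrite pnatr_eq0 -lt0n.
have -> : hpt x 0 0 = hpt (x - r%:R / 2) 0 0 + 2^-1 *: ex r.
  by apply/rowP => i; case_ord; mxsimp; field.
apply: (cint_unique sd1); first exact: (csmooth_continuous (csmooth_coef 0 b sF)).
move=> a' Ha'; have E : a' = r%:R * (a' / r%:R) by field.
by rewrite E in Ha' *; apply: tcoef_coef_eq0 => //; exact: H.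
Qed.

End Torus.

(** * The eigenspaces *)

Section DualBasis.
Local Open Scope complex_scope.
Context {R : realType}.
Local Notation V := 'rV[R]_3.
Local Notation C := R[i].

(** Functionals that form a diagonal pairing with the [e i] give independence. Subtracting from [f]
    the combination with coefficients [l i f / l i (e i)] lands in their common kernel, which is
    trivial on [E], so the [e i] span. *)
Lemma dual_has_dim (E : set (V -> 'cV[C]_2)) (I : finType)
    (e : I -> V -> 'cV[C]_2) (l : I -> (V -> 'cV[C]_2) -> C) :
  E (fun=> 0) -> (forall a f f', E f -> E f' -> E (fun g => a *: f g + f' g)) ->
  (forall i a f f', E f -> E f' -> l i (fun g => a *: f g + f' g) = a * l i f + l i f') ->
  (forall i, E (e i)) -> (forall i j, i != j -> l i (e j) = 0) -> (forall i, l i (e i) != 0) ->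
  (forall f, E f -> (forall i, l i f = 0) -> forall g, f g = 0) ->
  has_dim E (#|I|%:R)%:E.
Proof.
move=> E0 Elin llin Ee lij lii ker.
have l0 i : l i (fun=> 0) = 0.
  have := llin i (-1) _ _ E0 E0; rewrite mulN1r addNr => <-; congr (l i).
  by apply/funext => g; rewrite scaler0 addr0.
have Esum (s : seq I) (c : I -> C) : E (fun g => \sum_(i <- s) c i *: e i g) /\
    forall j, l j (fun g => \sum_(i <- s) c i *: e i g) = \sum_(i <- s) c i * l j (e i).
  elim: s => [|i s [IH1 IH2]].
    under eq_fun do rewrite big_nil; split=> // j; by rewrite big_nil l0.
  under eq_fun do rewrite big_cons; split=> [|j]; first exact: Elin.
  by rewrite llin// IH2 big_cons.
have lsum (c : I -> C) j : l j (fun g => \sum_i c i *: e i g) = c j * l j (e j).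
  rewrite (proj2 (Esum _ c)) (bigD1 j)//= big1 ?addr0// => i ij.
  by rewrite lij ?mulr0// eq_sym.
have enum_sum (A : zmodType) (F : I -> A) : \sum_(i < #|I|) F (enum_val i) = \sum_i F i.
  by rewrite (reindex (@enum_val I I))//; exact/onW_bij/enum_val_bij.
exists #|I|, (fun i => e (enum_val i)); split=> [//|c Hc i|f].
- pose c' (j : I) := c (enum_rank j).
  have cE k : c k = c' (enum_val k) by rewrite /c' enum_valK.
  have E1 : (fun g => \sum_i c' i *: e i g) = fun=> 0.
    apply/funext => g; rewrite -(enum_sum _ (fun i => c' i *: e i g)) -[RHS](Hc g).
    by apply: eq_bigr => k _; rewrite cE.
  have := lsum c' (enum_val i); rewrite E1 l0 cE => /esym/eqP.
  by rewrite mulf_eq0 (negbTE (lii _)) orbF => /eqP.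
- split=> [Ef|[c Hc]]; last first.
    pose c' (j : I) := c (enum_rank j).
    have -> : f = fun g => \sum_i c' i *: e i g.
      apply/funext => g; rewrite Hc -(enum_sum _ (fun i => c' i *: e i g)).
      by apply: eq_bigr => k _; rewrite /c' enum_valK.
    exact: (proj1 (Esum _ c')).
  pose c i := l i f / l i (e i).
  have [Es _] := Esum (index_enum I) c.
  exists (fun i => c (enum_val i)) => g; rewrite (enum_sum _ (fun i => c i *: e i g)).
  apply/eqP; rewrite -subr_eq0 addrC -scaleN1r; apply/eqP.
  apply: (ker (fun g => -1 *: (\sum_i c i *: e i g) + f g)); first exact: Elin.
  by move=> i; rewrite llin// lsum /c divfK// mulN1r addNr.
Qed.

End DualBasis.

(** * Eigenspaces as linear spaces of pairs of sections *)

Section Eigenspace.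
Local Open Scope complex_scope.
Context {R : realType}.
Local Notation V := 'rV[R]_3.
Local Notation C := R[i].
Implicit Types (F G P Q : V -> C) (g v : V) (sigma : V -> 'cV[C]_2).
Variables (r : nat) (eps : V -> int).
Hypotheses (r0 : (0 < r)%N) (Heps : spin_structure r eps).
Variables (d T : R) (lambda : C).
Hypotheses (d0 : 0 < d) (T0 : 0 < T).
Local Notation csec := (csection r eps).
Let mu : C := lambda + (d ^+ 2 * T / 4)%:C.
Local Notation E := (eigenspinors r d T eps lambda).

Definition spinor (b : bool) P Q : V -> 'cV[C]_2 :=
  fun g => if b then cvec (Q g) (P g) else cvec (P g) (Q g).

Lemma halfspin_spinor b P Q : halfspin b (spinor b P Q) = P.
Proof. by apply/funext => g; rewrite /halfspin /spinor; case: b; rewrite mxE. Qed.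

Lemma halfspin_spinorN b P Q : halfspin (~~ b) (spinor b P Q) = Q.
Proof. by apply/funext => g; rewrite /halfspin /spinor; case: b; rewrite mxE. Qed.

Lemma halfspin_eq0 b sigma g : halfspin b sigma g = 0 -> halfspin (~~ b) sigma g = 0 -> sigma g = 0.
Proof.
move=> h1 h2; rewrite [sigma g]cvec_eta; move: h1 h2; rewrite /halfspin.
by case: b => /= -> ->; apply/colP => k; rewrite !mxE; case: k => -[|[|//]].
Qed.

Lemma spinor_fieldE b sigma :
  spinor_field r eps sigma <-> csec (halfspin b sigma) /\ csec (halfspin (~~ b) sigma).
Proof.
suff H : spinor_field r eps sigma <-> csec (halfspin false sigma) /\ csec (halfspin true sigma).
  by rewrite H; case: b => /=; split=> -[].
have o2 (k : 'I_2) : k = if k == 1 then 1 else 0.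
  by apply: val_inj; case: k => -[|[|//]].
split=> [[ss es]|[s1 s2]].
  suff sk k : csec (fun h => sigma h k 0) by split; exact: sk.
  apply/(csectionP Heps); split; first exact: ss.
  move=> a b' c g; rewrite es; last exact: lattice_lpt.
  by rewrite mxE (spin_structureE Heps).
have sk k : csec (fun h => sigma h k 0) by rewrite (o2 k); case: eqP.
split=> [k|g0 g [a [b' [c ->]]]]; first exact: csection_smooth (sk k).
apply/colP => k; rewrite -/(lpt r a b' c) mxE (spin_structureE Heps).
have [_ H] := proj1 (csectionP Heps _) (sk k); exact: H.
Qed.

Lemma eigenP b sigma : E sigma <-> [/\ csec (halfspin b sigma), csec (halfspin (~~ b) sigma) &
  pq_system d T (sgb b) mu (halfspin b sigma) (halfspin (~~ b) sigma)].
Proof.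
have T1 : T != 0 by rewrite gt_eqF.
split=> [[sf ev]|[s1 s2 H]].
  have [s1 s2] := proj1 (spinor_fieldE b sigma) sf; split=> //.
  by apply/(eigen_pq b d lambda T1) => //; case: sf.
have sf : spinor_field r eps sigma by apply/(spinor_fieldE b).
by split=> //; apply/(eigen_pq b d lambda T1) => //; case: sf.
Qed.

Lemma eigen_spinor b P Q : csec P -> csec Q -> pq_system d T (sgb b) mu P Q -> E (spinor b P Q).
Proof. by move=> sP sQ H; apply/(eigenP b); rewrite halfspin_spinor halfspin_spinorN. Qed.

Lemma eigen_csec b sigma : E sigma -> csec (halfspin b sigma).
Proof. by case/(eigenP b). Qed.

Lemma pq_lin s a P Q P' Q' : csec P -> csec Q -> csec P' -> csec Q' ->
  pq_system d T s mu P Q -> pq_system d T s mu P' Q' ->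
  pq_system d T s mu (fun g => a * P g + P' g) (fun g => a * Q g + Q' g).
Proof.
move=> [sP _ _] [sQ _ _] [sP' _ _] [sQ' _ _] H H' g.
have [e1 e2] := H g; have [e1' e2'] := H' g.
have eX F G (sF : csmooth F) (sG : csmooth G) :=
  congr1 (fun u => u g) (cop_lin a (@op_linear_fX R) sF sG) : cX _ g = a * cX F g + cX G g.
have eY F G (sF : csmooth F) (sG : csmooth G) :=
  congr1 (fun u => u g) (cop_lin a (@op_linear_fY R) sF sG) : cY _ g = a * cY F g + cY G g.
have eZ F G (sF : csmooth F) (sG : csmooth G) :=
  congr1 (fun u => u g) (cop_lin a (@op_linear_fZ R) sF sG) : cZ _ g = a * cZ F g + cZ G g.
split.
- rewrite mulrDr mulrCA e1 e1' /raise (eX _ _ sQ sQ') (eY _ _ sQ sQ') (eZ _ _ sP sP').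
  move: (cX Q g) (cX Q' g) (cY Q g) (cY Q' g) (cZ P g) (cZ P' g) => *; ring.
- rewrite mulrDr mulrCA e2 e2' /low (eX _ _ sP sP') (eY _ _ sP sP') (eZ _ _ sQ sQ').
  move: (cX P g) (cX P' g) (cY P g) (cY P' g) (cZ Q g) (cZ Q' g) => *; ring.
Qed.

Lemma halfspin_lin b a sigma sigma' :
  halfspin b (fun g => a *: sigma g + sigma' g) = fun g => a * halfspin b sigma g + halfspin b sigma' g.
Proof. by apply/funext => g; rewrite /halfspin !mxE. Qed.

Lemma eigen_lin a sigma sigma' : E sigma -> E sigma' -> E (fun g => a *: sigma g + sigma' g).
Proof.
move=> /(eigenP false)[s1 s2 H] /(eigenP false)[s1' s2' H'].
by apply/(eigenP false); rewrite !halfspin_lin; split; [exact: csection_lin..|exact: pq_lin].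
Qed.

Lemma eigen0 : E (fun=> 0).
Proof.
have p0 b : halfspin b (fun=> 0) = fun=> 0 :> C by apply/funext => g; rewrite /halfspin mxE.
have s0 : csec (fun=> 0).
  apply/(csectionP Heps); split; first exact: csmooth_cst.
  by move=> *; rewrite mulr0.
apply/(eigenP false); rewrite !p0; split=> // g.
have cX0 : cX (fun=> 0 : C) = fun=> 0 := cop_cst0 (@op_linear_fX R).
have cY0 : cY (fun=> 0 : C) = fun=> 0 := cop_cst0 (@op_linear_fY R).
have cZ0 : cZ (fun=> 0 : C) = fun=> 0 := cop_cst0 (@op_linear_fZ R).
by rewrite /raise /low cX0 cY0 cZ0; split; ring.
Qed.

End Eigenspace.

(** * Eigenspinors of the flat torus family *)

Section TorusEigenspinors.
Local Open Scope complex_scope.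
Context {R : realType}.
Local Notation V := 'rV[R]_3.
Local Notation C := R[i].
Implicit Types (F G P Q : V -> C) (g v : V) (sigma : V -> 'cV[C]_2).

(** The fractional part y satisfies [cos (2 pi y) = 1], hence [sin (pi y) = 0], whereas the sine is
    positive inside (0, pi). *)
Lemma cis_eq1 (x : R) : cis (2 * pi * x) = 1 :> C -> exists m : int, x = m%:~R.
Proof.
move=> cx; exists (Num.floor x); set m := Num.floor x.
have [y0 y1] : 0 <= x - m%:~R /\ x - m%:~R < 1.
  by have := floor_itv x; rewrite -/m intrD => /andP[? ?]; split; lra.
have [cy _] : cos (2 * (pi * (x - m%:~R))) = 1 :> R /\ True.
  split=> //; have : cis (2 * pi * (x - m%:~R)) = 1 :> C.
    by rewrite mulrBr cisD cx mul1r -mulrN -rmorphN cis_int.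
  by rewrite -mulrA => -[].
move: cy; rewrite mulr2n mulrDl mul1r cosD -!expr2 => cy.
have s0 : sin (pi * (x - m%:~R)) = 0.
  have := cos2Dsin2 (pi * (x - m%:~R)) => cs; apply/eqP; rewrite -sqrf_eq0; apply/eqP; lra.
have [xm|xm] := eqVneq (x - m%:~R) 0; first by apply/eqP; rewrite -subr_eq0 xm.
have : 0 < sin (pi * (x - m%:~R)).
  have p0 := pi_gt0 R; have y2 : 0 < x - m%:~R by rewrite lt_neqAle eq_sym xm.
  by apply: sin_gt0_pi; rewrite mulr_gt0//= -[ltRHS]mulr1 ltr_pM2l.
by rewrite s0 ltxx.
Qed.

Lemma cis_eq_sign (chi : int) (x : R) : is_sign chi -> cis (2 * pi * x) = chi%:~R :> C ->
  exists m : int, x = half_of chi + m%:~R.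
Proof.
move=> cs cx; have [|m Hm] := @cis_eq1 (x - half_of chi).
  by rewrite mulrDr cisD cx (cis_signN (cis_half cs)) -intrM is_sign_sq.
by exists m; rewrite -Hm addrC subrK.
Qed.

Lemma torus_paramsE (r : nat) (d1 d2 : int) (a b : R) : (0 < r)%N -> is_sign d1 -> is_sign d2 ->
  torus_params r d1 d2 (a, b) <->
  cis (2 * pi * (r%:R * a)) = d1%:~R :> C /\ cis (2 * pi * b) = d2%:~R :> C.
Proof.
move=> r0 s1 s2; have rR : r%:R != 0 :> R by rewrite pnatr_eq0 -lt0n.
have half2 (chi : int) : exists k : int, 2 * half_of chi = k%:~R :> R.
  by rewrite /half_of; case: eqP => _; [exists 0; rewrite mulr0|exists 1; rewrite divff].
split=> [[/= _ _ h1 h2]|[h1 h2]]; first by rewrite mulrA.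
have [m Hm] := cis_eq_sign s1 h1; have [n Hn] := cis_eq_sign s2 h2.
have [k Hk] := half2 d1; have [l Hl] := half2 d2.
split=> //=; last by rewrite -mulrA.
- exists (k + 2 * m); rewrite intrD intrM -Hk.
  have -> : a = (r%:R * a) / r%:R by field.
  by rewrite Hm; field.
- by exists (l + 2 * n); rewrite intrD intrM -Hl Hn; field.
Qed.

Variables (r : nat) (eps : V -> int).
Hypotheses (r0 : (0 < r)%N) (Heps : spin_structure r eps) (H3 : delta3 eps = 1).
Variables (d T : R) (lambda : C).
Hypotheses (d0 : 0 < d) (T0 : 0 < T).
Local Notation csec := (csection r eps).
Let mu : C := lambda + (d ^+ 2 * T / 4)%:C.
Local Notation E := (eigenspinors r d T eps lambda).
Let ii : 'i%C * 'i%C = -1 :> C. Proof. by rewrite -expr2 sqr_i. Qed.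

(** Off-diagonal entries of the 2 by 2 symbol of the shifted operator at frequency (a, b); [rhoc] is
    the conjugate of [rho]. *)
Definition rho (a b : R) : C := (2 * pi * d)%:C * (a%:C + 'i%C * b%:C).
Definition rhoc (a b : R) : C := (2 * pi * d)%:C * (a%:C - 'i%C * b%:C).

Let q0 : 2 * pi * d != 0. Proof. by rewrite !mulf_neq0 ?gt_eqF// ?pi_gt0. Qed.
Let q0C : (2 * pi * d)%:C != 0 :> C. Proof. by rewrite eq_complex /= eqxx andbT. Qed.

Lemma rho_mul a b : rho a b * rhoc a b = ((2 * pi * d * Num.sqrt (a ^+ 2 + b ^+ 2)) ^+ 2)%:C.
Proof.
rewrite exprMn sqr_sqrtr ?addr_ge0 ?sqr_ge0// rmorphM rmorphD !rmorphXn /=.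
transitivity ((2 * pi * d)%:C ^+ 2 * (a%:C ^+ 2 - 'i%C * 'i%C * b%:C ^+ 2)); last by rewrite ii; ring.
by rewrite /rho /rhoc; ring.
Qed.

Lemma rho_eq0 a b : rho a b = 0 -> a = 0 /\ b = 0.
Proof.
move=> /eqP; rewrite mulf_eq0 (negbTE q0C) /= eq_complex /= => /andP[/eqP h1 /eqP h2].
by split; [move: h1|move: h2]; rewrite !(mul0r, mul1r, mulr0, subr0, add0r, addr0).
Qed.

Lemma rhoc_eq0 a b : rhoc a b = 0 -> a = 0 /\ b = 0.
Proof.
move=> /eqP; rewrite mulf_eq0 (negbTE q0C) /= eq_complex /= => /andP[/eqP h1 /eqP h2].
by split; lra.
Qed.

Definition torus_eigenvalue (p : R * R * bool) : R :=
  (-1) ^+ p.2 * (2 * pi * d * Num.sqrt (p.1.1 ^+ 2 + p.1.2 ^+ 2)).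

Definition torus_label (p : R * R * bool) :=
  [/\ cis (2 * pi * (r%:R * p.1.1)) = (delta1 r eps)%:~R :> C,
      cis (2 * pi * p.1.2) = (delta2 eps)%:~R :> C & mu = (torus_eigenvalue p)%:C].

Lemma torus_label_sq a b s : torus_label (a, b, s) -> mu ^+ 2 = rho a b * rhoc a b.
Proof. by case=> _ _ ->; rewrite rho_mul -rmorphXn /torus_eigenvalue exprMn sqrr_sign mul1r. Qed.

(** An eigenvector is [(rho, mu)] unless [rho] vanishes. That happens only at zero frequency, where
    both signs give [mu = 0]; the sign then selects a vector of the standard basis, so that the two
    labels yield independent spinors. *)
Definition torus_amp (p : R * R * bool) : C * C :=
  if rho p.1.1 p.1.2 == 0 then if p.2 then (0, 1) else (1, 0) else (rho p.1.1 p.1.2, mu).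

Definition torus_spinor (p : R * R * bool) : V -> 'cV[C]_2 :=
  spinor false (fun g => (torus_amp p).1 * texp p.1.1 p.1.2 g)
    (fun g => (torus_amp p).2 * texp p.1.1 p.1.2 g).

(** The first component suffices for nonzero [rho]; at zero frequency the sign selects which
    component is read. *)
Definition torus_fun (p : R * R * bool) sigma : C :=
  tcoef r p.1.1 p.1.2 (halfspin ((rho p.1.1 p.1.2 == 0) && p.2) sigma).

Lemma torus_ampE a b s : torus_label (a, b, s) ->
  mu * (torus_amp (a, b, s)).1 = rho a b * (torus_amp (a, b, s)).2 /\
  mu * (torus_amp (a, b, s)).2 = rhoc a b * (torus_amp (a, b, s)).1.
Proof.
move=> L; have sq := torus_label_sq L; rewrite /torus_amp /=.
case: eqP => [z|_] /=; last by rewrite -expr2 sq; split; ring.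
have m0 : mu = 0 by apply/eqP; rewrite -sqrf_eq0 sq z mul0r.
have [a0 b0] := rho_eq0 z; have zc : rhoc a b = 0.
  by rewrite /rhoc a0 b0 mulr0 subrr mulr0.
by rewrite m0 z zc !mul0r.
Qed.

Lemma torus_spinor_eigen p : torus_label p -> E (torus_spinor p).
Proof.
case: p => -[a b] s L; have [e1 e2] := torus_ampE L; have [Ha Hb _] := L.
have sT := csection_texp Heps H3 Ha Hb; have [sm _ _] := sT.
have sA c := csectionZ Heps c sT.
apply: eigen_spinor => //; rewrite /torus_spinor /=.
move: e1 e2; move: (torus_amp _).1 (torus_amp _).2 => A B e1 e2 g.
have X c : cX (fun g => c * texp a b g) g = c * ('i%C * (2 * pi * a)%:C * texp a b g).
  by rewrite /cX (copZ c (@op_linear_fX R) sm) -/(cX _) texp_X.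
have Y c : cY (fun g => c * texp a b g) g = c * ('i%C * (2 * pi * b)%:C * texp a b g).
  by rewrite /cY (copZ c (@op_linear_fY R) sm) -/(cY _) texp_Y.
have Z c : cZ (fun g => c * texp a b g) g = 0.
  by rewrite /cZ (copZ c (@op_linear_fZ R) sm) -/(cZ _) texp_Z mulr0.
rewrite /raise /low !X !Y !Z /sgb expr0 !mulr0 sub0r subr0 !mulrA.
rewrite -/mu e1 e2 /rho /rhoc; move: (texp a b g) => t.
split.
- transitivity (- ('i%C * 'i%C) * ((2 * pi * d)%:C * (a%:C + 'i%C * b%:C) * B * t)).
    by rewrite ii; ring.
  by rewrite !rmorphM rmorph1; ring.
- transitivity (- ('i%C * 'i%C) * ((2 * pi * d)%:C * (a%:C - 'i%C * b%:C) * A * t)).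
    by rewrite ii; ring.
  by rewrite !rmorphM rmorph1; ring.
Qed.

Lemma torus_fun_lin p c sigma sigma' : torus_label p -> E sigma -> E sigma' ->
  torus_fun p (fun g => c *: sigma g + sigma' g) = c * torus_fun p sigma + torus_fun p sigma'.
Proof.
move=> L Es Es'; rewrite /torus_fun halfspin_lin.
exact: (tcoef_lin _ _ _ (eigen_csec Heps T0 _ Es) (eigen_csec Heps T0 _ Es')).
Qed.

Lemma torus_fun_spinor a b s a' b' s' :
  torus_label (a, b, s) -> torus_label (a', b', s') ->
  torus_fun (a, b, s) (torus_spinor (a', b', s')) =
    (if (rho a b == 0) && s then (torus_amp (a', b', s')).2 else (torus_amp (a', b', s')).1)
    * ((a == a') && (b == b'))%:R.
Proof.
move=> [Ha Hb _] [Ha' Hb' _]; rewrite /torus_fun /torus_spinor /=.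
have sT := csection_texp Heps H3 Ha' Hb'.
rewrite -(tcoef_texp r0 Heps Ha Hb Ha' Hb').
case: ifP => _.
  by rewrite (halfspin_spinorN false) (tcoef_scale a b _ sT).
by rewrite halfspin_spinor (tcoef_scale a b _ sT).
Qed.

Lemma torus_fun_self p : torus_label p -> torus_fun p (torus_spinor p) != 0.
Proof.
case: p => -[a b] s L; rewrite (torus_fun_spinor L L) !eqxx mulr1 /torus_amp /=.
by have [_|] := eqVneq (rho a b) 0; case: (s); rewrite /= ?oner_neq0.
Qed.

Lemma torus_fun_other p p' : torus_label p -> torus_label p' -> p != p' ->
  torus_fun p (torus_spinor p') = 0.
Proof.
case: p p' => -[a b] s [[a' b'] s'] L L' ne; rewrite (torus_fun_spinor L L').
have [aa|] := eqVneq a a'; last by rewrite mulr0.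
have [bb|] := eqVneq b b'; last by rewrite mulr0.
rewrite -aa -bb in ne L' *.
have ss : s != s' by apply: contraNneq ne => ->.
have [_ _ m1] := L; have [_ _ m2] := L'.
(* Opposite signs with the same [mu] force the square root to vanish, which leaves only zero
   frequency. *)
have z : rho a b == 0.
  have /eqP : rho a b * rhoc a b = 0.
    rewrite rho_mul; move: m1; rewrite m2 /torus_eigenvalue /= => /(congr1 (@complex.Re R)) /=.
    set x := _ * Num.sqrt _ => H; suff -> : x = 0 by rewrite expr0n.
    by move: ss H; case: (s) (s') => -[] //= _; rewrite expr0 expr1; lra.
  rewrite mulf_eq0 => /orP[//|/eqP/rhoc_eq0[-> ->]].
  by rewrite /rho mulr0 addr0 mulr0.
by rewrite /torus_amp /= z /=; move: ss; case: (s) (s') => -[] //= _; rewrite mul0r.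
Qed.

Lemma torus_tcoef a b sigma :
  cis (2 * pi * (r%:R * a)) = (delta1 r eps)%:~R :> C ->
  cis (2 * pi * b) = (delta2 eps)%:~R :> C -> E sigma ->
  mu * tcoef r a b (halfspin false sigma) = rho a b * tcoef r a b (halfspin true sigma) /\
  mu * tcoef r a b (halfspin true sigma) = rhoc a b * tcoef r a b (halfspin false sigma).
Proof.
move=> Ha Hb /(eigenP Heps d lambda T0 false)[/= sP sQ H].
have half P Q (c x y : C) : csec P -> csec Q ->
   (forall g, mu * P g = c * cZ P g + x * (y * cY Q g + cX Q g)) ->
   mu * tcoef r a b P = x * (y * ('i%C * (2 * pi * b)%:C) + 'i%C * (2 * pi * a)%:C) * tcoef r a b Q.
  move=> {}sP {}sQ HH.
  have sX := csection_cX sQ; have sY := csection_cY sQ; have sZ := csection_cZ sP.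
  have sL := csection_lin Heps y sY sX; have sL' := csectionZ Heps x sL.
  rewrite -(tcoef_scale a b mu sP) (_ : (fun g => mu * P g) =
     fun g => c * cZ P g + x * (y * cY Q g + cX Q g)); last by apply/funext.
  rewrite (tcoef_lin a b c sZ sL') (tcoef_Z Heps H3 a b sP) mulr0 add0r.
  rewrite (tcoef_scale a b x sL) (tcoef_lin a b y sY sX).
  rewrite (tcoef_X r0 Heps H3 Ha Hb sQ) (tcoef_Y Heps H3 a Hb sQ).
  by move: (tcoef _ _ _ _) => t; ring.
split.
- rewrite (half _ _ ('i%C * (T^-1)%:C) (- (d%:C * 'i%C)) 'i%C sP sQ).
    transitivity (- ('i%C * 'i%C) * rho a b * tcoef r a b (halfspin true sigma)); last by rewrite ii; ring.
    by rewrite /rho !rmorphM; ring.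
  by move=> g; rewrite (proj1 (H g)) /raise /sgb expr0 rmorph1; ring.
- rewrite (half _ _ (- ('i%C * (T^-1)%:C)) (- (d%:C * 'i%C)) (- 'i%C) sQ sP).
    transitivity (- ('i%C * 'i%C) * rhoc a b * tcoef r a b (halfspin false sigma)); last by rewrite ii; ring.
    by rewrite /rhoc !rmorphM; ring.
  by move=> g; rewrite (proj2 (H g)) /low /sgb expr0 rmorph1; ring.
Qed.

(** The two coefficients solve a linear system of determinant [mu^2 - rho rhoc]. If it is singular,
    (a, b) carries a label whose functional kills the first coefficient and, for nonzero [rho], the
    equation kills the second. *)
Lemma torus_kernel a b sigma :
  cis (2 * pi * (r%:R * a)) = (delta1 r eps)%:~R :> C ->
  cis (2 * pi * b) = (delta2 eps)%:~R :> C -> E sigma ->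
  (forall p, torus_label p -> torus_fun p sigma = 0) ->
  forall h, tcoef r a b (halfspin h sigma) = 0.
Proof.
move=> Ha Hb Es H; have [] := torus_tcoef Ha Hb Es.
have [u Eu] : exists u, tcoef r a b (halfspin false sigma) = u by eexists.
have [z Ev] : exists z, tcoef r a b (halfspin true sigma) = z by eexists.
rewrite Eu Ev => e1 e2; suff [u0 v0] : u = 0 /\ z = 0.
  by move=> []; [rewrite Ev|rewrite Eu].
have [sq|nsq] := eqVneq (mu ^+ 2) (rho a b * rhoc a b); last first.
  have zz x : mu ^+ 2 * x = rho a b * rhoc a b * x -> x = 0.
    move=> /eqP; rewrite -subr_eq0 -mulrBl mulf_eq0 subr_eq0 (negbTE nsq) /= => /eqP//.
  split; apply: zz; rewrite expr2 -mulrA.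
    by rewrite e1 mulrCA e2 mulrA.
  by rewrite e2 mulrCA e1 mulrA [rhoc a b * _]mulrC.
have : exists s, torus_label (a, b, s).
  move: sq; rewrite rho_mul rmorphXn => /eqP; rewrite eqf_sqr => /orP[|] /eqP m.
    by exists false; split=> //; rewrite m /torus_eigenvalue /= expr0 mul1r.
  by exists true; split=> //; rewrite m /torus_eigenvalue /= expr1 mulN1r rmorphN.
move=> [s L]; have [rz|nz] := eqVneq (rho a b) 0; last first.
  have := H _ L; rewrite /torus_fun /= (negbTE nz) /= Eu => u0; split=> //.
  by move/eqP: e1; rewrite u0 mulr0 eq_sym mulf_eq0 (negbTE nz) /= => /eqP.
(* At zero frequency both signs are labels, and their functionals read off the two components. *)
have L' s' : torus_label (a, b, s').
  have [_ _ m] := L; split=> //; rewrite m /torus_eigenvalue /=.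
  by have [-> ->] := rho_eq0 rz; rewrite expr0n addr0 sqrtr0 !mulr0.
have := H _ (L' false); have := H _ (L' true).
by rewrite /torus_fun /= rz eqxx /= Eu Ev.
Qed.

End TorusEigenspinors.

(** * Eigenspinors with nontrivial central character *)

Section LandauEigenspinors.
Local Open Scope complex_scope.
Context {R : realType}.
Local Notation V := 'rV[R]_3.
Local Notation C := R[i].
Implicit Types (F G P Q : V -> C) (g v : V) (sigma : V -> 'cV[C]_2).
Variables (r : nat) (eps : V -> int).
Hypotheses (r0 : (0 < r)%N) (Heps : spin_structure r eps).
Variables (d T : R) (lambda : C).
Hypotheses (d0 : 0 < d) (T0 : 0 < T).
Local Notation csec := (csection r eps).
Let mu : C := lambda + (d ^+ 2 * T / 4)%:C.
Local Notation E := (eigenspinors r d T eps lambda).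
Local Notation d1 := (delta1 r eps).
Let sd1 := delta1_sign Heps.
Let sd2 := delta2_sign Heps.
Let sd3 := delta3_sign Heps.

(** Half-integral n occurs only for delta3 = -1, and then r is even. *)
Lemma central_int (n : R) : cis (2 * pi * n) = (delta3 eps)%:~R :> C ->
  exists Nr : int, n * r%:R = Nr%:~R.
Proof.
move=> /(cis_eq_sign sd3) [m ->]; rewrite /half_of; case: eqP => [_|d3].
  by exists (m * r%:Z); rewrite add0r intrM.
have er : ~~ odd r by apply/negP => /(delta3_odd Heps).
exists (r./2%:Z + m * r%:Z).
rewrite intrD intrM mulrDl; congr (_ + _).
have := odd_double_half r; rewrite (negbTE er) add0n => {1}<-.
by rewrite -muln2 natrM -pmulrn mulrC mulfK.
Qed.

Lemma coef_theta (w n b n' b' : R) p : 0 < w -> n != 0 ->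
  cis (2 * pi * n) = (delta3 eps)%:~R :> C -> cis (2 * pi * n') = (delta3 eps)%:~R :> C ->
  coef n' b' (theta w n b r d1 p) =
    fun g => (n' == n)%:R * cint (1 *: delta_mx 0 1) b' (theta w n b r d1 p) g.
Proof.
move=> w0 n0 Hn Hn'; rewrite /coef.
have -> : cint (1 *: delta_mx 0 2%:R) n' (theta w n b r d1 p) =
    fun g => (n' == n)%:R * theta w n b r d1 p g.
  by apply/funext => g; exact: (theta_cint_z b w0 n0 r0 sd1 sd3 Hn).
exact/cintZ/csmooth_continuous/csmooth_theta.
Qed.

Lemma coef_texp (a b n' b' : R) : n' != 0 -> delta3 eps = 1 ->
  cis (2 * pi * n') = (delta3 eps)%:~R :> C -> coef n' b' (texp a b) = fun=> 0.
Proof.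
move=> n0 d31 Hn; have sm := csmooth_texp a b; rewrite /coef.
have -> : cint (1 *: delta_mx 0 2%:R) n' (texp a b) = fun g => 0 * texp a b g.
  apply/funext => g; rewrite (cint_exp sd3 (b' := 0) sm) ?(negbTE n0)//.
    by move=> h; rewrite mul1r -/(fZ) [LHS](congr1 (fun u => u h) (texp_Z a b)) mulr0 mulr0 mul0r.
  by rewrite mulr0 cis0 d31.
rewrite cintZ; last exact: csmooth_continuous.
by apply/funext => g; rewrite mul0r.
Qed.

(* k = 0 encodes the ground family, for which only the lower sign of mu occurs. *)
Definition landau_label (tau : R) (k : nat) :=
  [/\ 0 < tau, cis (2 * pi * tau) = (delta3 eps)%:~R :> C,
    mu ^+ 2 = (2 * pi * tau / T)%:C ^+ 2 + (2 * (2 * pi * tau) * k%:R * d ^+ 2)%:C &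
    k = 0%N -> mu = - (2 * pi * tau / T)%:C].

(* For 0 <= j < |n| r these represent the frequencies b modulo n r. *)
Definition beta (j : nat) : R := half_of (delta2 eps) + j%:R.

Let Hbeta j : cis (2 * pi * beta j) = (delta2 eps)%:~R :> C.
Proof. by rewrite mulrDr cisD (cis_half sd2) (cis_int j%:Z) mulr1. Qed.

Definition nonroot (p : {poly R}) : R := xget 0 [set x | p.[x] != 0].

Lemma nonrootP p : p != 0 -> p.[nonroot p] != 0.
Proof. by move=> /poly_neq0_root/(@xgetPex _ 0 [set x | p.[x] != 0]). Qed.

Definition landau_spinor (sb : bool) (tau : R) (k j : nat) : V -> 'cV[C]_2 :=
  spinor sb (thetaP r eps sb tau (beta j) k) (thetaQ r eps d T mu sb tau (beta j) k).

(** The evaluation point is a non-zero of the Hermite polynomial measured from the oscillator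
    centre, so the value detects the constant of the Hermite pair. *)
Definition landau_fun (sb : bool) (tau : R) (k j : nat) sigma : C :=
  coef (sgb sb * tau) (beta j) (halfspin sb sigma)
    (hpt (nonroot (hpol (2 * pi * tau) k) - beta j / (sgb sb * tau)) 0 0).

Section Label.
Variables (sb : bool) (tau : R) (k : nat).
Hypothesis L : landau_label tau k.

Lemma landau_tau_gt0 : 0 < tau. Proof. by case: L. Qed.
Lemma landau_n_neq0 : sgb sb * tau != 0.
Proof. by rewrite mulf_neq0 ?(gt_eqF landau_tau_gt0)// /sgb signr_eq0. Qed.

Lemma landau_central : cis (2 * pi * (sgb sb * tau)) = (delta3 eps)%:~R :> C.
Proof.
case: L => _ h _ _; rewrite /sgb; case: (sb); rewrite ?expr0 ?mul1r// expr1 mulN1r.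
exact: cis_signN.
Qed.

Let w0 : 0 < 2 * pi * tau. Proof. by rewrite !mulr_gt0 ?pi_gt0 ?landau_tau_gt0. Qed.

Lemma csection_landau j : csec (thetaP r eps sb tau (beta j) k) /\
  csec (thetaQ r eps d T mu sb tau (beta j) k).
Proof.
have [Nr HN] := central_int landau_central.
split; first exact: (csection_thetaP r0 Heps landau_tau_gt0 landau_central (Hbeta j) k HN).
exact: (csection_thetaQ r0 Heps d T mu landau_tau_gt0 landau_central (Hbeta j) k HN).
Qed.

Lemma landau_spinor_eigen j : E (landau_spinor sb tau k j).
Proof.
have [Nr HN] := central_int landau_central; have [sP sQ] := csection_landau j.
have [_ _ Hmu Hk] := L.
apply: (eigen_spinor Heps T0 sP sQ).
exact: (theta_pq r0 Heps d0 landau_tau_gt0 landau_central (Hbeta j) HN Hmu Hk).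
Qed.

Lemma landau_fun_lin j c sigma sigma' : E sigma -> E sigma' ->
  landau_fun sb tau k j (fun g => c *: sigma g + sigma' g) =
  c * landau_fun sb tau k j sigma + landau_fun sb tau k j sigma'.
Proof.
move=> Es Es'; rewrite /landau_fun halfspin_lin.
by rewrite (coef_lin _ _ c (eigen_csec Heps T0 sb Es) (eigen_csec Heps T0 sb Es')).
Qed.

Lemma coef_landau_other (h : bool) (n' b' : R) j : n' != sgb sb * tau ->
  cis (2 * pi * n') = (delta3 eps)%:~R :> C ->
  coef n' b' (halfspin h (landau_spinor sb tau k j)) = fun=> 0.
Proof.
move=> ne Hn'.
have z p : coef n' b' (theta (2 * pi * tau) (sgb sb * tau) (beta j) r d1 p) = fun=> 0.
  rewrite (coef_theta _ _ _ w0 landau_n_neq0 landau_central Hn') (negbTE ne).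
  by apply/funext => g; rewrite mul0r.
have [->|->] : h = sb \/ h = ~~ sb by case: (h) (sb) => -[]; tauto.
  by rewrite halfspin_spinor; exact: z.
have [Nr HN] := central_int landau_central.
have sT := csection_theta r0 Heps landau_tau_gt0 landau_central (Hbeta j) HN (hprev (2 * pi * tau) k).
rewrite halfspin_spinorN /thetaQ (coef_scale n' b' _ sT) z.
by apply/funext => g; rewrite mulr0.
Qed.

Lemma landau_fun_torus j p : delta3 eps = 1 ->
  torus_label r eps d T lambda p -> landau_fun sb tau k j (torus_spinor d T lambda p) = 0.
Proof.
move=> d31 [Ha Hb _]; have sT := csection_texp Heps d31 Ha Hb.
rewrite /landau_fun /torus_spinor.
have z c := coef_scale (sgb sb * tau) (beta j) c sT.
have zz := coef_texp p.1.1 p.1.2 (beta j) landau_n_neq0 d31 landau_central.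
case: (sb) z zz => z zz.
  by rewrite (halfspin_spinorN false) z zz mulr0.
by rewrite (halfspin_spinor false) z zz mulr0.
Qed.

Lemma landau_fun_self j : landau_fun sb tau k j (landau_spinor sb tau k j) != 0.
Proof.
have [Nr HN] := central_int landau_central.
rewrite /landau_fun halfspin_spinor /thetaP.
rewrite (coef_theta _ _ _ w0 landau_n_neq0 landau_central landau_central) eqxx mul1r.
rewrite (theta_cint_y_self w0 landau_n_neq0 r0 sd1 sd2 HN (Hbeta j)).
rewrite /thetam /ctheta /tterm /xim /tcos !mxE /= /betam mulr0 addr0 subrK.
have -> : 2 * pi * (beta j * 0 + sgb sb * tau * 0) = 0 :> R by ring.
rewrite addr0 add0r cosN cos_pihalf mulr0 cos0 expr0z expr0 !mul1r mulr1.
rewrite eq_complex /= eqxx andbT /pgauss; apply: mulf_neq0; first exact/nonrootP/hpol_neq0.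
by rewrite gt_eqF ?expR_gt0.
Qed.

Lemma landau_fun_index j j' : j%:R < tau * r%:R -> j'%:R < tau * r%:R -> j != j' ->
  landau_fun sb tau k j (landau_spinor sb tau k j') = 0.
Proof.
move=> jN jN' jj; have [Nr HN] := central_int landau_central.
rewrite /landau_fun halfspin_spinor /thetaP.
rewrite (coef_theta _ _ _ w0 landau_n_neq0 landau_central landau_central) eqxx mul1r.
apply: (theta_cint_y_other w0 landau_n_neq0 r0 sd1 sd2 HN (Hbeta j') _ _ (Hbeta j)) => m.
(* The frequencies linked to [beta j'] are its translates by multiples of [Nr], whereas j and j' are
   distinct and both less than [|Nr|]. *)
apply/eqP; rewrite /beta /betam HN -intrM -addrA => /addrI.
rewrite !pmulrn -intrD => /eqP; rewrite eqr_int => /eqP jE.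
have NE : (absz Nr)%:R = tau * r%:R :> R.
  rewrite natr_absz intr_norm -HN !normrM /sgb normr_sign mul1r.
  by rewrite (gtr0_norm landau_tau_gt0) ger0_norm.
rewrite -NE !ltr_nat in jN jN'.
have [m0|m0] := eqVneq m 0; first by move: jE jj; rewrite m0 mulr0 addr0 => -[->]; rewrite eqxx.
have : (absz Nr <= absz (Nr * m)%R)%N by rewrite abszM leq_pmulr// absz_gt0.
by move: (Nr * m)%R jE => x jE; lia.
Qed.

End Label.

(** Lattice translation reduces any frequency to some [beta j]; there the classification leaves a
    Hermite pair with one free constant, and a vanishing functional forces that constant to be 0. *)
Lemma landau_kernel sigma : E sigma ->
  (forall sb tau k j, landau_label tau k -> j%:R < tau * r%:R -> landau_fun sb tau k j sigma = 0) ->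
  forall n b, n != 0 -> cis (2 * pi * n) = (delta3 eps)%:~R :> C ->
    cis (2 * pi * b) = (delta2 eps)%:~R :> C ->
  forall h x, coef n b (halfspin h sigma) (hpt x 0 0) = 0.
Proof.
move=> Es H n b n0 Hn Hb h x.
have [Nr HN] := central_int Hn.
have [i Hi] := cis_eq_sign sd2 Hb.
have Nr0 : Nr != 0.
  by apply: contraNneq n0 => N0; move/eqP: HN; rewrite N0 mulf_eq0 pnatr_eq0 -leqn0 leqNgt r0 orbF.
pose sb := n < 0; pose tau := `|n|.
have nE : n = sgb sb * tau by rewrite /sgb /tau /sb -numEsign.
have tau0 : 0 < tau by rewrite normr_gt0.
have Htau : cis (2 * pi * tau) = (delta3 eps)%:~R :> C.
  by rewrite /tau; case: (ltrgt0P n) n0 => //= _ _; exact: cis_signN.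
(* Euclidean division of the integral part of b; the remainder lies in [0, [|Nr|]) even for negative
   [Nr]. *)
pose m := (i %/ Nr)%Z; pose j := absz (i %% Nr)%Z.
have jE : j%:Z = (i %% Nr)%Z by rewrite gez0_abs// modz_ge0.
have bE : b = beta j + n * r%:R * m%:~R.
  rewrite /beta; have -> : j%:R = (i %% Nr)%Z%:~R :> R by rewrite -jE.
  rewrite HN Hi -addrA -intrM -intrD; congr (_ + _%:~R).
  by rewrite addrC mulrC; exact: divz_eq.
have jN : j%:R < tau * r%:R.
  have -> : tau * r%:R = (absz Nr)%:R.
    by rewrite natr_absz intr_norm -HN normrM (ger0_norm (ler0n R r)).
  by rewrite ltr_nat -ltz_nat jE; exact: ltz_mod.
suff Hz h' y : coef n (beta j) (halfspin h' sigma) (hpt y 0 0) = 0.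
  have := coef_translate Heps (beta j) Hn m x (eigen_csec Heps T0 h Es).
  rewrite Hz -bE => /esym/eqP; rewrite mulf_eq0 intr_eq0.
  by case: (is_sign_exp m sd1) => -> /=; move/eqP.
have Hbj := Hbeta j.
have [sP sQ sys] := proj1 (eigenP Heps d lambda T0 sb sigma) Es.
rewrite nE in Hn *.
suff Z z : coef (sgb sb * tau) (beta j) (halfspin sb sigma) (hpt z 0 0) = 0 /\
    coef (sgb sb * tau) (beta j) (halfspin (~~ sb) sigma) (hpt z 0 0) = 0.
  by have [->|->] : h' = sb \/ h' = ~~ sb by [case: (h') (sb) => -[]; tauto];
    [exact: (proj1 (Z y))|exact: (proj2 (Z y))].
have [Z|[k [e1 e2 [c Hc]]]] := coef_classification r0 Heps d0 tau0 Hn Hbj sP sQ sys.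
  exact: Z.
have L : landau_label tau k by split.
have := H sb tau k j L jN; rewrite /landau_fun (proj1 (Hc _)) => /eqP.
rewrite mulf_eq0 => /orP[/eqP c0|]; last first.
  have w0 : 0 < 2 * pi * tau by rewrite !mulr_gt0 ?pi_gt0.
  rewrite eq_complex /= eqxx andbT mulf_eq0 (gt_eqF (expR_gt0 _)) orbF.
  by rewrite (negbTE (nonrootP (hpol_neq0 k w0))).
have := Hc (z + beta j / (sgb sb * tau)); rewrite addrK c0 !mul0r.
exact.
Qed.

End LandauEigenspinors.

(** * Multiplicities *)

Section EigenspaceDimension.
Local Open Scope complex_scope.
Context {R : realType}.
Local Notation V := 'rV[R]_3.
Local Notation C := R[i].
Variables (r : nat) (eps : V -> int).
Hypotheses (r0 : (0 < r)%N) (Heps : spin_structure r eps).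
Variables (d T : R) (lambda : C).
Hypotheses (d0 : 0 < d) (T0 : 0 < T).
Local Notation E := (eigenspinors r d T eps lambda).
Local Notation tlabel := (torus_label r eps d T lambda).
Local Notation llabel := (landau_label eps d T lambda).

Variables (TT : finType) (tp : TT -> R * R * bool).
Hypotheses (tp_inj : injective tp) (tpP : forall t, delta3 eps = 1 /\ tlabel (tp t))
  (tp_surj : forall p, delta3 eps = 1 -> tlabel p -> exists t, tp t = p).
Variables (LL : finType) (ltau : LL -> R) (lk lN : LL -> nat).
Hypotheses (ltau_inj : injective ltau) (lP : forall l, llabel (ltau l) (lk l))
  (l_surj : forall tau k, llabel tau k -> exists l, ltau l = tau /\ lk l = k)
  (lNE : forall l, (lN l)%:R = ltau l * r%:R).

(** Besides the torus labels: for each Landau label the [tau r] residues of y-frequencies, doubled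
    by the sign of the central character. *)
Let I : finType := (TT + {l : LL & 'I_(lN l)} * bool)%type.

Let e (i : I) : V -> 'cV[C]_2 := match i with
  | inl t => torus_spinor d T lambda (tp t)
  | inr (existT l j, sb) => landau_spinor r eps d T lambda sb (ltau l) (lk l) j
  end.

Let f (i : I) : (V -> 'cV[C]_2) -> C := match i with
  | inl t => torus_fun r d (tp t)
  | inr (existT l j, sb) => landau_fun eps sb (ltau l) (lk l) j
  end.

Let torus_landau l j sb t : torus_fun r d (tp t)
  (landau_spinor r eps d T lambda sb (ltau l) (lk l) j) = 0.
Proof.
have [d31 [Ha Hb _]] := tpP t; rewrite /torus_fun /tcoef.
have L := lP l; have n0 := landau_n_neq0 sb L.
rewrite (coef_landau_other r0 Heps L) 1?eq_sym//.
  by rewrite /cint /= !J0; apply: complexP => /=; ring.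
by rewrite mulr0 cis0 d31.
Qed.

Let f_other i j : i != j -> f i (e j) = 0.
Proof.
case: i j => [t|[[l j] sb]] [t'|[[l' j'] sb']] ne /=.
- have [d31 L] := tpP t; have [_ L'] := tpP t'.
  apply: (torus_fun_other r0 Heps d31 d0 L L'); apply: contraNneq ne => /tp_inj ->; exact: eqxx.
- exact: torus_landau.
- by have [d31 L] := tpP t'; apply: (landau_fun_torus Heps sb (lP l) j d31 L).
- have L := lP l; have L' := lP l'.
  have [nn|nn] := eqVneq (sgb sb * ltau l) (sgb sb' * ltau l'); last first.
    rewrite /landau_fun (coef_landau_other r0 Heps L')//.
    exact: (landau_central sb L).
  have tl := landau_tau_gt0 L; have tl' := landau_tau_gt0 L'.
  (* Both [tau] are positive, so the central character determines its sign and its absolute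
     value. *)
  have [ss tt] : sb = sb' /\ ltau l = ltau l'.
    by move: nn; rewrite /sgb; case: (sb) (sb') => -[]; rewrite ?expr0 ?expr1 => nn; split=> //; lra.
  have ll := ltau_inj tt; rewrite -{}ss in ne *.
  case: l' / ll j' ne {L' tl' tt nn} => j' ne.
  have jN (k : 'I_(lN l)) : k%:R < ltau l * r%:R by rewrite -lNE ltr_nat.
  apply: (landau_fun_index r0 Heps d0 T0 sb L (jN _) (jN _)).
  by apply: contraNneq ne => /val_inj ->; exact: eqxx.
Qed.

Let f_self i : f i (e i) != 0.
Proof.
case: i => [t|[[l j] sb]] /=.
  by have [d31 L] := tpP t; exact: (torus_fun_self r0 Heps d31 L).
exact: (landau_fun_self r0 Heps sb (lP l) j).
Qed.

Let e_eigen i : E (e i).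
Proof.
case: i => [t|[[l j] sb]] /=.
  by have [d31 L] := tpP t; exact: (torus_spinor_eigen Heps d31 d0 T0 L).
exact: (landau_spinor_eigen r0 Heps d0 T0 sb (lP l) j).
Qed.

Let f_ker sigma : E sigma -> (forall i, f i sigma = 0) -> forall g, sigma g = 0.
Proof.
move=> Es H g.
suff Z h : halfspin h sigma g = 0 by exact: (@halfspin_eq0 _ false); exact: Z.
apply: (coef_vanish Heps (eigen_csec Heps T0 h Es)) => n b Hn Hb x.
have [n0|n0] := eqVneq n 0.
  have no1 : (1 : R) = -1 -> False by move=> /eqP; rewrite -addr_eq0 -mulr2n pnatr_eq0.
  (* The central character 0 takes the value 1 on the centre, so it cannot occur for delta3 = -1. *)
  have d31 : delta3 eps = 1.
    case: (delta3_sign Heps) => // d3.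
    by move: Hn; rewrite n0 d3 mulr0 => /cis_sign[]; rewrite cos0 rmorphN1 => /no1[].
  rewrite n0; apply: (coef0_eq0 r0 Heps d31 (eigen_csec Heps T0 h Es) Hb) => a Ha.
  apply: (torus_kernel r0 Heps d31 d0 T0 Ha Hb Es) => p Lp.
  by have [t <-] := tp_surj d31 Lp; exact: (H (inl t)).
apply: (landau_kernel r0 Heps d0 T0 Es _ n0 Hn Hb) => sb tau k j L jN.
have [l [lt lk']] := l_surj L; rewrite -lt -lk' in jN *.
have jN' : (j < lN l)%N by rewrite -(ltr_nat R) lNE.
exact: (H (inr (existT _ l (Ordinal jN'), sb))).
Qed.

Lemma eigenspace_dim : has_dim E (#|TT|%:R + \sum_l 2 * ltau l * r%:R)%:E.
Proof.
have -> : #|TT|%:R + \sum_l 2 * ltau l * r%:R = #|I|%:R :> R.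
  rewrite card_sum natrD card_prod card_bool card_tagged natrM; congr (_ + _).
  rewrite sumnE big_map big_enum /= natr_sum mulr_suml; apply: eq_bigr => l _.
  by rewrite card_ord lNE; ring.
apply: (dual_has_dim (e := e) (l := f)) => //.
- exact: eigen0.
- by move=> a f1 f2; exact: eigen_lin.
- case=> [t|[[l j] sb]] a f1 f2 E1 E2 /=.
    by have [_ L] := tpP t; exact: (torus_fun_lin Heps T0 a L E1 E2).
  exact: (landau_fun_lin Heps T0 sb (ltau l) (lk l) j a E1 E2).
Qed.

End EigenspaceDimension.

From mathcomp Require Import finmap.

(** * Finite index sets and extended real sums *)

Section FiniteSums.
Local Open Scope complex_scope.
Context {R : realType}.

Lemma fset_set_val (U : choiceType) (A : set U) (x : fset_set A) : finite_set A -> A (val x).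
Proof. by move=> fA; have := valP x; rewrite in_fset_set// => /set_mem. Qed.

Lemma fset_set_ex (U : choiceType) (A : set U) (p : U) : finite_set A -> A p ->
  exists x : fset_set A, val x = p.
Proof.
move=> fA Ap; have h : p \in fset_set A by rewrite in_fset_set//; exact/mem_set.
by exists [` h]%fset.
Qed.

Lemma esum_fset_set (U : choiceType) (A : set U) (F : U -> R) : finite_set A ->
  (forall p, A p -> 0 <= F p) ->
  \esum_(p in A) (F p)%:E = (\sum_(x : fset_set A) F (val x))%:E.
Proof.
move=> fA F0; rewrite esum_fset//; last by move=> p /set_mem; rewrite lee_fin => /F0.
by rewrite fsbig_finite// sumEFin big_seq_fsetE.
Qed.

Lemma finite_int_box (K : nat) : finite_set [set m : int | (absz m <= K)%N].
Proof.
apply: (@sub_finite_set _ _ ((fun k : nat => k%:Z - K%:Z) @` `I_(2 * K).+1)).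
  by move=> m /= mK; exists (absz (m + K%:Z)); rewrite /=; lia.
exact/finite_image/finite_II.
Qed.

Lemma finite_setT_bool : finite_set [set: bool].
Proof.
apply: (@sub_finite_set _ _ ((fun k : nat => k == 0%N) @` `I_2)).
  by move=> [] _; [exists 0%N|exists 1%N].
exact/finite_image/finite_II.
Qed.

Lemma int_bound (x : R) : exists K : nat, forall m : int, `|m%:~R| <= x -> (absz m <= K)%N.
Proof.
exists (Num.truncn x) => m mx; rewrite -ltnS -(ltr_nat R) natr_absz intr_norm.
apply: le_lt_trans mx _; exact: truncnS_gt.
Qed.

End FiniteSums.

(** * Matching labels with the listed eigenvalues *)

Section Spectrum.
Local Open Scope complex_scope.
Context {R : realType}.
Local Notation V := 'rV[R]_3.
Local Notation C := R[i].
Variables (r : nat) (eps : V -> int).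
Hypotheses (r0 : (0 < r)%N) (Heps : spin_structure r eps).
Variables (d T : R) (lambda : C).
Hypotheses (d0 : 0 < d) (T0 : 0 < T).
Local Notation E := (eigenspinors r d T eps lambda).
Local Notation tlabel := (torus_label r eps d T lambda).
Local Notation llabel := (landau_label eps d T lambda).
Local Notation mu := (lambda + (d ^+ 2 * T / 4)%:C).

Lemma shifted_eigenvalue (x : R) : (- (d ^+ 2 * T / 4) + x)%:C = lambda <-> mu = x%:C.
Proof.
split=> [<-|H]; first by rewrite -rmorphD addrAC addNr add0r.
by rewrite -[lambda](addrK ((d ^+ 2 * T / 4)%:C)) H -rmorphB addrC.
Qed.

Lemma torus_labelE p : torus_params r (delta1 r eps) (delta2 eps) p.1 /\
  (ev_torus d T p.1.1 p.1.2 p.2)%:C = lambda <-> tlabel p.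
Proof.
case: p => -[a b] s /=.
have H1 := torus_paramsE a b r0 (delta1_sign Heps) (delta2_sign Heps).
by split=> [[/H1[h1 h2] /shifted_eigenvalue h3]|[h1 h2 h3]]; split=> //;
  [exact/H1|exact/shifted_eigenvalue].
Qed.

Lemma torus_labels_finite : finite_set tlabel.
Proof.
(* All labels for the given eigenvalue lie on the circle of radius [M], and their coordinates have
   bounded denominators. *)
pose M := `|complex.Re mu| / (2 * pi * d).
have [K HK] := int_bound (M * (2 * r%:R)); have [L HL] := int_bound (M * 2).
have q0 : 0 < 2 * pi * d by rewrite !mulr_gt0// pi_gt0.
have rR : 0 < r%:R :> R by rewrite ltr0n.
pose f (u : int * int * bool) : R * R * bool := ((u.1.1%:~R / (2 * r%:R), u.1.2%:~R / 2), u.2).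
apply: (@sub_finite_set _ _ (f @` ([set m | (absz m <= K)%N] `*` [set m | (absz m <= L)%N] `*` setT))).
  move=> [[a b] s] Lp; have [[[m /= Hm] [n /= Hn] _ _] _] := proj2 (torus_labelE _) Lp.
  have [_ _ mE] := Lp.
  have MS : M = Num.sqrt (a ^+ 2 + b ^+ 2).
    have x0 : 0 <= 2 * pi * d * Num.sqrt (a ^+ 2 + b ^+ 2) by rewrite mulr_ge0 ?sqrtr_ge0 ?(ltW q0).
    rewrite /M mE /torus_eigenvalue /= normrM normr_sign mul1r (ger0_norm x0).
    by rewrite mulrAC mulfV ?mul1r// gt_eqF.
  have aM : `|a| <= M by rewrite MS -sqrtr_sqr ler_wsqrtr// lerDl sqr_ge0.
  have bM : `|b| <= M by rewrite MS -sqrtr_sqr ler_wsqrtr// lerDr sqr_ge0.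
  exists ((m, n), s); last by rewrite /f /= -Hm -Hn.
  split=> //; split=> /=.
    apply: HK; have -> : m%:~R = a * (2 * r%:R) by rewrite Hm; field; rewrite gt_eqF.
    have r2 : 0 < 2 * r%:R :> R by rewrite mulr_gt0.
    by rewrite normrM (gtr0_norm r2) ler_wpM2r// ltW.
  apply: HL; have -> : n%:~R = b * 2 by rewrite Hn; field.
  by rewrite normrM (gtr0_norm (ltr0n R 2)) ler_wpM2r.
apply: finite_image; apply: finite_setX; last exact: finite_setT_bool.
by apply: finite_setX; exact: finite_int_box.
Qed.

(** For fixed [tau] the prescribed value of [mu^2] is affine in k with nonzero slope. *)
Lemma landau_label_inj tau k k' : llabel tau k -> llabel tau k' -> k = k'.
Proof.
move=> [t0 _ e1 _] [_ _ e2 _]; move: e1; rewrite e2 => /addrI /complexI.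
have d20 : d ^+ 2 != 0 by rewrite gt_eqF ?exprn_gt0.
have w0 : 2 * (2 * pi * tau) != 0 by rewrite gt_eqF// !mulr_gt0// pi_gt0.
by move=> /(mulIf d20) /(mulfI w0) /eqP; rewrite eqr_nat => /eqP.
Qed.

Lemma landau_ground tau : 0 < tau -> cis (2 * pi * tau) = (delta3 eps)%:~R :> C ->
  (ev_ground d T tau)%:C = lambda <-> llabel tau 0.
Proof.
move=> t0 ct; rewrite /ev_ground -/(2 * pi * tau / T) shifted_eigenvalue rmorphN.
split=> [H|[_ _ _ /(_ erefl)//]]; split=> //.
by rewrite H sqrrN !(mulr0, mul0r) addr0.
Qed.

Lemma landau_excited tau k s : 0 < tau -> cis (2 * pi * tau) = (delta3 eps)%:~R :> C -> (0 < k)%N ->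
  (ev_excited d T tau k s)%:C = lambda -> llabel tau k.
Proof.
move=> t0 ct k0 /shifted_eigenvalue H; split=> //; last by move=> k00; rewrite k00 in k0.
rewrite H -!rmorphXn -rmorphD; congr (_%:C).
rewrite exprMn sqrr_sign mul1r exprMn sqr_sqrtr; first by field; rewrite gt_eqF.
have p0 := pi_gt0 R.
by rewrite addr_ge0// !mulr_ge0 ?invr_ge0 ?exprn_ge0 ?(ltW d0) ?(ltW t0) ?(ltW p0) ?(ltW T0).
Qed.

Lemma landau_excited_ex tau k : (0 < k)%N -> llabel tau k ->
  exists s, (ev_excited d T tau k s)%:C = lambda.
Proof.
move=> k0 [t0 ct e _].
set x := 2 * Num.sqrt (pi ^+ 2 * tau ^+ 2 * (T ^+ 2)^-1 + k%:R * pi * d ^+ 2 * tau).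
have p0 := pi_gt0 R.
have : mu ^+ 2 = x%:C ^+ 2.
  rewrite e -!rmorphXn -rmorphD; congr (_%:C); rewrite /x [RHS]exprMn sqr_sqrtr.
    by field; rewrite gt_eqF.
  by rewrite addr_ge0// !mulr_ge0 ?invr_ge0 ?exprn_ge0 ?(ltW d0) ?(ltW t0) ?(ltW p0) ?(ltW T0).
move=> /eqP; rewrite eqf_sqr => /orP[|] /eqP m.
  by exists false; apply/shifted_eigenvalue; rewrite m expr0 mul1r.
by exists true; apply/shifted_eigenvalue; rewrite m expr1 mulN1r rmorphN.
Qed.

Lemma ev_excited_inj tau k s s' : 0 < tau -> (0 < k)%N ->
  ev_excited d T tau k s = ev_excited d T tau k s' -> s = s'.
Proof.
move=> t0 k0 /addrI; set x := 2 * _.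
have x0 : 0 < x.
  have p0 := pi_gt0 R.
  rewrite mulr_gt0// sqrtr_gt0 ltr_wpDl ?mulr_gt0 ?exprn_gt0 ?ltr0n//.
  by rewrite !mulr_ge0 ?invr_ge0 ?exprn_ge0 ?(ltW t0) ?(ltW p0) ?(ltW T0).
by case: s s' => -[] //; rewrite expr0 expr1 => h; exfalso; lra.
Qed.

(** Stands for the positive integers or the half-odd numbers, so that both values of delta3 share
    one dimension count. *)
Variable taus : set R.
Hypotheses (tausP : forall tau, taus tau <-> 0 < tau /\ cis (2 * pi * tau) = (delta3 eps)%:~R :> C)
  (taus_half : forall tau, taus tau -> exists q : nat, tau = q%:R / 2).

Let ground := [set t | taus t /\ (ev_ground d T t)%:C = lambda].
Let excited := [set p : R * nat * bool | [/\ taus p.1.1, (0 < p.1.2)%N &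
  (ev_excited d T p.1.1 p.1.2 p.2)%:C = lambda]].

Let groundP t : ground t -> llabel t 0.
Proof. by move=> [/tausP[t0 ct]]; move/(landau_ground t0 ct). Qed.

Let excitedP p : excited p -> llabel p.1.1 p.1.2.
Proof. by move=> [/tausP[t0 ct] k0]; exact: landau_excited. Qed.

Let excited_inj p p' : excited p -> excited p' -> p.1.1 = p'.1.1 -> p.1.2 = p'.1.2 -> p = p'.
Proof.
case: p p' => -[a k] s [[a' k'] s'] [/tausP[t0 _] k0 e] [_ _ e'] /= aE kE.
rewrite /= in t0 k0 e e'; rewrite -aE -kE in e' *.
by congr (_, _); apply: (ev_excited_inj t0 k0); apply: complexI; rewrite e e'.
Qed.

Lemma ground_finite : finite_set ground.
Proof.
apply: (@sub_finite_set _ _ [set - (complex.Re mu * T / (2 * pi))]); last exact: finite_set1.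
move=> t /groundP [_ _ _ /(_ erefl) ->] /=; have p0 := pi_gt0 R.
by move: (pi : R) p0 => p p0; field; rewrite !gt_eqF.
Qed.

Lemma excited_finite : finite_set excited.
Proof.
(* Both summands of [mu^2] are nonnegative: the first bounds [tau], hence the integer 2 tau, and the
   second bounds k because [tau >= 1/2]. *)
pose M := `|complex.Re mu|; have p0 := pi_gt0 R.
have [K HK] := int_bound (M * T / pi).
have [L HL] := int_bound (M ^+ 2 / (2 * pi * d ^+ 2)).
pose f (u : nat * nat * bool) : R * nat * bool := ((u.1.1%:R / 2, u.1.2), u.2).
apply: (@sub_finite_set _ _ (f @` (`I_K.+1 `*` `I_L.+1 `*` setT))).
  move=> [[tau k] s] Xp; have [/taus_half[q tq] /= k0 ev] := Xp.
  have [t0 _ mE _] := excitedP Xp; rewrite /= in t0 mE tq.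
  have mR : mu = (complex.Re mu)%:C.
    by move: ev => /= /shifted_eigenvalue ->.
  have M2 : M ^+ 2 = (2 * pi * tau / T) ^+ 2 + 2 * (2 * pi * tau) * k%:R * d ^+ 2.
    move: mE; rewrite mR -!rmorphXn -rmorphD => /complexI <-.
    by rewrite /M real_normK ?num_real.
  have w1 : 0 <= 2 * (2 * pi * tau) * k%:R * d ^+ 2.
    by rewrite !mulr_ge0 ?exprn_ge0 ?(ltW t0) ?(ltW p0) ?(ltW d0).
  have q1 : (1 <= q)%N by rewrite lt0n; apply: contraTneq t0 => q0; rewrite tq q0 mul0r ltxx.
  exists ((q, k), s); last by rewrite /f /= -tq.
  split=> //; split=> /=; rewrite ltnS.
    apply: (HK q%:Z).
    have nM : 2 * pi * tau / T <= M.
      rewrite -(@ler_pXn2r _ 2)// ?nnegrE ?normr_ge0 ?mulr_ge0 ?invr_ge0 ?(ltW t0) ?(ltW p0) ?(ltW T0)//.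
      by rewrite M2 lerDl.
    rewrite ger0_norm ?ler0n// -[q%:~R]/(q%:R : R).
    have -> : q%:R = 2 * pi * tau / T * T / pi :> R.
      by rewrite tq; move: (pi : R) p0 => p p0; field; rewrite !gt_eqF.
    by rewrite ler_pM2r ?invr_gt0// ler_pM2r.
  apply: (HL k%:Z); rewrite ger0_norm ?ler0n// -[k%:~R]/(k%:R : R).
  rewrite ler_pdivlMr ?mulr_gt0 ?exprn_gt0// M2.
  have t2 : 2^-1 <= tau by rewrite tq -[leLHS]mul1r ler_pM2r ?invr_gt0// ler1n.
  apply: (@le_trans _ _ (2 * (2 * pi * tau) * k%:R * d ^+ 2)); last by rewrite lerDr sqr_ge0.
  have -> : k%:R * (2 * pi * d ^+ 2) = (4 * pi * k%:R * d ^+ 2) * 2^-1 by field.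
  have -> : 2 * (2 * pi * tau) * k%:R * d ^+ 2 = (4 * pi * k%:R * d ^+ 2) * tau by ring.
  by rewrite ler_wpM2l// !mulr_ge0 ?exprn_ge0 ?(ltW t0) ?(ltW p0) ?(ltW d0).
apply: finite_image; apply: finite_setX; last exact: finite_setT_bool.
by apply: finite_setX; exact: finite_II.
Qed.

Lemma spectrum_dim (TT : finType) (tp : TT -> R * R * bool) : injective tp ->
  (forall t, delta3 eps = 1 /\ tlabel (tp t)) ->
  (forall p, delta3 eps = 1 -> tlabel p -> exists t, tp t = p) ->
  has_dim E ((#|TT|%:R)%:E + mult_ground taus r d T lambda + mult_excited taus r d T lambda)%E.
Proof.
move=> tp_inj tpP tp_surj.
have gf := ground_finite; have xf := excited_finite.
have t_ge0 tau : taus tau -> 0 <= 2 * tau * r%:R by move=> /tausP[t0 _]; rewrite !mulr_ge0// ltW.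
rewrite /mult_ground -/ground (esum_fset_set gf); last by move=> t [/t_ge0].
rewrite /mult_excited -/excited (esum_fset_set (F := fun p => 2 * p.1.1 * r%:R) xf); last first.
  by move=> p [/t_ge0].
pose LL : finType := (fset_set ground + fset_set excited)%type.
pose ltau (l : LL) : R := match l with inl g => val g | inr x => (val x).1.1 end.
pose lk (l : LL) : nat := match l with inl g => 0%N | inr x => (val x).1.2 end.
have lP l : llabel (ltau l) (lk l).
  case: l => [g|x] /=; first exact: (groundP (fset_set_val g gf)).
  exact: (excitedP (fset_set_val x xf)).
have -> : ((#|TT|%:R)%:E + (\sum_(x : fset_set ground) 2 * val x * r%:R)%:E +
    (\sum_(x : fset_set excited) 2 * (val x).1.1 * r%:R)%:E)%E
    = (#|TT|%:R + \sum_l 2 * ltau l * r%:R)%:E :> \bar R.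
  by rewrite -!EFinD big_sumType /= addrA.
(* The product [tau r] is an integer by [central_int], so the floor recovers it exactly as a number
   of residues. *)
apply: (eigenspace_dim r0 Heps d0 T0 tp_inj tpP tp_surj (lk := lk)
  (lN := fun l => absz (Num.floor (ltau l * r%:R)))) => //.
(* Equal [tau] forces equal k, which separates ground from excited labels; for k > 0 the square root
   is positive and the sign is determined as well. *)
- move=> l l' e; have kk : lk l = lk l'.
    by have := lP l'; rewrite -e; exact: landau_label_inj.
  case: l l' e kk => [g|x] [g'|x'] /= e kk.
  + by congr inl; apply: val_inj.
  + by have [_] := fset_set_val x' xf; rewrite -kk.
  + by have [_] := fset_set_val x xf; rewrite kk.
  + congr inr; apply: val_inj.
    exact: excited_inj (fset_set_val x xf) (fset_set_val x' xf) e kk.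
- move=> tau k L; have [t0 ct _ _] := L.
  have tt : taus tau by apply/tausP.
  case: k L => [|k] L.
    have [|x <-] := fset_set_ex (p := tau) gf; last by exists (inl x).
    by split=> //; apply/landau_ground.
  have [s es] := landau_excited_ex (ltn0Sn k) L.
  have [|x xE] := fset_set_ex (p := (tau, k.+1, s)) xf; first by [].
  by exists (inr x); rewrite /= xE.
- move=> l; have [t0 ct _ _] := lP l; have [N HN] := central_int Heps ct.
  rewrite HN intrKfloor natr_absz ger0_norm//.
  by rewrite -(ler0z R) -HN mulr_ge0// ltW.
Qed.

End Spectrum.

(** * Admissible values of tau for each sign of delta3 *)

Section CentralCharacters.
Local Open Scope complex_scope.
Context {R : realType}.
Local Notation C := R[i].

Lemma pos_natsP (tau : R) : pos_nats tau <-> 0 < tau /\ cis (2 * pi * tau) = (1 : int)%:~R :> C.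
Proof.
split=> [[n n0 ->]|[t0 ct]]; first by rewrite ltr0n (cis_int n%:Z).
have [m Hm] := cis_eq_sign (or_introl erefl) ct; move: Hm; rewrite /half_of eqxx add0r => Hm.
rewrite Hm ltr0z in t0; exists (absz m); first by lia.
by rewrite Hm natr_absz gtr0_norm.
Qed.

Lemma half_oddsP (tau : R) : half_odds tau <-> 0 < tau /\ cis (2 * pi * tau) = (-1 : int)%:~R :> C.
Proof.
have hE : half_of (-1) = 2^-1 :> R by [].
have s : is_sign (-1) by right.
split=> [[n ->]|[t0 ct]].
  split; first by rewrite ltr_wpDl.
  by rewrite mulrDr cisD (cis_int n%:Z) mul1r -hE; exact: cis_half.
have [m Hm] := cis_eq_sign s ct; rewrite hE in Hm.
have m0 : 0 <= m.
  have : (-1)%:~R < m%:~R :> R by rewrite rmorphN1; move: t0; rewrite Hm; lra.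
  by rewrite ltr_int; lia.
by exists (absz m); rewrite Hm natr_absz ger0_norm// addrC.
Qed.

End CentralCharacters.
Theorem theorem3p1 (R : realType) (r : nat) (d T : R)
    (hr : (0 < r)%N) (hd : 0 < d) (hT : 0 < T) :
  (forall eps eps' : 'rV[R]_3 -> int,
     spin_structure r eps -> spin_structure r eps' ->
     delta1 r eps = delta1 r eps' -> delta2 eps = delta2 eps' ->
     delta3 eps = delta3 eps' ->
     forall g, lattice r g -> eps g = eps' g) /\
  (forall d1 d2 d3 : int, is_sign d1 -> is_sign d2 -> is_sign d3 ->
     ((exists eps : 'rV[R]_3 -> int,
         [/\ spin_structure r eps, delta1 r eps = d1, delta2 eps = d2
           & delta3 eps = d3])
      <-> (d3 = -1 -> ~~ odd r))) /\
  (forall eps : 'rV[R]_3 -> int, spin_structure r eps ->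
   forall lambda : complex R,
     (delta3 eps = 1 ->
        has_dim (eigenspinors r d T eps lambda)
          (mult_torus r d T (delta1 r eps) (delta2 eps) lambda
           + mult_ground (@pos_nats R) r d T lambda
           + mult_excited (@pos_nats R) r d T lambda)%E) /\
     (delta3 eps = -1 ->
        has_dim (eigenspinors r d T eps lambda)
          (mult_ground (@half_odds R) r d T lambda
           + mult_excited (@half_odds R) r d T lambda)%E)).

Proof.
split; first by move=> eps eps'; exact: spin_structure_unique.
split; first by move=> d1 d2 d3; exact: spin_structure_exists.
move=> eps Heps lambda; split=> d3.
- have tf : finite_set (torus_label r eps d T lambda) by exact: torus_labels_finite.
  pose TT : finType := fset_set (torus_label r eps d T lambda).
  have -> : mult_torus r d T (delta1 r eps) (delta2 eps) lambda = (#|TT|%:R)%:E :> \bar R.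
    rewrite /mult_torus (_ : [set p | _] = torus_label r eps d T lambda); last first.
      by apply/seteqP; split=> p; [move/(torus_labelE hr Heps)|move=> L; exact/(torus_labelE hr Heps)].
    by rewrite (esum_fset_set (F := fun=> 1) tf)// sumr_const.
  apply: (spectrum_dim hr Heps hd hT _ _ (tp := fun x : TT => val x)) => //.
  + by move=> tau; rewrite d3; exact: pos_natsP.
  + by move=> tau [n _ ->]; exists (2 * n)%N; rewrite natrM mulrAC divff ?mul1r.
  + by move=> t; split=> //; exact: fset_set_val.
  + by move=> p _; exact: fset_set_ex.
(* The torus family is absent for delta3 = -1, so it is indexed by the empty type with a dummy
   parameter map. *)
- have := @spectrum_dim R r eps hr Heps d T lambda hd hT (@half_odds R) _ _ 'I_0 (fun=> (0, 0, false)).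
  rewrite card_ord add0r; apply.
  + by move=> tau; rewrite d3; exact: half_oddsP.
  + by move=> tau [n ->]; exists (2 * n + 1)%N; rewrite natrD natrM; field.
  + by move=> [].
  + by move=> [].
  + by move=> p; rewrite d3.
Qed.
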